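(* Let $A$ be a commutative ring satisfying: (1) $\mu_2(A)=\{\pm1\}$ and $-1\in(A^\times)^2$; (2) the complex $X_\bullet(A^2)\to\mathbb{Z}$ is exact in dimension $<2$; (3) $H_3(B(A),\mathbb{Z})\simeq H_3(T(A),\mathbb{Z})$ (via the inclusion $T(A)\subseteq B(A)$). Then there exists an exact sequence $$H_3(\mathrm{SM}_2(A),\mathbb{Z})\to H_3(\mathrm{SL}_2(A),\mathbb{Z})\to\mathcal{RB}(A)\to0,$$ where the first map is induced by the inclusion $\mathrm{SM}_2(A)\subseteq\mathrm{SL}_2(A)$.
   Context: For a commutative ring $A$: $A^\times$ is the unit group, $\mu_2(A)=\{a\in A:a^2=1\}$, $T(A)=\left\{\begin{pmatrix}a&0\\0&a^{-1}\end{pmatrix}:a\in A^\times\right\}$, $B(A)=\left\{\begin{pmatrix}a&b\\0&a^{-1}\end{pmatrix}:a\in A^\times,b\in A\right\}$, $\mathrm{SM}_2(A)=\left\{\begin{pmatrix}a&0\\0&a^{-1}\end{pmatrix},\begin{pmatrix}0&b^{-1}\\-b&0\end{pmatrix}:a,b\in A^\times\right\}$. The complex $X_\bullet(A^2)$: a column vector in $A^2$ is unimodular if it is a column of some matrix in $\mathrm{GL}_2(A)$; $\langle u\rangle$ denotes the line generated by $u$. $X_k(A^2)$ is the free abelian group on tuples $(\langle v_0\rangle,\dots,\langle v_k\rangle)$ with $v_i$ unimodular and $(v_i,v_j)\in\mathrm{GL}_2(A)$ for $i\ne j$, with the diagonal action of $\mathrm{SL}_2(A)$; $\partial_k$ is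 the alternating sum of the maps omitting one entry, and $\partial_0:X_0(A^2)\to\mathbb{Z}$ sends each generator to $1$. The complex is exact in dimension $<2$ if $X_2\to X_1\to X_0\to\mathbb{Z}\to0$ is exact. $Z_2(A^2)=\ker\partial_2$. Definition of $\mathcal{RB}(A)$: let $\mathcal{G}_A=A^\times/(A^\times)^2$, with $\langle a\rangle$ the class of $a$, and $\mathcal{R}_A=\mathbb{Z}[\mathcal{G}_A]$. Let $\mathcal{RP}(A)=H_0(\mathrm{SL}_2(A),Z_2(A^2))$. The inclusion $Z_2\subseteq X_2$ induces $\lambda_1:\mathcal{RP}(A)\to X_2(A^2)_{\mathrm{SL}_2(A)}\simeq\mathcal{R}_A$ (the class of $(\langle(1,0)^T\rangle,\langle(0,1)^T\rangle,\langle(1,a)^T\rangle)$ corresponding to $\langle a\rangle$), and $\mathcal{RP}_1(A)=\ker\lambda_1$. Let $X^\tau_\bullet$ be the complex with $X^\tau_k=X_k(A^2)$ for $k\le2$, $X_3^\tau=Z_2(A^2)$ (mapping to $X_2$ by inclusion), $X^\tau_k=0$ for $k>3$. With $F_\bullet\to\mathbb{Z}$ a projective resolution over $\mathbb{Z}[\mathrm{SL}_2(A)]$, the double complex $F_\bullet\otimes_{\mathrm{SL}_2(A)}X^\tau_\bullet$ gives a spectral sequence with $E^1_{p,q}(\mathrm{SL}_2(A),X^\tau)=H_q(\mathrm{SL}_2(A),X^\tau_p)$; one has $E^3_{3,0}=\mathcal{RP}_1(A)$, and $\mathcal{RB}(A)$ is the kernel of the differential $d^3_{3,0}:\mathcal{RP}_1(A)\to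 E^3_{0,2}(\mathrm{SL}_2(A),X^\tau)$. *)

(* Defs.v *)
From HB Require Import structures.
From mathcomp Require Import all_boot all_algebra zify.
From mathcomp Require Import boolp classical_sets.
From mathcomp Require Import finmap monalg.

Set Implicit Arguments.
Unset Strict Implicit.
Unset Printing Implicit Defensive.

Import GRing.Theory.
Local Open Scope quotient_scope.
Local Open Scope ring_scope.

Definition exact_at (U V W : zmodType) (f : U -> V) (g : V -> W) : Prop :=
  forall v, g v = 0 <-> exists u, f u = v.

Definition surjective (U V : Type) (f : U -> V) : Prop :=
  forall v, exists u, f u = v.

Definition subg (V : zmodType) (S : zmodClosed V) : Type := {x : V | x \in S}.

Section SubGroup.
Variables (V : zmodType) (S : zmodClosed V).
HB.instance Definition _ := SubChoice.on (subg S).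
HB.instance Definition _ := [SubChoice_isSubZmodule of subg S by <:].
End SubGroup.

Section Subgroups.
Variables (U V : zmodType).

Definition all_pred : {pred V} := fun=> true.
Fact all_closed : zmod_closed all_pred. Proof. by []. Qed.
HB.instance Definition _ := GRing.isZmodClosed.Build V all_pred all_closed.

Definition ker_pred (f : {additive U -> V}) : {pred U} := fun x => f x == 0.
Fact ker_closed f : zmod_closed (ker_pred f).
Proof.
split=> [|x y]; rewrite !unfold_in ?raddf0 // => /eqP fx /eqP fy.
by rewrite raddfB fx fy subr0.
Qed.
HB.instance Definition _ f := GRing.isZmodClosed.Build U (ker_pred f) (ker_closed f).

Definition im_pred (f : {additive U -> V}) : {pred V} :=
  fun y => `[< exists x, f x = y >].
Fact im_closed f : zmod_closed (im_pred f).
Proof.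
split=> [|x y]; rewrite !unfold_in; first by apply/asboolP; exists 0; rewrite raddf0.
move=> /asboolP[a <-] /asboolP[b <-]; apply/asboolP; exists (a - b).
by rewrite raddfB.
Qed.
HB.instance Definition _ f := GRing.isZmodClosed.Build V (im_pred f) (im_closed f).

Definition image_pred (f : {additive U -> V}) (S : zmodClosed U) : {pred V} :=
  fun y => `[< exists2 x, x \in S & f x = y >].
Fact image_closed f S : zmod_closed (image_pred f S).
Proof.
split=> [|x y]; rewrite !unfold_in.
  by apply/asboolP; exists 0; rewrite ?raddf0 ?rpred0.
move=> /asboolP[a aS <-] /asboolP[b bS <-]; apply/asboolP; exists (a - b).
  exact: rpredB.
by rewrite raddfB.
Qed.
HB.instance Definition _ f S :=
  GRing.isZmodClosed.Build V (image_pred f S) (image_closed f S).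

Definition preim_pred (f : {additive U -> V}) (S : zmodClosed V) : {pred U} :=
  fun x => f x \in S.
Fact preim_closed f S : zmod_closed (preim_pred f S).
Proof.
split=> [|x y fx fy]; rewrite unfold_in /preim_pred ?raddf0 ?rpred0 //.
by rewrite raddfB rpredB.
Qed.
HB.instance Definition _ f S :=
  GRing.isZmodClosed.Build U (preim_pred f S) (preim_closed f S).

Definition sum_pred (S T : zmodClosed V) : {pred V} :=
  fun x => `[< exists s t, [/\ s \in S, t \in T & x = s + t] >].
Fact sum_closed S T : zmod_closed (sum_pred S T).
Proof.
split=> [|x y]; rewrite !unfold_in.
  by apply/asboolP; exists 0, 0; rewrite !rpred0 addr0.
move=> /asboolP[a [b [aS bT ->]]] /asboolP[c [d [cS dT ->]]]; apply/asboolP.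
by exists (a - c), (b - d); rewrite !rpredB // opprD addrACA.
Qed.
HB.instance Definition _ S T :=
  GRing.isZmodClosed.Build V (sum_pred S T) (sum_closed S T).

End Subgroups.

Definition All (V : zmodType) : zmodClosed V := all_pred (V:=V).
Definition Ker (U V : zmodType) (f : {additive U -> V}) : zmodClosed U :=
  ker_pred f.
Definition Im (U V : zmodType) (f : {additive U -> V}) : zmodClosed V :=
  im_pred f.

Lemma kerP (U V : zmodType) (f : {additive U -> V}) x :
  reflect (f x = 0) (x \in Ker f).
Proof. exact: eqP. Qed.

Lemma imP (U V : zmodType) (f : {additive U -> V}) y :
  reflect (exists x, f x = y) (y \in Im f).
Proof. exact: asboolP. Qed.

Section Subquotients.
Variables (V : zmodType) (Z B : zmodClosed V).

(* The group Z / (Z :&: B). *)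
Definition subquot : zmodType :=
  Quotient.quot (preim_pred (val : {additive subg Z -> V}) B : zmodClosed (subg Z)).

Definition class (z : subg Z) : subquot := \pi z.

Lemma class_eq (x y : subg Z) : class x = class y <-> val x - val y \in B.
Proof.
rewrite -raddfB /=; split=> [|xyB]; first by move/eqP; rewrite -Quotient.idealrBE.
by apply/eqP; rewrite -Quotient.idealrBE.
Qed.

Lemma class_is_additive : zmod_morphism class.
Proof. by move=> x y; rewrite /class !piE. Qed.
HB.instance Definition _ :=
  GRing.isZmodMorphism.Build (subg Z) subquot class class_is_additive.

Lemma class_reprK (c : subquot) : class (repr c) = c.
Proof. exact: reprK. Qed.

End Subquotients.

Section SubquotientMap.
Variables (V V' : zmodType) (Z B : zmodClosed V) (Z' B' : zmodClosed V').
Variable f : {additive V -> V'}.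
Hypothesis fZ : forall x, x \in Z -> f x \in Z'.
Hypothesis fB : forall x, x \in Z -> x \in B -> f x \in B'.

Definition subg_map (x : subg Z) : subg Z' := exist _ (f (val x)) (fZ (valP x)).

Definition subquot_fun (c : subquot Z B) : subquot Z' B' :=
  class B' (subg_map (repr c)).

Lemma subquot_funE x : subquot_fun (class B x) = class B' (subg_map x).
Proof.
apply/class_eq; rewrite /= -(raddfB f); apply: fB; first exact: rpredB (valP _) (valP _).
by apply/class_eq; rewrite class_reprK.
Qed.

Lemma subquot_fun_is_additive : zmod_morphism subquot_fun.
Proof.
move=> c d; rewrite -[c]class_reprK -[d]class_reprK -raddfB !subquot_funE -raddfB.
by congr class; apply: val_inj; rewrite /= !raddfB.
Qed.
HB.instance Definition _ :=
  GRing.isZmodMorphism.Build (subquot Z B) (subquot Z' B') subquot_fun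
    subquot_fun_is_additive.

Definition subquot_map : {additive subquot Z B -> subquot Z' B'} := subquot_fun.

Lemma subquot_mapE x : subquot_map (class B x) = class B' (subg_map x).
Proof. exact: subquot_funE. Qed.

End SubquotientMap.

Section FreeLift.
Variables (K : choiceType) (M N : zmodType).
Implicit Types c : {malg M[K]}.

Lemma malg_ext (f g : {additive {malg M[K]} -> N}) :
  (forall k m, f (mkmalgU k m) = g (mkmalgU k m)) -> f =1 g.
Proof. by move=> fg c; rewrite [c]monalgE !raddf_sum; apply: eq_bigr. Qed.

Variable f : K -> {additive M -> N}.

Definition mlift c : N := \sum_(k <- msupp c) f k (mcoeff k c).

Lemma mliftEw c (d : {fset K}) :
  fsubset (msupp c) d -> mlift c = \sum_(k <- d) f k (mcoeff k c).
Proof.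
move=> cd; rewrite /mlift; apply: big_fset_incl => // k _ kc.
by rewrite mcoeff_outdom // raddf0.
Qed.

Lemma mlift_is_additive : zmod_morphism mlift.
Proof.
move=> x y; pose d := fsetU (msupp x) (msupp y).
rewrite (@mliftEw _ d) ?msuppB_le // (@mliftEw x d) ?fsubsetUl //.
rewrite (@mliftEw y d) ?fsubsetUr // -sumrB; apply: eq_bigr => k _.
by rewrite !raddfB.
Qed.
HB.instance Definition _ :=
  GRing.isZmodMorphism.Build {malg M[K]} N mlift mlift_is_additive.

Lemma mliftU k m : mlift (mkmalgU k m) = f k m.
Proof. by rewrite (@mliftEw _ [fset k]%fset) ?msuppU_le // big_seq_fset1 mcoeffUU. Qed.

End FreeLift.

Definition mpush (K K' : choiceType) (M M' : zmodType) (phi : K -> K')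
    (f : {additive M -> M'}) : {additive {malg M[K]} -> {malg M'[K']}} :=
  mlift (fun k => mkmalgU (phi k) \o f).

Lemma mpushU (K K' : choiceType) (M M' : zmodType) (phi : K -> K')
    (f : {additive M -> M'}) k m :
  mpush phi f (mkmalgU k m) = mkmalgU (phi k) (f m).
Proof. exact: mliftU. Qed.

Lemma mpush_comp (K K' K'' : choiceType) (M M' M'' : zmodType) (phi : K -> K')
    (psi : K' -> K'') (f : {additive M -> M'}) (g : {additive M' -> M''}) x :
  mpush psi g (mpush phi f x) = mpush (psi \o phi) (g \o f) x.
Proof.
pose lhs : {additive _ -> _} := mpush psi g \o mpush phi f.
rewrite -[LHS]/(lhs x); apply: malg_ext => k m.
by rewrite -[LHS]/(mpush psi g (mpush phi f _)) !mpushU.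
Qed.

Lemma eq_mpush (K K' : choiceType) (M M' : zmodType) (phi psi : K -> K')
    (f g : {additive M -> M'}) x :
  phi =1 psi -> f =1 g -> mpush phi f x = mpush psi g x.
Proof. by move=> phiE fE; apply: malg_ext => k m; rewrite !mpushU phiE fE. Qed.

Lemma mpush0 (K K' : choiceType) (M M' : zmodType) (phi : K -> K')
    (f : {additive M -> M'}) x : (forall m, f m = 0) -> mpush phi f x = 0.
Proof.
move=> f0; rewrite [x]monalgE raddf_sum big1 // => k _.
by rewrite mpushU f0 raddf0.
Qed.

Lemma mpush_comp0 (K K' K'' : choiceType) (M M' M'' : zmodType) (phi : K -> K')
    (psi : K' -> K'') (f : {additive M -> M'}) (g : {additive M' -> M''}) x :
  (forall m, g (f m) = 0) -> mpush psi g (mpush phi f x) = 0.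
Proof.
by move=> gf0; rewrite mpush_comp mpush0.
Qed.

Section AlternatingSum.
Variables (U V : zmodType) (n : nat) (face : nat -> {additive U -> V}).

Definition alt_sum (x : U) : V := \sum_(i < n) face i x *~ (-1) ^+ i.

Lemma alt_sum_is_additive : zmod_morphism alt_sum.
Proof.
by move=> x y; rewrite -sumrB; apply: eq_bigr => i _; rewrite raddfB mulrzBl.
Qed.
HB.instance Definition _ :=
  GRing.isZmodMorphism.Build U V alt_sum alt_sum_is_additive.

End AlternatingSum.

Lemma alt_sumK (U V W : zmodType) (n : nat) (face : nat -> {additive U -> V})
    (face' : nat -> {additive V -> W}) :
  (forall i j x, (i <= j < n)%N -> face' i (face j.+1 x) = face' j (face i x)) ->
  forall x, alt_sum n face' (alt_sum n.+1 face x) = 0.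
Proof.
move=> ffE x; pose F (i j : nat) := face' i (face j x) *~ (-1) ^+ (i + j).
have -> : alt_sum n face' (alt_sum n.+1 face x) =
    \sum_(i < n) \sum_(j < n.+1) F i j.
  apply: eq_bigr => i _; rewrite raddf_sum mulrz_suml; apply: eq_bigr => j _.
  by rewrite raddfMz -mulrzA -exprD /F addnC.
have -> : \sum_(i < n) \sum_(j < n.+1) F i j =
    \sum_(i < n) \sum_(j < n.+1 | (i < j)%N) F i j
      + \sum_(i < n) \sum_(j < n.+1 | ~~ (i < j)%N) F i j.
  by rewrite -big_split; apply: eq_bigr => i _; rewrite (bigID (fun j : 'I_n.+1 => i < j)%N).
have -> : \sum_(i < n) \sum_(j < n.+1 | (i < j)%N) F i j =
    - \sum_(i < n) \sum_(j < n | (i <= j)%N) F j i.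
  rewrite -sumrN; apply: eq_bigr => i _.
  rewrite big_mkcond big_ord_recl /= add0r -sumrN [RHS]big_mkcond /=.
  apply: eq_bigr => j _; rewrite /bump /= add1n ltnS; case: ifP => // ij.
  by rewrite /F ffE ?ij //= addnS exprS mulN1r mulrNz addnC.
apply/eqP; rewrite addrC subr_eq0; apply/eqP.
rewrite [RHS](exchange_big_dep xpredT) //=; apply: eq_bigr => i _.
rewrite big_mkcond big_ord_recr /= ltn_ord addr0 -big_mkcond /=.
by apply: eq_bigl => j; rewrite -leqNgt.
Qed.

Lemma alt_sum_natural (U V U' V' : zmodType) (n : nat)
    (face : nat -> {additive U -> V}) (face' : nat -> {additive U' -> V'})
    (f : {additive U -> U'}) (g : {additive V -> V'}) :
  (forall i x, g (face i x) = face' i (f x)) ->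
  forall x, g (alt_sum n face x) = alt_sum n face' (f x).
Proof.
move=> fE x; rewrite raddf_sum; apply: eq_bigr => i _.
by rewrite raddfMz fE.
Qed.

Section Homology.
Variables (C : nat -> zmodType) (d : forall n, {additive C n.+1 -> C n}).

Definition cycles (n : nat) : zmodClosed (C n) :=
  match n return zmodClosed (C n) with
  | 0%N => @All (C 0)
  | n'.+1 => Ker (d n')
  end.

Definition homology (n : nat) : zmodType := subquot (cycles n) (Im (d n)).

End Homology.

Section HomologyMap.
Variables (C C' : nat -> zmodType).
Variables (d : forall n, {additive C n.+1 -> C n}).
Variables (d' : forall n, {additive C' n.+1 -> C' n}).
Variable f : forall n, {additive C n -> C' n}.
Hypothesis fd : forall n x, f n (d n x) = d' n (f n.+1 x).

Lemma cycles_map n x : x \in cycles d n -> f n x \in cycles d' n.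
Proof.
case: n x => [//|n] x; rewrite !unfold_in /= /ker_pred -fd => /eqP->.
by rewrite raddf0.
Qed.

Lemma boundaries_map n x : x \in cycles d n -> x \in Im (d n) -> f n x \in Im (d' n).
Proof.
move=> _; rewrite !unfold_in /= => /asboolP[y <-]; apply/asboolP.
by exists (f n.+1 y); rewrite fd.
Qed.

Definition homology_map n : {additive homology d n -> homology d' n} :=
  subquot_map (@cycles_map n) (@boundaries_map n).

End HomologyMap.

Record gmodule (G : groupType) := GModule {
  gmod_sort :> zmodType;
  act : G -> {additive gmod_sort -> gmod_sort};
  act1 : forall m, act 1%g m = m;
  actM : forall g h m, act (g * h)%g m = act g (act h m) }.
Arguments act {G M} : rename.

Definition equivariant (G : groupType) (M N : gmodule G) (f : M -> N) : Prop :=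
  forall g m, f (act g m) = act g (f m).

Definition trivial_gmodule (G : groupType) (M : zmodType) : gmodule G :=
  @GModule G M (fun=> idfun) (fun=> erefl) (fun _ _ => fun=> erefl).

Section BarComplex.
Variables (G : groupType) (M : gmodule G).

(* F_q (x)_G M for the bar resolution F of Z: the generator m (x) [g_0|...|g_(q-1)]
   is mkmalgU g m. *)
Definition chain (q : nat) : zmodType := {malg M[{ffun 'I_q -> G}]}.

(* [bar_word i] drops g_0 if i = 0, drops g_q if i = q + 1, and otherwise
   replaces g_(i-1), g_i by their product. *)
Definition bar_word (q i : nat) (g : {ffun 'I_q.+1 -> G}) : {ffun 'I_q -> G} :=
  [ffun j : 'I_q =>
    if (j.+1 < i)%N then g (inord j)
    else if (j.+1 == i)%N then (g (inord j) * g (inord j.+1))%g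
    else g (inord j.+1)].

(* The left module M is turned into a right one by m.g = g^-1 m, so that
   m (x) [g_0|...|g_q] has 0-th face (g_0^-1 m) (x) [g_1|...|g_q]. *)
Definition bar_coef (i : nat) (g : G) : {additive M -> M} :=
  if i is 0%N then act (g^-1)%g else idfun.

Definition bar_face (q i : nat) : {additive chain q.+1 -> chain q} :=
  mlift (fun g => mkmalgU (bar_word i g) \o bar_coef i (g ord0)).

Lemma bar_faceU q i g m :
  bar_face q i (mkmalgU g m) = mkmalgU (bar_word i g) (bar_coef i (g ord0) m).
Proof. exact: mliftU. Qed.

Definition bar_d (q : nat) : {additive chain q.+1 -> chain q} :=
  alt_sum q.+2 (bar_face q).

Lemma bar_word_inord q i (g : {ffun 'I_q.+2 -> G}) n : (n < q.+1)%N ->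
  bar_word i g (inord n) =
    if (n.+1 < i)%N then g (inord n)
    else if (n.+1 == i)%N then (g (inord n) * g (inord n.+1))%g
    else g (inord n.+1).
Proof. by move=> nq; rewrite ffunE inordK. Qed.

Lemma bar_word_comm q i j (g : {ffun 'I_q.+2 -> G}) : (i <= j)%N ->
  bar_word i (bar_word j.+1 g) = bar_word j (bar_word i g).
Proof.
move=> ij; apply/ffunP => k; have kq := ltn_ord k; have kq1 := ltnW kq.
rewrite [LHS]ffunE [RHS]ffunE !bar_word_inord ?ltnS //.
rewrite !eqSS; move: (nat_of_ord k) {kq kq1} => n.
by do ![case: ifP => ?]; rewrite ?mulgA //; exfalso; lia.
Qed.

Lemma bar_face_comm q i j x : (i <= j < q.+2)%N ->
  bar_face q i (bar_face q.+1 j.+1 x) = bar_face q j (bar_face q.+1 i x).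
Proof.
case/andP=> ij _; pose lhs : {additive _ -> _} := bar_face q i \o bar_face q.+1 j.+1.
pose rhs : {additive _ -> _} := bar_face q j \o bar_face q.+1 i.
rewrite -[LHS]/(lhs x) -[RHS]/(rhs x); apply: malg_ext => g m.
rewrite {}/lhs {}/rhs /= !bar_faceU bar_word_comm //; congr mkmalgU.
have inord0 n : inord 0 = ord0 :> 'I_n.+1 by apply: val_inj; rewrite /= inordK.
case: i j ij => [|i] [|j] //= _; rewrite !ffunE /= ?inord0 //.
by rewrite invgM actM.
Qed.

Lemma bar_dK q x : bar_d q (bar_d q.+1 x) = 0.
Proof. by apply: alt_sumK => i j y; apply: bar_face_comm. Qed.

Definition group_homology (n : nat) : zmodType := homology bar_d n.

End BarComplex.

Notation "''H_' n ( G , M )" := (@group_homology G M n)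
  (at level 8, n at level 2, format "''H_' n ( G ,  M )") : type_scope.

Section BarFunctoriality.
Variables (G H : groupType) (phi : {multiplicative G -> H}).
Variables (M : gmodule G) (N : gmodule H) (f : {additive M -> N}).
Hypothesis f_equiv : forall g m, f (act g m) = act (phi g) (f m).

Definition chain_map (q : nat) : {additive chain M q -> chain N q} :=
  mpush (fun g : {ffun 'I_q -> G} => [ffun i => phi (g i)]) f.

Lemma chain_mapU q g m :
  chain_map q (mkmalgU g m) = mkmalgU [ffun i => phi (g i)] (f m).
Proof. exact: mpushU. Qed.

Lemma chain_map_d q x : chain_map q (bar_d M q x) = bar_d N q (chain_map q.+1 x).
Proof.
apply: alt_sum_natural => i {}x; pose lhs : {additive _ -> _} := chain_map q \o bar_face M q i.
pose rhs : {additive _ -> _} := bar_face N q i \o chain_map q.+1.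
rewrite -[LHS]/(lhs x) -[RHS]/(rhs x); apply: malg_ext => g m.
rewrite {}/lhs {}/rhs /= chain_mapU !bar_faceU chain_mapU.
have phi1 : phi 1%g = 1%g by apply: (mulgI (phi 1%g)); rewrite -gmulfM !mulg1.
have phiV y : phi y^-1%g = (phi y)^-1%g.
  by apply: (mulgI (phi y)); rewrite -gmulfM !mulgV.
congr mkmalgU.
  by apply/ffunP => k; rewrite !ffunE; do ![case: ifP => // _]; rewrite gmulfM.
by case: i => [|n] //=; rewrite ffunE f_equiv phiV.
Qed.

Definition group_homology_map (n : nat) : {additive 'H_n(G, M) -> 'H_n(H, N)} :=
  homology_map chain_map_d n.

End BarFunctoriality.

Definition integral_homology (n : nat) (G : groupType) : zmodType :=
  'H_n(G, trivial_gmodule G int).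

Definition integral_homology_map (n : nat) (G H : groupType)
    (phi : {multiplicative G -> H}) :
    {additive integral_homology n G -> integral_homology n H} :=
  @group_homology_map G H phi (trivial_gmodule G int) (trivial_gmodule H int)
    idfun (fun _ _ => erefl) n.

Record bicomplex := Bicomplex {
  bi :> nat -> nat -> zmodType;
  dh : forall p q, {additive bi p.+1 q -> bi p q};
  dv : forall p q, {additive bi p q.+1 -> bi p q};
  dhK : forall p q x, dh p q (dh p.+1 q x) = 0;
  dvK : forall p q x, dv p q (dv p q.+1 x) = 0;
  dhv : forall p q x, dh p q (dv p.+1 q x) = dv p q (dh p q.+1 x) }.
Arguments dh {b} p q.
Arguments dv {b} p q.

Section SpectralSequence.
Variable C : bicomplex.

(* All families (x_(p,q)); the elements of degree n of the total complex are
   the families with x_(p,q) = 0 for p + q <> n. *)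
Definition tot : Type := forall p q, C p q.

HB.instance Definition _ := gen_eqMixin tot.
HB.instance Definition _ := gen_choiceMixin tot.

Definition tot0 : tot := fun p q => 0.
Definition totN (x : tot) : tot := fun p q => - x p q.
Definition totD (x y : tot) : tot := fun p q => x p q + y p q.

Fact tot_ext (x y : tot) : (forall p q, x p q = y p q) -> x = y.
Proof. by move=> xy; apply: functional_extensionality_dep => p;
  apply: functional_extensionality_dep => q. Qed.
Fact totDA : associative totD.
Proof. by move=> x y z; apply: tot_ext => p q; rewrite /totD addrA. Qed.
Fact totDC : commutative totD.
Proof. by move=> x y; apply: tot_ext => p q; rewrite /totD addrC. Qed.
Fact tot0D : left_id tot0 totD.
Proof. by move=> x; apply: tot_ext => p q; rewrite /totD add0r. Qed.
Fact totND : left_inverse tot0 totN totD.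
Proof. by move=> x; apply: tot_ext => p q; rewrite /totD addNr. Qed.
HB.instance Definition _ := GRing.isZmodule.Build tot totDA totDC tot0D totND.

Definition coord (p q : nat) (x : tot) : C p q := x p q.
Fact coord_is_additive p q : zmod_morphism (coord p q). Proof. by []. Qed.
HB.instance Definition _ p q :=
  GRing.isZmodMorphism.Build tot (C p q) (coord p q) (coord_is_additive p q).

Definition totd (x : tot) : tot :=
  fun p q => dh p q (x p.+1 q) + dv p q (x p q.+1) *~ (-1) ^+ p.

Fact totd_is_additive : zmod_morphism totd.
Proof.
move=> x y; apply: tot_ext => p q; rewrite /totd.
have E i j : (x - y) i j = x i j - y i j by [].
rewrite !E !raddfB mulrzBl addrACA.
by rewrite -[in RHS]/(_ + _ + - (_ + _)) opprD.
Qed.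
HB.instance Definition _ := GRing.isZmodMorphism.Build tot tot totd totd_is_additive.

Lemma totdK x : totd (totd x) = 0.
Proof.
apply: tot_ext => p q; rewrite /totd !raddfD !raddfMz /= dhK dvK mul0rz addr0 add0r.
by rewrite dhv exprS mulN1r mulrNz addNr.
Qed.

(* x in F_p Tot_(p+q) with totd x in F_(p-r) Tot, for the filtration by columns *)
Definition Zr_pred (r : nat) (p q : int) : {pred tot} := fun x =>
  `[< [/\ forall i j, x i j <> 0 -> i%:Z + j%:Z = p + q,
          forall i j, x i j <> 0 -> (i%:Z <= p)%R
        & forall i j, totd x i j <> 0 -> (i%:Z <= p - r%:Z)%R] >].

Fact Zr_closed r p q : zmod_closed (Zr_pred r p q).
Proof.
have nzB (x y : tot) i j : (x - y) i j <> 0 -> x i j <> 0 \/ y i j <> 0.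
  move=> xy; apply: contrapT => /not_orP[/contrapT x0 /contrapT y0]; apply: xy.
  by rewrite -[LHS]/(x i j - y i j) x0 y0 subr0.
split=> [|x y]; rewrite !unfold_in.
  by apply/asboolP; split=> i j; rewrite ?raddf0.
move=> /asboolP[x1 x2 x3] /asboolP[y1 y2 y3]; apply/asboolP.
split=> i j; rewrite ?raddfB => /nzB[]; by [apply: x1|apply: y1|apply: x2|apply: y2
  |apply: x3|apply: y3].
Qed.
HB.instance Definition _ r p q :=
  GRing.isZmodClosed.Build tot (Zr_pred r p q) (Zr_closed r p q).

Definition Zr (r : nat) (p q : int) : zmodClosed tot := Zr_pred r p q.

Definition Br (r : nat) (p q : int) : zmodClosed tot :=
  sum_pred (Zr r.-1 (p - 1) (q + 1))
    (image_pred totd (Zr r.-1 (p + r%:Z - 1) (q - r%:Z + 2))).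

(* E^r_(p,q), for r >= 1: the quotient Z^r_(p,q) / (Z^(r-1)_(p-1,q+1) +
   d Z^(r-1)_(p+r-1,q-r+2)) for the filtration by p, so that E^1_(p,q) is the
   homology of the column C p at q. *)
Definition page (r : nat) (p q : int) : zmodType := subquot (Zr r p q) (Br r p q).

Fact totd_Zr r p q x : x \in Zr r p q -> totd x \in Zr r (p - r%:Z) (q + r%:Z - 1).
Proof.
rewrite !unfold_in => /asboolP[x1 x2 x3]; apply/asboolP; split=> i j; last 2 first.
- exact: x3.
- by rewrite totdK.
move=> dx; apply: contrapT => ij; apply: dx; rewrite /totd.
rewrite (_ : x i.+1 j = 0); last by apply: contrapT => /x1; lia.
rewrite (_ : x i j.+1 = 0); last by apply: contrapT => /x1; lia.
by rewrite !raddf0 mul0rz addr0.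
Qed.

Fact totd_Br r p q x :
  x \in Zr r p q -> x \in Br r p q -> totd x \in Br r (p - r%:Z) (q + r%:Z - 1).
Proof.
move=> _; rewrite !unfold_in /= => /asboolP[y [z [yZ /asboolP[w wZ <-] ->]]].
apply/asboolP; exists 0, (totd y); rewrite add0r raddfD /= totdK addr0 rpred0.
split=> //; rewrite unfold_in; apply/asboolP; exists y => //.
have -> : p - r%:Z + r%:Z - 1 = p - 1 by lia.
by have -> : q + r%:Z - 1 - r%:Z + 2 = q + 1 by lia.
Qed.

Definition page_d (r : nat) (p q : int) :
    {additive page r p q -> page r (p - r%:Z) (q + r%:Z - 1)} :=
  subquot_map (@totd_Zr r p q) (@totd_Br r p q).

End SpectralSequence.

Definition subgrp (G : groupType) (S : groupClosed G) : Type := {x : G | x \in S}.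

Section SubGroups.
Variables (G : groupType) (S : groupClosed G).
HB.instance Definition _ := SubChoice.on (subgrp S).
Fact subgrp_closed : group_closed S.
Proof. by split=> [|x y xS yS]; rewrite ?gpred1 // gpredM ?gpredV. Qed.
HB.instance Definition _ := SubChoice_isSubGroup.Build G (fun x => x \in S) (subgrp S) subgrp_closed.

Definition incl (x : subgrp S) : G := val x.
Fact incl_is_multiplicative : {morph incl : x y / (x * y)%g}.
Proof. by []. Qed.
HB.instance Definition _ :=
  monoid.isMultiplicative.Build (subgrp S) G incl incl_is_multiplicative.

End SubGroups.

Section SubGroupInclusion.
Variables (G : groupType) (S S' : groupClosed G).
Hypothesis sSS' : {subset S <= S'}.
Definition incl_sub_fun (x : subgrp S) : subgrp S' := exist _ (val x) (sSS' (valP x)).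
Fact incl_sub_is_multiplicative : {morph incl_sub_fun : x y / (x * y)%g}.
Proof. by move=> x y; apply: val_inj. Qed.
HB.instance Definition _ :=
  monoid.isMultiplicative.Build (subgrp S) (subgrp S') incl_sub_fun incl_sub_is_multiplicative.
Definition incl_sub : {multiplicative subgrp S -> subgrp S'} := incl_sub_fun.

End SubGroupInclusion.

Section SL2.
Variable A : comPzRingType.

Definition SL2 : Type := {g : 'M[A]_2 | \det g == 1}.
HB.instance Definition _ := SubChoice.on SL2.

Definition sl2_mul (g h : SL2) : SL2.
Proof.
exists (val g *m val h).
by rewrite det_mulmx (eqP (valP g)) (eqP (valP h)) mulr1.
Defined.

Definition sl2_one : SL2.
Proof. by exists 1%:M; rewrite det1. Defined.

Fact det_adj (M : 'M[A]_2) : \det M = 1 -> \det (\adj M) = 1.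
Proof.
by move=> M1; rewrite -[LHS]mul1r -{1}M1 -det_mulmx mul_mx_adj M1 det1.
Qed.

Definition sl2_inv (g : SL2) : SL2.
Proof. by exists (\adj (val g)); rewrite det_adj ?(eqP (valP g)). Defined.

Fact sl2_mulA : associative sl2_mul.
Proof. by move=> x y z; apply: val_inj; rewrite /= mulmxA. Qed.
Fact sl2_mul1 : left_id sl2_one sl2_mul.
Proof. by move=> x; apply: val_inj; rewrite /= mul1mx. Qed.
Fact sl2_mulr1 : right_id sl2_one sl2_mul.
Proof. by move=> x; apply: val_inj; rewrite /= mulmx1. Qed.
Fact sl2_mulV : left_inverse sl2_one sl2_inv sl2_mul.
Proof. by move=> x; apply: val_inj; rewrite /= mul_adj_mx (eqP (valP x)). Qed.
Fact sl2_mulrV : right_inverse sl2_one sl2_inv sl2_mul.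
Proof. by move=> x; apply: val_inj; rewrite /= mul_mx_adj (eqP (valP x)). Qed.
HB.instance Definition _ :=
  isGroup.Build SL2 sl2_mulA sl2_mul1 sl2_mulr1 sl2_mulV sl2_mulrV.

Lemma sl2_valM (g h : SL2) : val (g * h)%g = val g *m val h.
Proof. by []. Qed.

Definition mx2 (a b c d : A) : 'M[A]_2 :=
  \matrix_(i < 2, j < 2) if i == 0 then if j == 0 then a else b
                         else if j == 0 then c else d.

Fact mx2_mul a b c d a' b' c' d' : mx2 a b c d *m mx2 a' b' c' d' =
  mx2 (a * a' + b * c') (a * b' + b * d') (c * a' + d * c') (c * b' + d * d').
Proof.
by apply/matrixP => i j; rewrite !mxE !big_ord_recl big_ord0 !mxE /= addr0;
  case: ifP; case: ifP.
Qed.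

Fact mx2_1 : 1%:M = mx2 1 0 0 1.
Proof.
by apply/matrixP => -[[|[|i]] ilt] [[|[|j]] jlt]; rewrite !mxE.
Qed.

Fact det_mx2 a b c d : \det (mx2 a b c d) = a * d - b * c.
Proof.
rewrite (expand_det_row _ ord0) !big_ord_recl big_ord0 /cofactor !det_mx11 !mxE /=.
by rewrite addr0 expr0 expr1 !mul1r mulN1r mulrN.
Qed.

Fact sl2_valV (g : SL2) a b c d :
  val g = mx2 a b c d -> val (g^-1)%g = mx2 d (- b) (- c) a.
Proof.
move=> gE; have := eqP (valP g); rewrite gE det_mx2 => adbc.
have adj1 : \det (mx2 d (- b) (- c) a) == 1 by rewrite det_mx2 mulrNN mulrC adbc.
pose h : SL2 := Sub (mx2 d (- b) (- c) a) adj1.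
suff -> : (g^-1)%g = h by [].
have hE : val h = mx2 d (- b) (- c) a by [].

apply: (mulgI g); rewrite mulgV; apply: val_inj; rewrite sl2_valM gE hE mx2_mul.
rewrite -[LHS]/(1%:M) mx2_1.
by rewrite !mulrN adbc [b * a]mulrC addNr [d * c]mulrC subrr addrC [d * a]mulrC
  [c * b]mulrC adbc.
Qed.

(* The diagonal or antidiagonal entry paired with a is its inverse: the second kind
   of monomial matrix is [0, a^-1; -a, 0]. Units are expressed by a * b = 1, as A is
   an arbitrary commutative ring, possibly zero. *)
Definition torus_pred : {pred SL2} := fun g =>
  `[< exists a b, a * b = 1 /\ val g = mx2 a 0 0 b >].

Definition borel_pred : {pred SL2} := fun g =>
  `[< exists a b c, a * c = 1 /\ val g = mx2 a b 0 c >].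

Definition monomial_pred : {pred SL2} := fun g =>
  `[< exists a b, a * b = 1 /\ (val g = mx2 a 0 0 b \/ val g = mx2 0 b (- a) 0) >].

End SL2.

Section MatrixSubgroups.
Variable A : comPzRingType.

Fact torus_mul : {in @torus_pred A &, forall g h, (g * h)%g \in @torus_pred A}.
Proof.
move=> g h /asboolP[a [b [ab ga]]] /asboolP[c [d [cd hc]]]; apply/asboolP.
exists (a * c), (b * d); rewrite mulrACA ab cd mulr1; split=> //.
by rewrite sl2_valM ga hc mx2_mul
    ?(mul0r, mulr0, addr0, add0r, mulNr, mulrN, opprK).
Qed.
Fact torus_one : (1%g : SL2 A) \in @torus_pred A.
Proof. by apply/asboolP; exists 1, 1; rewrite mulr1 -mx2_1. Qed.
Fact torus_inv : {in @torus_pred A, forall g, (g^-1)%g \in @torus_pred A}.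
Proof.
move=> g /asboolP[a [b [ab ga]]]; apply/asboolP; exists b, a; rewrite mulrC.
by split=> //; rewrite (sl2_valV ga) oppr0.
Qed.
HB.instance Definition _ := monoid.isMulClosed.Build (SL2 A) (@torus_pred A) torus_mul.
HB.instance Definition _ := isMul1Closed.Build (SL2 A) (@torus_pred A) torus_one.
HB.instance Definition _ := isInvClosed.Build (SL2 A) (@torus_pred A) torus_inv.

Fact borel_mul : {in @borel_pred A &, forall g h, (g * h)%g \in @borel_pred A}.
Proof.
move=> g h /asboolP[a [b [c [ac ga]]]] /asboolP[d [e [f [df hd]]]]; apply/asboolP.
exists (a * d), (a * e + b * f), (c * f); rewrite mulrACA ac df mulr1; split=> //.
by rewrite sl2_valM ga hd mx2_mul
    ?(mul0r, mulr0, addr0, add0r, mulNr, mulrN, opprK).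
Qed.
Fact borel_one : (1%g : SL2 A) \in @borel_pred A.
Proof. by apply/asboolP; exists 1, 0, 1; rewrite mulr1 -mx2_1. Qed.
Fact borel_inv : {in @borel_pred A, forall g, (g^-1)%g \in @borel_pred A}.
Proof.
move=> g /asboolP[a [b [c [ac ga]]]]; apply/asboolP; exists c, (- b), a.
by rewrite mulrC; split=> //; rewrite (sl2_valV ga) oppr0.
Qed.
HB.instance Definition _ := monoid.isMulClosed.Build (SL2 A) (@borel_pred A) borel_mul.
HB.instance Definition _ := isMul1Closed.Build (SL2 A) (@borel_pred A) borel_one.
HB.instance Definition _ := isInvClosed.Build (SL2 A) (@borel_pred A) borel_inv.

Fact monomial_mul :
  {in @monomial_pred A &, forall g h, (g * h)%g \in @monomial_pred A}.
Proof.
move=> g h /asboolP[a [b [ab ga]]] /asboolP[c [d [cd hc]]]; apply/asboolP.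
have ba : b * a = 1 by rewrite mulrC.
have dc : d * c = 1 by rewrite mulrC.
case: ga => ga; case: hc => hc.
- exists (a * c), (b * d); rewrite mulrACA ab cd mulr1; split=> //; left.
  by rewrite sl2_valM ga hc mx2_mul
    ?(mul0r, mulr0, addr0, add0r, mulNr, mulrN, opprK).
- exists (b * c), (a * d); rewrite mulrACA ba cd mulr1; split=> //; right.
  by rewrite sl2_valM ga hc mx2_mul
    ?(mul0r, mulr0, addr0, add0r, mulNr, mulrN, opprK).
- exists (a * c), (b * d); rewrite mulrACA ab cd mulr1; split=> //; right.
  by rewrite sl2_valM ga hc mx2_mul
    ?(mul0r, mulr0, addr0, add0r, mulNr, mulrN, opprK).
- exists (- (b * c)), (- (a * d)); rewrite mulrNN mulrACA ba cd mulr1.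
  by split=> //; left; rewrite sl2_valM ga hc mx2_mul
    ?(mul0r, mulr0, addr0, add0r, mulNr, mulrN, opprK).
Qed.
Fact monomial_one : (1%g : SL2 A) \in @monomial_pred A.
Proof. by apply/asboolP; exists 1, 1; rewrite mulr1 -mx2_1; split=> //; left. Qed.
Fact monomial_inv : {in @monomial_pred A, forall g, (g^-1)%g \in @monomial_pred A}.
Proof.
move=> g /asboolP[a [b [ab ga]]]; apply/asboolP; case: ga => ga.
  exists b, a; rewrite mulrC; split=> //; left.
  by rewrite (sl2_valV ga) oppr0.
exists (- a), (- b); rewrite mulrNN; split=> //; right.
by rewrite (sl2_valV ga) !opprK.
Qed.
HB.instance Definition _ :=
  monoid.isMulClosed.Build (SL2 A) (@monomial_pred A) monomial_mul.
HB.instance Definition _ := isMul1Closed.Build (SL2 A) (@monomial_pred A) monomial_one.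
HB.instance Definition _ := isInvClosed.Build (SL2 A) (@monomial_pred A) monomial_inv.

Definition T2 : groupType := subgrp (@torus_pred A).
Definition B2 : groupType := subgrp (@borel_pred A).
Definition SM2 : groupType := subgrp (@monomial_pred A).

Fact torus_sub_borel : {subset @torus_pred A <= @borel_pred A}.
Proof. by move=> g /asboolP[a [b [ab ga]]]; apply/asboolP; exists a, 0, b. Qed.

Definition T2_B2 : {multiplicative T2 -> B2} := incl_sub torus_sub_borel.
Definition SM2_SL2 : {multiplicative SM2 -> SL2 A} := @incl _ (@monomial_pred A).

End MatrixSubgroups.

Section Lines.
Variable A : comPzRingType.
Local Open Scope classical_set_scope.

Definition GL2 (M : 'M[A]_2) : Prop :=
  exists N : 'M[A]_2, M *m N = 1%:M /\ N *m M = 1%:M.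

Definition unimodular (u : 'cV[A]_2) : Prop :=
  exists2 M : 'M[A]_2, GL2 M & exists j, u = col j M.

Definition span (u : 'cV[A]_2) : set 'cV[A]_2 := range (fun a : A => a *: u).

Definition is_line (L : set 'cV[A]_2) : Prop := exists2 u, unimodular u & L = span u.

Definition line : Type := {L : set 'cV[A]_2 | `[< is_line L >]}.
HB.instance Definition _ := SubChoice.on line.

Definition transverse (L L' : line) : Prop :=
  exists u v : 'cV[A]_2,
    [/\ val L = span u, val L' = span v & GL2 (row_mx u v : 'M[A]_(2, 1 + 1))].

Definition is_conf (k : nat) (c : {ffun 'I_k.+1 -> line}) : Prop :=
  forall i j, i != j -> transverse (c i) (c j).

Definition conf (k : nat) : Type := {c : {ffun 'I_k.+1 -> line} | `[< is_conf c >]}.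
HB.instance Definition _ k := SubChoice.on (conf k).

Fact GL2_mul (M N : 'M[A]_2) : GL2 M -> GL2 N -> GL2 (M *m N).
Proof.
move=> [M' [MM' M'M]] [N' [NN' N'N]]; exists (N' *m M'); split.
  by rewrite mulmxA -(mulmxA M) NN' mulmx1.
by rewrite mulmxA -(mulmxA N') M'M mulmx1.
Qed.

Fact GL2_SL2 (g : SL2 A) : GL2 (val g).
Proof.
by exists (val (g^-1)%g); rewrite -!sl2_valM mulgV mulVg.
Qed.

Fact span_mul (g : 'M[A]_2) (u : 'cV[A]_2) : mulmx g @` span u = span (g *m u).
Proof.
apply/seteqP; split=> [_ [_ [a _ <-] <-]|_ [a _ <-]]; first by exists a; rewrite ?scalemxAr.
by exists (a *: u); rewrite ?scalemxAr //; exists a.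
Qed.

Fact line_act_proof (g : SL2 A) (L : line) :
  `[< is_line (mulmx (val g) @` val L) >].
Proof.
case: L => L /= /asboolP[u [M glM [j ->]] ->]; apply/asboolP.
rewrite span_mul; exists (val g *m col j M) => //; exists (val g *m M).
  exact: GL2_mul (GL2_SL2 g) glM.
by exists j; rewrite !colE mulmxA.
Qed.

Definition line_act (g : SL2 A) (L : line) : line :=
  exist (fun L => `[< is_line L >]) (mulmx (val g) @` val L) (line_act_proof g L).

Fact line_act1 L : line_act 1%g L = L.
Proof.
apply: val_inj => /=; apply/seteqP; split=> [_ [v Lv <-]|v Lv].
  by rewrite mul1mx.
by exists v; rewrite ?mul1mx.
Qed.

Fact line_actM g h L : line_act (g * h)%g L = line_act g (line_act h L).
Proof.
apply: val_inj => /=; apply/seteqP; split=> [_ [v Lv <-]|_ [_ [v Lv <-] <-]].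
  by exists (val h *m v); [exists v | rewrite mulmxA].
by exists v; rewrite ?mulmxA.
Qed.

Fact transverse_act g L L' : transverse L L' -> transverse (line_act g L) (line_act g L').
Proof.
move=> [u [v [Lu Lv uv]]]; exists (val g *m u), (val g *m v).
rewrite /= Lu Lv !span_mul; split=> //; rewrite -mul_mx_row.
exact: GL2_mul (GL2_SL2 g) uv.
Qed.

Fact conf_act_proof k (g : SL2 A) (c : conf k) :
  `[< is_conf [ffun i => line_act g (val c i)] >].
Proof.
apply/asboolP => i j ij; rewrite !ffunE; apply: transverse_act.
by have /asboolP := valP c; apply.
Qed.

Definition conf_act k (g : SL2 A) (c : conf k) : conf k :=
  exist (fun c => `[< is_conf c >]) [ffun i => line_act g (val c i)] (conf_act_proof g c).

Fact conf_act1 k (c : conf k) : conf_act 1%g c = c.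
Proof. by apply: val_inj; apply/ffunP => i; rewrite ffunE line_act1. Qed.

Fact conf_actM k g h (c : conf k) : conf_act (g * h)%g c = conf_act g (conf_act h c).
Proof. by apply: val_inj; apply/ffunP => i; rewrite !ffunE line_actM. Qed.

(* [bump i] skips the index i, so that [conf_face i] omits the i-th entry for
   i <= k + 1. *)
Fact conf_face_proof k (i : nat) (c : conf k.+1) :
  `[< is_conf [ffun j : 'I_k.+1 => val c (inord (bump i j))] >].
Proof.
apply/asboolP => j l jl; rewrite !ffunE; have /asboolP := valP c; apply.
apply: contra_neq jl => /(congr1 val) /=; rewrite !inordK.
- by move=> E; apply: val_inj; move: E; rewrite /bump /=; lia.
- by have lk := ltn_ord l; rewrite /bump; lia.
- by have jk := ltn_ord j; rewrite /bump; lia.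
Qed.

Definition conf_face k (i : nat) (c : conf k.+1) : conf k :=
  exist (fun c => `[< is_conf c >])
    [ffun j : 'I_k.+1 => val c (inord (bump i j))] (conf_face_proof i c).

Fact conf_face_act k i g (c : conf k.+1) :
  conf_face i (conf_act g c) = conf_act g (conf_face i c).
Proof. by apply: val_inj; apply/ffunP => j; rewrite !ffunE. Qed.

Fact conf_face_comm k i j (c : conf k.+2) : (i <= j)%N ->
  conf_face i (conf_face j.+1 c) = conf_face j (conf_face i c).
Proof.
move=> ij; apply: val_inj; apply/ffunP => l; rewrite !ffunE; congr (val c (inord _)).
have lk := ltn_ord l; rewrite !inordK /bump; last 2 first.
- by lia.
- by lia.
by lia.
Qed.

End Lines.

Section LineComplex.
Variable A : comPzRingType.
Local Notation G := (SL2 A : groupType).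

Definition Xact k (g : G) : {additive {malg int[conf A k]} -> {malg int[conf A k]}} :=
  mpush (conf_act g) idfun.

Fact Xact1 k (x : {malg int[conf A k]}) : Xact k 1%g x = x.
Proof.
rewrite -[RHS]/((idfun : {additive _ -> _}) x); apply: malg_ext => c m.
by rewrite mpushU conf_act1.
Qed.

Fact XactM k g h (x : {malg int[conf A k]}) : Xact k (g * h)%g x = Xact k g (Xact k h x).
Proof.
by rewrite [RHS]mpush_comp; apply: eq_mpush => [c|//]; exact: conf_actM.
Qed.

Definition X (k : nat) : gmodule G := GModule (@Xact1 k) (@XactM k).

(* [bd k] is the differential X_(k+1) -> X_k. *)
Definition bd (k : nat) : {additive X k.+1 -> X k} :=
  alt_sum k.+2 (fun i => mpush (@conf_face A k i) idfun).

Definition aug : {additive X 0 -> int} := mlift (fun _ : conf A 0 => idfun).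

Definition exact_below_2 : Prop :=
  [/\ exact_at (bd 1) (bd 0), exact_at (bd 0) aug & surjective aug].

Fact bd_equiv k : equivariant (bd k).
Proof.
move=> g x; symmetry; move: x.
apply: (@alt_sum_natural _ _ _ _ _ _ _ (Xact k.+1 g) (Xact k g)) => i x.
rewrite [LHS]mpush_comp [RHS]mpush_comp; apply: eq_mpush => [c|//].
by rewrite /= conf_face_act.
Qed.

Fact bdK k x : bd k (bd k.+1 x) = 0.
Proof.
apply: alt_sumK => i j {}x /andP[ij _].
rewrite [LHS]mpush_comp [RHS]mpush_comp; apply: eq_mpush => [c|//].
exact: conf_face_comm.
Qed.

Definition Z2_carrier : zmodType := subg (Ker (bd 1)).

Fact Z2_act_proof g (z : Z2_carrier) : act g (val z) \in Ker (bd 1).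
Proof.
by have /kerP z0 := valP z; apply/kerP; rewrite bd_equiv z0 raddf0.
Qed.

Definition Z2_act_fun g (z : Z2_carrier) : Z2_carrier :=
  exist (fun x => x \in Ker (bd 1)) (act g (val z)) (Z2_act_proof g z).

Fact Z2_act_is_additive g : zmod_morphism (Z2_act_fun g).
Proof. by move=> x y; apply: val_inj; rewrite /= !raddfB. Qed.
HB.instance Definition _ g :=
  GRing.isZmodMorphism.Build Z2_carrier Z2_carrier (Z2_act_fun g) (Z2_act_is_additive g).

Definition Z2_act g : {additive Z2_carrier -> Z2_carrier} := Z2_act_fun g.

Fact Z2_act1 z : Z2_act 1%g z = z.
Proof. by apply: val_inj; exact: Xact1. Qed.
Fact Z2_actM g h z : Z2_act (g * h)%g z = Z2_act g (Z2_act h z).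
Proof. by apply: val_inj; exact: XactM. Qed.

Definition Z2 : gmodule G := GModule Z2_act1 Z2_actM.

Definition Z2_X2 : {additive Z2 -> X 2} := (val : Z2_carrier -> X 2).

Fact Z2_X2_equiv : equivariant Z2_X2.
Proof. by []. Qed.

(* 'I_1 is the zero group. *)
Definition Xtau (p : nat) : gmodule G :=
  match p with
  | 0%N => X 0
  | 1%N => X 1
  | 2%N => X 2
  | 3%N => Z2
  | _ => trivial_gmodule G 'I_1
  end.

Definition dtau (p : nat) : {additive Xtau p.+1 -> Xtau p} :=
  match p return {additive Xtau p.+1 -> Xtau p} with
  | 0%N => bd 0
  | 1%N => bd 1
  | 2%N => Z2_X2
  | _ => \0
  end.

Fact dtau_equiv p : equivariant (dtau p).
Proof.
case: p => [|[|[|p]]]; [exact: bd_equiv|exact: bd_equiv|exact: Z2_X2_equiv|].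
by move=> g x; rewrite raddf0.
Qed.

Fact dtauK p x : dtau p (dtau p.+1 x) = 0.
Proof.
case: p x => [|[|[|p]]] x; rewrite ?raddf0 //; first exact: bdK.
exact/kerP/(valP x).
Qed.

Local Notation gid := (idfun : {multiplicative G -> G}).

Definition Ctau_dh p q : {additive chain (Xtau p.+1) q -> chain (Xtau p) q} :=
  chain_map gid (dtau p) q.

Fact Ctau_dhK p q x : Ctau_dh p q (Ctau_dh p.+1 q x) = 0.
Proof. by apply: mpush_comp0 => m; exact: dtauK. Qed.

Fact Ctau_dhv p q x :
  Ctau_dh p q (bar_d (Xtau p.+1) q x) = bar_d (Xtau p) q (Ctau_dh p q.+1 x).
Proof. by apply: chain_map_d => g m; apply: dtau_equiv. Qed.

(* The double complex F_* (x)_{SL_2(A)} X^tau_*, with F the bar resolution. *)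
Definition Ctau : bicomplex :=
  @Bicomplex (fun p q => chain (Xtau p) q) Ctau_dh (fun p q => bar_d (Xtau p) q)
    Ctau_dhK (fun p q => @bar_dK G (Xtau p) q) Ctau_dhv.

Definition RP : zmodType := 'H_0(SL2 A, Z2).

(* 'H_0(SL2 A, X 2) is the group of coinvariants of X 2, isomorphic to the group
   ring Z[A^x / (A^x)^2]; only the kernel of lambda1 is used. *)
Definition lambda1 : {additive RP -> 'H_0(SL2 A, X 2)} :=
  @group_homology_map G G gid Z2 (X 2) Z2_X2 Z2_X2_equiv 0.

Definition RP1 : zmodType := subg (Ker lambda1).

Fact edge_cycles (x : tot Ctau) :
  x \in Zr Ctau 3 3 0 -> coord 3 0 x \in cycles (bar_d Z2) 0.
Proof. by []. Qed.

Fact edge_boundaries (x : tot Ctau) :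
  x \in Zr Ctau 3 3 0 -> x \in Br Ctau 3 3 0 -> coord 3 0 x \in Im (bar_d Z2 0).
Proof.
move=> _; rewrite unfold_in => /asboolP[y [z [yZ zB ->]]].
have y0 : coord 3 0 y = 0.
  by apply: contrapT => y0; move: yZ; rewrite unfold_in => /asboolP[_ /(_ 3%N 0%N y0)].
rewrite -[coord 3 0 _]/(coord 3 0 y + coord 3 0 z) y0 add0r {y yZ y0}.
move: zB; rewrite unfold_in => /asboolP[w _ <-].
rewrite -[coord 3 0 _]/(Ctau_dh 3 0 (w 4 0) + bar_d Z2 0 (w 3 1) *~ (-1) ^+ 3).
rewrite [Ctau_dh 3 0 _]mpush0 // add0r -raddfMz.
by apply/imP; exists (w 3%N 1%N *~ (-1) ^+ 3).
Qed.

(* The inclusion of E^3_(3,0) in E^1_(3,0) = RP: nothing maps to the (3,0) spot,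
   as X^tau_p = 0 for p > 3. It sends the class of x to the class of x_(3,0). *)
Definition edge : {additive page Ctau 3 3 0 -> RP} :=
  subquot_map edge_cycles edge_boundaries.

(* E^3_(3,0) and RP1 are the same subgroup of RP; RB is the kernel of
   d^3_(3,0) : E^3_(3,0) -> E^3_(0,2), seen inside RP1. *)
Definition RB_sub : zmodClosed RP1 :=
  preim_pred (val : {additive RP1 -> RP}) (image_pred edge (Ker (page_d Ctau 3 3 0))).

Definition RB : zmodType := subg RB_sub.

End LineComplex.

(* Main.v *)
(* Write Z_0 = ker(X_0 -> Z), Z_1 = ker(X_1 -> X_0), G = SL_2(A), Gamma = SM_2(A).
   By exactness of X below degree 2 there are connecting maps
     H_3(G, Z) -> H_2(G, Z_0) -> H_1(G, Z_1) -> H_0(G, Z_2) = RP(A),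
   and lifting a class along them step by step produces exactly a cycle of the
   total complex, so the image of the composite is RB(A), by definition of
   d^3_(3,0). For the kernel, compare with the Gamma-complex
   0 -> Z -> Y_1 -> Y_0 -> Z -> 0 spanned by the two coordinate axes and the two
   ordered pairs they form. Shapiro's lemma identifies H_q(Gamma, Y_0) and
   H_q(Gamma, Y_1) with H_q(T), H_q(G, X_0) with H_q(B) and H_q(G, X_1) with
   H_q(T), and H_2(T) -> H_2(B) is injective, so two applications of the four
   lemma reduce the claim to the exactness of
     H_1(Gamma, Z) -> H_1(G, Z_1) -> H_0(G, Z_2).
   Now let i^2 = -1. Every antidiagonal matrix w fixes a line <(1, c)>, hence fixes
   the chain (oo, 0, <(1, c)>) + (0, oo, <(1, c)>) of X_2, which lifts the cycle
   (oo, 0) + (0, oo); this kills the composite, as antidiagonal matrices generate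
   Gamma. Conversely mu_2(A) = {1, -1} is the stabilizer of a triple and
   [-1] (x) (oo, 0, <(1, c)>) is homologous to [w] times the above chain,
   because w^2 = -1. (The axes are distinct only if 1 <> 0 in A; over the zero
   ring RB(A) = 0 and Gamma = G.) *)
Require Import Defs.
From HB Require Import structures.
From mathcomp Require Import all_boot all_algebra ring zify.
From mathcomp Require Import boolp classical_sets.
From mathcomp Require Import finmap monalg.

Set Implicit Arguments.
Unset Strict Implicit.
Unset Printing Implicit Defensive.

Import GRing.Theory.
Local Open Scope ring_scope.

(** * Homology classes and the connecting map *)

Section AdditiveRelation.
Variables (U V : zmodType) (R : U -> V -> Prop).
Hypothesis R_total : forall u, exists v, R u v.
Hypothesis RB : forall u v u' v', R u v -> R u' v' -> R (u - u') (v - v').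
Hypothesis R0 : forall v, R 0 v -> v = 0.

(** A total additive relation that relates 0 only to 0 is the graph of a homomorphism. Connecting
    maps are obtained this way, with no choice of lifts to keep track of. *)
Definition rel_fun (u : U) : V := sval (cid (R_total u)).

Lemma rel_funE u v : R u v -> rel_fun u = v.
Proof.
move=> uv; apply/eqP; rewrite -subr_eq0; apply/eqP/R0; rewrite -(subrr u).
exact: RB (svalP (cid (R_total u))) uv.
Qed.

Lemma rel_fun_is_additive : zmod_morphism rel_fun.
Proof.
move=> x y; apply: rel_funE.
exact: RB (svalP (cid (R_total x))) (svalP (cid (R_total y))).
Qed.
HB.instance Definition _ := GRing.isZmodMorphism.Build U V rel_fun rel_fun_is_additive.

Definition rel_map : {additive U -> V} := rel_fun.

Lemma rel_mapE u v : R u v -> rel_map u = v.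
Proof. exact: rel_funE. Qed.

End AdditiveRelation.

Section HomologyClass.
Variables (C : nat -> zmodType) (d : forall n, {additive C n.+1 -> C n}).

Lemma cycleP n x : x \in cycles d n.+1 <-> d n x = 0.
Proof. by split=> [/kerP|dx]; [|exact/kerP]. Qed.

(* The junk value of [hcl] outside the cycles is 0. *)
Definition hcl n (x : C n) : homology d n :=
  class (Im (d n)) (insubd (0 : subg (cycles d n)) x).

Lemma hclB n x y : x \in cycles d n -> y \in cycles d n ->
  hcl (x - y) = hcl x - hcl y.
Proof.
move=> xZ yZ; rewrite /hcl -raddfB; congr class; apply: val_inj.
by rewrite /= !insubdK // rpredB.
Qed.

Lemma hcl_surj n (c : homology d n) : exists2 x, x \in cycles d n & hcl x = c.
Proof.
exists (val (repr c)); first exact: valP.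
by rewrite /hcl valKd class_reprK.
Qed.

Lemma hcl_eq n x y : x \in cycles d n -> y \in cycles d n ->
  hcl x = hcl y <-> exists w, d n w = x - y.
Proof.
move=> xZ yZ; split=> [/class_eq|xy].
  by rewrite /= !insubdK // => /imP.
by apply/class_eq; rewrite /= !insubdK //; apply/imP.
Qed.

Lemma hcl_eq0 n x : x \in cycles d n -> hcl x = 0 <-> exists w, d n w = x.
Proof.
move=> xZ; have <- : hcl (0 : C n) = 0.
  by rewrite -[X in hcl X](subrr x) hclB // subrr.
by rewrite hcl_eq ?rpred0 // subr0.
Qed.

End HomologyClass.

Lemma hcl_map (C C' : nat -> zmodType) (d : forall n, {additive C n.+1 -> C n})
    (d' : forall n, {additive C' n.+1 -> C' n}) (f : forall n, {additive C n -> C' n})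
    (fd : forall n x, f n (d n x) = d' n (f n.+1 x)) n (x : C n) :
  x \in cycles d n -> homology_map fd n (hcl d x) = hcl d' (f n x).
Proof.
move=> xZ; rewrite /homology_map /hcl subquot_mapE; congr class; apply: val_inj.
by rewrite /= !insubdK //; apply: cycles_map.
Qed.

Section Snake.
Variables (A B C : nat -> zmodType).
Variables (dA : forall n, {additive A n.+1 -> A n}).
Variables (dB : forall n, {additive B n.+1 -> B n}).
Variables (dC : forall n, {additive C n.+1 -> C n}).
Variables (i : forall n, {additive A n -> B n}) (p : forall n, {additive B n -> C n}).
Hypothesis dBK : forall n x, dB n (dB n.+1 x) = 0.
Hypothesis iB : forall n x, i n (dA n x) = dB n (i n.+1 x).
Hypothesis pB : forall n x, p n (dB n x) = dC n (p n.+1 x).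
Hypothesis i_inj : forall n, injective (i n).
Hypothesis ip : forall n, exact_at (i n) (p n).
Hypothesis p_surj : forall n, surjective (p n).

Lemma snake_cycle n a b : dB n b = i n a -> a \in cycles dA n.
Proof.
case: n a b => // n a b ab; apply/kerP/i_inj.
by rewrite iB -ab dBK raddf0.
Qed.

Lemma snake_cycle_dst n a b : dB n b = i n a -> p n.+1 b \in cycles dC n.+1.
Proof. by move=> ab; apply/kerP; rewrite -pB ab; apply/ip; exists a. Qed.

Definition snake_rel n (c : homology dC n.+1) (a : homology dA n) : Prop :=
  exists b y, [/\ dB n b = i n y, hcl dC (p n.+1 b) = c & hcl dA y = a].

Lemma snake_total n (c : homology dC n.+1) : exists a, snake_rel c a.
Proof.
have [x xZ <-] := hcl_surj c; have [b pb] := p_surj x.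
have : p n (dB n b) = 0 by rewrite pB pb; apply/kerP.
by case/ip=> y yb; exists (hcl dA y), b, y; rewrite pb yb.
Qed.

Lemma snake_relB n (c : homology dC n.+1) a (c' : homology dC n.+1) a' :
  snake_rel c a -> snake_rel c' a' -> snake_rel (c - c') (a - a').
Proof.
move=> [b [y [by_ <- <-]]] [b' [y' [by' <- <-]]]; exists (b - b'), (y - y').
have Z := snake_cycle_dst by_; have Z' := snake_cycle_dst by'.
have yZ := snake_cycle by_; have yZ' := snake_cycle by'.
by rewrite !raddfB by_ by' !hclB.
Qed.

(** If [p b] is the boundary of [c], lift [c] to [b']. Then [b - dB b'] is the image of some [y'],
    and [dA y' = y] by injectivity of [i]. *)
Lemma snake_rel0 n a : snake_rel (0 : homology dC n.+1) a -> a = 0.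
Proof.
move=> [b [y [by_ c0 <-]]]; apply/hcl_eq0; first exact: snake_cycle by_.
have [c dc] := (hcl_eq0 (snake_cycle_dst by_)).1 c0; have [b' pb'] := p_surj c.
have : p n.+1 (b - dB n.+1 b') = 0 by rewrite raddfB pB pb' dc subrr.
case/ip=> y' iy'; exists y'; apply: i_inj.
by rewrite iB iy' raddfB dBK subr0.
Qed.

Definition snake n : {additive homology dC n.+1 -> homology dA n} :=
  rel_map (@snake_total n) (@snake_relB n) (@snake_rel0 n).

Lemma snakeE n b y : dB n b = i n y -> snake n (hcl dC (p n.+1 b)) = hcl dA y.
Proof.
move=> ab; by rewrite /snake; apply: rel_mapE; exists b, y.
Qed.

Lemma snake_lift n (c : homology dC n.+1) :
  exists b y, dB n b = i n y /\ c = hcl dC (p n.+1 b).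
Proof. by have [a [b [y [yb <- _]]]] := snake_total c; exists b, y. Qed.

Lemma snake_exact_p n : exact_at (homology_map pB n.+1) (snake n).
Proof.
move=> c; split=> [|[u <-]].
  have [b [y [yb ->]]] := snake_lift c; rewrite (snakeE yb).
  case/(hcl_eq0 (snake_cycle yb)) => a ay.
  (* Subtracting [i a] turns the lift into a cycle without changing its image under [p]. *)
  have bZ : b - i n.+1 a \in cycles dB n.+1.
    by apply/kerP; rewrite raddfB yb -ay iB subrr.
  exists (hcl dB (b - i n.+1 a)); rewrite hcl_map //; congr hcl.
  rewrite raddfB (_ : p _ (i _ a) = 0) ?subr0 //; apply/ip; by exists a.
have [b bZ <-] := hcl_surj u; rewrite hcl_map // (@snakeE _ _ 0).
  apply/(hcl_eq0 (rpred0 _)); by exists 0; rewrite raddf0.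
by rewrite raddf0; apply/kerP.
Qed.

Lemma snake_exact_i n : exact_at (snake n) (homology_map iB n).
Proof.
move=> a; split=> [|[c <-]].
  have [y yZ <-] := hcl_surj a; rewrite hcl_map // hcl_eq0; last exact: cycles_map.
  by case=> b yb; exists (hcl dC (p n.+1 b)); rewrite (snakeE yb).
have [b [y [yb ->]]] := snake_lift c; rewrite (snakeE yb) hcl_map ?(snake_cycle yb) //.
apply/hcl_eq0; first exact/(cycles_map iB)/(snake_cycle yb).
by exists b.
Qed.

End Snake.

(** * Long exact sequences in group homology *)

Section PushCoefficients.
Variables (K : choiceType) (phi : K -> K) (phi_id : phi =1 id).
Variables (L M : zmodType) (f : {additive L -> M}).

(** Here [phi] is only pointwise the identity, because [chain_map] along the identity of a group
    rebuilds every word as a finite function. *)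
Lemma mcoeff_mpush k x : mcoeff k (mpush phi f x) = f (mcoeff k x).
Proof.
pose lhs : {additive {malg L[K]} -> M} := mcoeff k \o mpush phi f.
pose rhs : {additive {malg L[K]} -> M} := f \o mcoeff k.
rewrite -[LHS]/(lhs x) -[RHS]/(rhs x); apply: malg_ext => j m.
by rewrite {}/lhs {}/rhs /= mpushU phi_id !mcoeffU raddfMn.
Qed.

Lemma mpush_lift x : (forall k, exists m, f m = mcoeff k x) -> exists y, mpush phi f y = x.
Proof.
move=> lift; exists (\sum_(k <- msupp x) mkmalgU k (sval (cid (lift k)))).
rewrite raddf_sum [RHS]monalgE; apply: eq_bigr => k _.
by rewrite mpushU phi_id; case: (cid _) => m /= ->.
Qed.

Lemma mpush_inj : injective f -> injective (mpush phi f).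
Proof.
by move=> f_inj x y xy; apply/malgP => k; apply: f_inj; rewrite -!mcoeff_mpush xy.
Qed.

Lemma mpush_surj : surjective f -> surjective (mpush phi f).
Proof. by move=> f_surj x; apply: mpush_lift => k; apply: f_surj. Qed.

End PushCoefficients.

(** Exactness can be tested one word at a time. This expresses the freeness of the bar resolution
    and is the source of the long exact sequences. *)
Lemma mpush_exact (K : choiceType) (phi psi : K -> K) (L M N : zmodType)
    (f : {additive L -> M}) (g : {additive M -> N}) :
  phi =1 id -> psi =1 id -> exact_at f g -> exact_at (mpush phi f) (mpush psi g).
Proof.
move=> phi_id psi_id fg x; split=> [gx|[y <-]].
  apply: (mpush_lift phi_id) => k; apply/fg.
  by rewrite -(mcoeff_mpush psi_id) gx mcoeff0.
by rewrite mpush_comp0 // => m; apply/fg; exists m.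
Qed.

Local Notation gid G := (idfun : {multiplicative G -> G}).

Record gses (G : groupType) := GSES {
  gsub : gmodule G;
  gmid : gmodule G;
  gquo : gmodule G;
  ginc : {additive gsub -> gmid};
  gpro : {additive gmid -> gquo};
  ginc_equiv : equivariant ginc;
  gpro_equiv : equivariant gpro;
  ginc_inj : injective ginc;
  gses_exact : exact_at ginc gpro;
  gpro_surj : surjective gpro }.

Section LongExactSequence.
Variables (G : groupType) (S : gses G).
Local Notation i := (chain_map (gid G) (ginc S)).
Local Notation p := (chain_map (gid G) (gpro S)).

Definition inc_map n : {additive 'H_n(G, gsub S) -> 'H_n(G, gmid S)} :=
  @group_homology_map G G (gid G) _ _ (ginc S) (@ginc_equiv G S) n.
Definition pro_map n : {additive 'H_n(G, gmid S) -> 'H_n(G, gquo S)} :=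
  @group_homology_map G G (gid G) _ _ (gpro S) (@gpro_equiv G S) n.

Lemma word_id n : (fun g : {ffun 'I_n -> G} => [ffun k => gid G (g k)]) =1 id.
Proof. by move=> g; apply/ffunP => k; rewrite ffunE. Qed.

Lemma chain_inc_inj n : injective (i n).
Proof. apply: mpush_inj; [exact: word_id|exact: ginc_inj]. Qed.

Lemma chain_pro_surj n : surjective (p n).
Proof. apply: mpush_surj; [exact: word_id|exact: gpro_surj]. Qed.

Lemma chain_gses_exact n : exact_at (i n) (p n).
Proof. apply: mpush_exact; [exact: word_id|exact: word_id|exact: gses_exact]. Qed.

Definition connecting n : {additive 'H_n.+1(G, gquo S) -> 'H_n(G, gsub S)} :=
  snake (@bar_dK G (gmid S)) (@chain_map_d G G (gid G) _ _ (ginc S) (@ginc_equiv G S))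
    (@chain_map_d G G (gid G) _ _ (gpro S) (@gpro_equiv G S))
    chain_inc_inj chain_gses_exact chain_pro_surj n.

Lemma connectingE n b y : bar_d _ n b = i n y ->
  connecting n (hcl (bar_d _) (p n.+1 b)) = hcl (bar_d _) y.
Proof. exact: snakeE. Qed.

Lemma connecting_cycle n a b : bar_d _ n b = i n a -> a \in cycles (bar_d (gsub S)) n.
Proof.
apply: (snake_cycle (@bar_dK G (gmid S)) _ chain_inc_inj).
exact: (@chain_map_d G G (gid G) _ _ (ginc S) (@ginc_equiv G S)).
Qed.

Lemma connecting_lift n (c : 'H_n.+1(G, gquo S)) :
  exists b y, bar_d _ n b = i n y /\ c = hcl (bar_d _) (p n.+1 b).
Proof.
exact: (@snake_lift _ _ _ (bar_d (gsub S)) _ _ _ _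
  (@chain_map_d G G (gid G) _ _ (gpro S) (@gpro_equiv G S))
  chain_gses_exact chain_pro_surj n c).
Qed.

Lemma cycle_lift n y : y \in cycles (bar_d (gquo S)) n.+1 ->
  exists b a, p n.+1 b = y /\ bar_d (gmid S) n b = i n a.
Proof.
move=> yZ; have [b pb] := chain_pro_surj y.
have : p n (bar_d _ n b) = 0.
  by rewrite (@chain_map_d G G (gid G) _ _ (gpro S) (@gpro_equiv G S)) pb; apply/cycleP.
by case/chain_gses_exact => a ab; exists b, a.
Qed.

Lemma connecting_exact_pro n : exact_at (pro_map n.+1) (connecting n).
Proof. exact: snake_exact_p. Qed.

Lemma connecting_pro n c : connecting n (pro_map n.+1 c) = 0.
Proof. by apply/connecting_exact_pro; exists c. Qed.

Lemma connecting_exact_inc n : exact_at (connecting n) (inc_map n).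
Proof. exact: snake_exact_i. Qed.

End LongExactSequence.

Section Functoriality.
Variables (G H : groupType) (phi : {multiplicative G -> H}).
Variables (M : gmodule G) (N : gmodule H) (f : {additive M -> N}).
Hypothesis f_equiv : forall g m, f (act g m) = act (phi g) (f m).

Lemma ghm_hcl n x : x \in cycles (bar_d M) n ->
  group_homology_map f_equiv n (hcl (bar_d M) x) = hcl (bar_d N) (chain_map phi f n x).
Proof. exact: hcl_map. Qed.

End Functoriality.

Lemma chain_map_square (G H K L : groupType)
    (phi : {multiplicative G -> H}) (psi : {multiplicative H -> L})
    (phi' : {multiplicative G -> K}) (psi' : {multiplicative K -> L})
    (M : gmodule G) (N : gmodule H) (P : gmodule K) (Q : gmodule L)
    (f : {additive M -> N}) (g : {additive N -> Q})
    (f' : {additive M -> P}) (g' : {additive P -> Q}) n x :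
  (forall u, psi (phi u) = psi' (phi' u)) -> (forall m, g (f m) = g' (f' m)) ->
  chain_map psi g n (chain_map phi f n x) = chain_map psi' g' n (chain_map phi' f' n x).
Proof.
move=> phiE fE; rewrite [LHS]mpush_comp [RHS]mpush_comp; apply: eq_mpush => // u /=.
by apply/ffunP => k; rewrite !ffunE.
Qed.

Lemma ghm_square (G H K L : groupType)
    (phi : {multiplicative G -> H}) (psi : {multiplicative H -> L})
    (phi' : {multiplicative G -> K}) (psi' : {multiplicative K -> L})
    (M : gmodule G) (N : gmodule H) (P : gmodule K) (Q : gmodule L)
    (f : {additive M -> N}) (g : {additive N -> Q})
    (f' : {additive M -> P}) (g' : {additive P -> Q})
    (fe : forall u m, f (act u m) = act (phi u) (f m))
    (ge : forall u m, g (act u m) = act (psi u) (g m))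
    (fe' : forall u m, f' (act u m) = act (phi' u) (f' m))
    (ge' : forall u m, g' (act u m) = act (psi' u) (g' m)) n c :
  (forall u, psi (phi u) = psi' (phi' u)) -> (forall m, g (f m) = g' (f' m)) ->
  group_homology_map ge n (group_homology_map fe n c)
    = group_homology_map ge' n (group_homology_map fe' n c).
Proof.
move=> phiE fE; have [x xZ <-] := hcl_surj c; have xfZ := cycles_map (chain_map_d fe) xZ.
have xfZ' := cycles_map (chain_map_d fe') xZ.
rewrite (ghm_hcl fe xZ) (ghm_hcl fe' xZ) (ghm_hcl ge xfZ) (ghm_hcl ge' xfZ').
by congr hcl; apply: chain_map_square.
Qed.

Section ConnectingNatural.
Variables (G H : groupType) (phi : {multiplicative G -> H}) (S : gses G) (S' : gses H).
Variables (f1 : {additive gsub S -> gsub S'}) (f2 : {additive gmid S -> gmid S'}).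
Variable f3 : {additive gquo S -> gquo S'}.
Hypothesis f1e : forall g m, f1 (act g m) = act (phi g) (f1 m).
Hypothesis f2e : forall g m, f2 (act g m) = act (phi g) (f2 m).
Hypothesis f3e : forall g m, f3 (act g m) = act (phi g) (f3 m).
Hypothesis f12 : forall m, f2 (ginc S m) = ginc S' (f1 m).
Hypothesis f23 : forall m, f3 (gpro S m) = gpro S' (f2 m).

Lemma inc_natural n c :
  group_homology_map f2e n (inc_map S n c) = inc_map S' n (group_homology_map f1e n c).
Proof. exact: ghm_square. Qed.

Lemma pro_natural n c :
  group_homology_map f3e n (pro_map S n c) = pro_map S' n (group_homology_map f2e n c).
Proof. exact: ghm_square. Qed.

(** A lift [b] with boundary [y] for [S] is carried by [f2] and [f1] to such a pair for [S'], which
    then computes the other connecting map. *)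
Lemma connecting_natural n c :
  group_homology_map f1e n (connecting S n c) = connecting S' n (group_homology_map f3e n.+1 c).
Proof.
have [b [y [yb ->]]] := connecting_lift c; rewrite (connectingE yb).
have yZ := connecting_cycle yb; rewrite ghm_hcl // ghm_hcl; last first.
  exact: (snake_cycle_dst (@chain_map_d G G (gid G) _ _ (gpro S) (@gpro_equiv G S))
    (@chain_gses_exact _ S) yb).
rewrite (@chain_map_square _ _ _ _ _ _ phi (gid H) _ _ _ _ _ _ f2 (gpro S')) //.
symmetry; apply: connectingE; rewrite -chain_map_d // yb.
exact: chain_map_square.
Qed.

End ConnectingNatural.

(** * Normalization of bar chains and Shapiro's lemma *)

(** Combinatorial core of the prism homotopy: [F i j] is the signed i-th face of the j-th prism,
    [E i j] the signed j-th prism over the i-th face. The two diagonals of [F] telescope and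
    everything else cancels against [E]. *)
Lemma prism_sum (V : zmodType) (F E : nat -> nat -> V) (a : nat -> V) n :
  (forall i j, (i <= j)%N -> F i j.+1 = - E i j) ->
  (forall i j, (j < i)%N -> F i.+1 j = - E i j) ->
  (forall j, F j j = a j) -> (forall j, F j.+1 j = - a j.+1) ->
  \sum_(0 <= j < n.+1) \sum_(0 <= i < n.+2) F i j
    + \sum_(0 <= j < n) \sum_(0 <= i < n.+1) E i j = a 0%N - a n.+1.
Proof.
move=> Fle Flt Fd Fd'.
(* The faces [j] and [j.+1] of the j-th prism are left out of [lo j] and [hi j]; they contribute
   [a j - a j.+1]. *)
pose lo j := \sum_(0 <= i < j) F i j; pose hi j := \sum_(j.+2 <= i < n.+2) F i j.
have -> : \sum_(0 <= j < n.+1) \sum_(0 <= i < n.+2) F i j =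
    \sum_(0 <= j < n.+1) (lo j + hi j - (a j.+1 - a j)).
  apply: eq_big_nat => j /andP[_ jn].
  rewrite (big_cat_nat (n := j)) /= ?(leqW (ltnW jn)) // [X in _ + X]big_ltn ?(leqW jn) //.
  rewrite [X in _ + (_ + X)]big_ltn // Fd Fd' -/(lo j) -/(hi j) -addrA; congr (_ + _).
  by rewrite opprB addrA addrC.
have -> : \sum_(0 <= j < n) \sum_(0 <= i < n.+1) E i j =
    - \sum_(0 <= j < n) (lo j.+1 + hi j).
  rewrite -sumrN; apply: eq_big_nat => j /andP[_ jn].
  rewrite (big_cat_nat (n := j.+1)) //= ?(leqW jn) // opprD /lo /hi.
  rewrite [\sum_(j.+2 <= _ < _) _]big_add1 /=.
  rewrite -!sumrN; congr (_ + _); apply: eq_big_nat => i /andP[ji ij].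
    by rewrite Fle ?opprK.
  by rewrite Flt ?opprK.
rewrite sumrB telescope_sumr // opprB !big_split /=.
rewrite big_nat_recl // [lo 0%N]big_geq // add0r.
rewrite [\sum_(0 <= j < n.+1) hi j]big_nat_recr //= [hi n]big_geq // addr0.
by rewrite addrAC subrr add0r.
Qed.

Section IteratedLift.
Variables (K S : choiceType) (N : zmodType) (F : K -> S -> N).

Definition lift_row (g : K) : {additive {malg int[S]} -> N} :=
  mlift (fun s => *~%R (F g s)).

Lemma lift_rowU g s n : lift_row g (mkmalgU s n) = F g s *~ n.
Proof. exact: mliftU. Qed.

Definition mlift2 : {additive {malg {malg int[S]}[K]} -> N} := mlift lift_row.

Lemma mlift2U g s n : mlift2 (mkmalgU g (mkmalgU s n)) = F g s *~ n.
Proof. by rewrite -lift_rowU; apply: (mliftU lift_row). Qed.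

End IteratedLift.

(* Chains with coefficients in the permutation module Z[S]. The generator
   [vtx u s] is given by vertices u_0, ..., u_q, so that its i-th face omits u_i;
   it depends on (u, s) up to left translation by G only. *)
Section PermutationModule.
Variables (G : groupType) (S : choiceType) (sact : G -> S -> S).
Hypothesis sact1 : forall s, sact 1%g s = s.
Hypothesis sactM : forall g h s, sact (g * h)%g s = sact g (sact h s).
Variable a : G -> {additive {malg int[S]} -> {malg int[S]}}.
Hypothesis a1 : forall m, a 1%g m = m.
Hypothesis aM : forall g h m, a (g * h)%g m = a g (a h m).
Hypothesis aE : forall g s n, a g (mkmalgU s n) = mkmalgU (sact g s) n.
Let M := GModule a1 aM.

Definition edges q (u : nat -> G) : {ffun 'I_q -> G} :=
  [ffun j : 'I_q => ((u j)^-1 * u j.+1)%g].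

Definition vtx q (u : nat -> G) (s : S) : chain M q :=
  mkmalgU (edges q u) (mkmalgU (sact (u 0%N)^-1%g s) 1 : {malg int[S]}).

(** Partial products of the word, that is, the representative whose first vertex is 1. The default
    letter 1 makes the sequence constant past index q. *)
Fixpoint verts q (g : {ffun 'I_q -> G}) (j : nat) : G :=
  if j is j'.+1 then (verts g j' * oapp g 1%g (insub j'))%g else 1%g.

Lemma edges_verts q (g : {ffun 'I_q -> G}) : edges q (verts g) = g.
Proof. by apply/ffunP => j; rewrite ffunE /= valK mulKg. Qed.

Lemma verts_edges q u j : (j <= q)%N -> verts (edges q u) j = ((u 0%N)^-1 * u j)%g.
Proof.
elim: j => [|j IHj] jq /=; first by rewrite mulVg.
by rewrite IHj 1?ltnW // insubT /= ffunE /= mulgA mulgK.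
Qed.

Lemma vtx_verts q (g : {ffun 'I_q -> G}) s :
  vtx q (verts g) s = mkmalgU g (mkmalgU s 1 : {malg int[S]}).
Proof. by rewrite /vtx edges_verts /= invg1 sact1. Qed.

Lemma eq_vtx q u v s : (forall j, (j <= q)%N -> u j = v j) -> vtx q u s = vtx q v s.
Proof.
move=> uv; rewrite /vtx uv //; congr mkmalgU; apply/ffunP => j.
by rewrite !ffunE !uv // ltnW.
Qed.

Lemma vtx_translate q x u s : vtx q (fun j => x * u j)%g (sact x s) = vtx q u s.
Proof.
rewrite /vtx -sactM invgM mulgVK; congr mkmalgU.
by apply/ffunP => j; rewrite !ffunE invgM mulgA mulgVK.
Qed.

(** Each word and point of [S] give a basis element, which is the [vtx] of the partial products of
    the word. *)
Lemma chain_ext q (N : zmodType) (f f' : {additive chain M q -> N}) :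
  (forall u s, f (vtx q u s) = f' (vtx q u s)) -> f =1 f'.
Proof.
move=> ff'; apply: malg_ext => g m.
pose lhs : {additive {malg int[S]} -> N} := f \o mkmalgU g.
pose rhs : {additive {malg int[S]} -> N} := f' \o mkmalgU g.
rewrite -[LHS]/(lhs m) -[RHS]/(rhs m); apply: malg_ext => s n.
have -> : mkmalgU s n = (mkmalgU s 1 : {malg int[S]}) *~ n by rewrite -raddfMz intz.
by rewrite !raddfMz {}/lhs {}/rhs /= -vtx_verts ff'.
Qed.

Section Lift.
Variables (q : nat) (N : zmodType) (F : (nat -> G) -> S -> N).

Definition vlift : {additive chain M q -> N} := mlift2 (fun g s => F (verts g) s).

(** Up to index q, [verts (edges q u)] is [u] translated by the inverse of [u 0]. The two conditions
    say that [F] does not see the translation or the later vertices. *)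
Lemma vliftE u s :
  (forall x v t, F (fun j => x * v j)%g (sact x t) = F v t) ->
  (forall v w t, (forall j, (j <= q)%N -> v j = w j) -> F v t = F w t) ->
  vlift (vtx q u s) = F u s.
Proof.
move=> Fx Fw; have -> : vlift (vtx q u s) = F (verts (edges q u)) (sact (u 0%N)^-1%g s).
  by rewrite -[RHS]mulr1z; apply: mlift2U.
by rewrite (Fw _ _ _ (@verts_edges q u)) Fx.
Qed.

End Lift.

Lemma bar_face_vtx q i u s : (i <= q.+1)%N ->
  bar_face M q i (vtx q.+1 u s) = vtx q (u \o bump i) s.
Proof.
move=> iq; rewrite bar_faceU; congr mkmalgU.
  apply/ffunP => j; rewrite !ffunE /= !inordK ?ltnS //; last exact: ltnW.
  case: ltngtP => [ji|ij|ij]; last rewrite mulgA mulgK.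
  - by congr ((u _)^-1 * u _)%g; rewrite /bump; lia.
  - by congr ((u _)^-1 * u _)%g; rewrite /bump; lia.
  - by congr ((u _)^-1 * u _)%g; rewrite /bump; lia.
case: i iq => [|i] iq //=; rewrite ffunE /= aE -sactM; congr (mkmalgU (sact _ s) _).
by rewrite invgM invgK mulgK.
Qed.

Lemma bar_d_vtx q u s :
  bar_d M q (vtx q.+1 u s) = \sum_(0 <= i < q.+2) vtx q (u \o bump i) s *~ (-1) ^+ i.
Proof.
rewrite big_mkord; apply: eq_bigr => i _; rewrite bar_face_vtx //.
by rewrite -ltnS ltn_ord.
Qed.

(** * Moving the vertices of bar chains by a prism homotopy *)

Section Normalize.
Variable r : S -> G.

(** If [r t] carries a base point of the orbit to [t] for every [t], then each moved vertex carries
    that base point to [s]. For any [r] the formula commutes with left translation. *)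
Definition nrm (u : nat -> G) (s : S) (j : nat) : G := (u j * r (sact (u j)^-1 s))%g.

(** The i-th vertex occurs twice, first in its old and then in its new position, whence the shift
    [j.-1]. *)
Definition prism (i : nat) (u : nat -> G) (s : S) (j : nat) : G :=
  if (j <= i)%N then u j else nrm u s j.-1.

Lemma nrm_translate x u s : nrm (fun j => x * u j)%g (sact x s) = fun j => (x * nrm u s j)%g.
Proof. by apply/funext => j; rewrite /nrm -sactM invgM mulgVK mulgA. Qed.

Lemma prism_translate i x u s :
  prism i (fun j => x * u j)%g (sact x s) = fun j => (x * prism i u s j)%g.
Proof. by apply/funext => j; rewrite /prism nrm_translate; case: ifP. Qed.

Definition normalize q : {additive chain M q -> chain M q} :=
  vlift q (fun u s => vtx q (nrm u s) s).

Definition homotopy q : {additive chain M q -> chain M q.+1} :=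
  vlift q (fun u s => \sum_(0 <= j < q.+1) vtx q.+1 (prism j u s) s *~ (-1) ^+ j).

Lemma normalizeE q u s : normalize q (vtx q u s) = vtx q (nrm u s) s.
Proof.
apply: vliftE => [x v t|v w t vw]; first by rewrite nrm_translate vtx_translate.
by apply: eq_vtx => j jq; rewrite /nrm vw.
Qed.

Lemma homotopyE q u s : homotopy q (vtx q u s) =
  \sum_(0 <= j < q.+1) vtx q.+1 (prism j u s) s *~ (-1) ^+ j.
Proof.
apply: vliftE => [x v t|v w t vw]; apply: eq_big_nat => i /andP[_ iq].
  by rewrite prism_translate vtx_translate.
rewrite (@eq_vtx _ _ (prism i w t)) // => j jq; rewrite /prism /nrm.
case: leqP => ij; first by rewrite vw // (leq_trans ij).
by rewrite vw // -ltnS (ltn_predK ij).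
Qed.

Lemma normalize_d q x : normalize q (bar_d M q x) = bar_d M q (normalize q.+1 x).
Proof.
pose lhs : {additive _ -> _} := normalize q \o bar_d M q.
pose rhs : {additive _ -> _} := bar_d M q \o normalize q.+1.
rewrite -[LHS]/(lhs x) -[RHS]/(rhs x); apply: chain_ext => u s.
rewrite {}/lhs {}/rhs /= normalizeE !bar_d_vtx raddf_sum; apply: eq_bigr => i _.
by rewrite raddfMz normalizeE.
Qed.

Lemma homotopy_d q x :
  bar_d M q.+1 (homotopy q.+1 x) + homotopy q (bar_d M q x) = normalize q.+1 x - x.
Proof.
pose lhs : {additive _ -> _} :=
  (bar_d M q.+1 \o homotopy q.+1) \+ (homotopy q \o bar_d M q).
pose rhs : {additive _ -> _} := normalize q.+1 \- idfun.
rewrite -[LHS]/(lhs x) -[RHS]/(rhs x); apply: chain_ext => u s.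
rewrite {}/lhs {}/rhs /= normalizeE homotopyE bar_d_vtx !raddf_sum.
pose F i j := vtx q.+1 (prism j u s \o bump i) s *~ (-1) ^+ (i + j).
pose E i j := vtx q.+1 (prism j (u \o bump i) s) s *~ (-1) ^+ (i + j).
(* This simplex is face [j] of prism [j] and also face [j] of prism [j - 1], with opposite signs.
   The telescoping runs from [mix 0], all vertices moved, to [mix q.+2], which agrees with [u] on
   the vertices 0 to [q.+1]. *)
pose mix j k := if (k < j)%N then u k else nrm u s k.
have -> : \sum_(0 <= j < q.+2) bar_d M q.+1 (vtx q.+2 (prism j u s) s *~ (-1) ^+ j)
    = \sum_(0 <= j < q.+2) \sum_(0 <= i < q.+3) F i j.
  apply: eq_bigr => j _; rewrite raddfMz bar_d_vtx mulrz_suml; apply: eq_bigr => i _.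
  by rewrite -mulrzA -exprD.
have -> : \sum_(0 <= i < q.+2) homotopy q (vtx q (u \o bump i) s *~ (-1) ^+ i)
    = \sum_(0 <= j < q.+1) \sum_(0 <= i < q.+2) E i j.
  rewrite exchange_big /=; apply: eq_bigr => i _; rewrite raddfMz homotopyE mulrz_suml.
  by apply: eq_bigr => j _; rewrite -mulrzA -exprD addnC.
rewrite (prism_sum (a := fun j => vtx q.+1 (mix j) s)) => [|i j ij|i j ji|j|j].
- congr (_ - _); apply: eq_vtx => j jq; rewrite /mix ?ltn0 // ltnS.
  by rewrite jq.
- rewrite /F /E addnS exprS mulN1r mulrNz; apply: (congr1 (fun v => - (vtx q.+1 v s *~ _))).
  apply/funext => k; rewrite /prism /nrm /= /bump.
  by do ![case: leqP => ? /=]; do ?congr (_ * r (sact _^-1 _))%g; try congr u; lia.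
- rewrite /F /E addSn exprS mulN1r mulrNz; apply: (congr1 (fun v => - (vtx q.+1 v s *~ _))).
  apply/funext => k; rewrite /prism /nrm /= /bump.
  by do ![case: leqP => ? /=]; do ?congr (_ * r (sact _^-1 _))%g; try congr u; lia.
- rewrite /F addnn -mul2n exprM sqrrN !expr1n mulr1z; apply: (congr1 (vtx q.+1 ^~ s)).
  apply/funext => k; rewrite /mix /prism /= /bump.
  by case: (ltnP k j) => kj; rewrite ?(leq0n, add0n, add1n) ?(ltnW kj) // ltnNge kj.
- rewrite /F addSn addnn -mul2n exprS exprM sqrrN !expr1n mulr1 mulrN1z.
  apply: (congr1 (fun v => - vtx q.+1 v s)).
  apply/funext => k; rewrite /mix /prism /= /bump.
  rewrite ltnS; case: leqP => kj; first by rewrite add0n kj.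
  by rewrite add1n leqNgt ltnS (ltnW kj).
Qed.

Lemma hcl_normalize n x : x \in cycles (bar_d M) n.+1 ->
  hcl (bar_d M) (normalize n.+1 x) = hcl (bar_d M) x.
Proof.
move=> xZ; have dx := (cycleP _ _).1 xZ; have nZ : normalize n.+1 x \in cycles (bar_d M) n.+1.
  by apply/cycleP; rewrite -normalize_d dx raddf0.
apply/(hcl_eq nZ xZ).
by exists (homotopy n.+1 x); rewrite -homotopy_d dx raddf0 addr0.
Qed.

End Normalize.

Section Shapiro.
Variables (K : groupType) (iota : {multiplicative K -> G}) (s0 : S).
Hypothesis iota_inj : injective iota.
Hypothesis iota_stab : forall k, sact (iota k) s0 = s0.
Hypothesis stab_iota : forall g, sact g s0 = s0 -> exists k, iota k = g.
Hypothesis trans : forall s, exists g, sact g s0 = s.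

Let MK := trivial_gmodule K int.
Definition base_elt : {additive MK -> M} := (mkmalgU s0 : {additive int -> {malg int[S]}}).

Lemma base_elt_equiv k m : base_elt (act k m) = act (iota k) (base_elt m).
Proof. by rewrite [RHS]aE iota_stab. Qed.

Definition shapiro n : {additive integral_homology n K -> 'H_n(G, M)} :=
  group_homology_map base_elt_equiv n.

(** With [r s0 = 1] nothing moves on chains coming from [K], so [unshapiro] is a strict left inverse
    on chains and not merely one up to homotopy. *)
Let r s : G := if s == s0 then 1%g else sval (cid (trans s)).

Lemma base_move s : sact (r s) s0 = s.
Proof. by rewrite /r; case: eqP => [->|_]; [exact: sact1|case: (cid _)]. Qed.

(** Inverse of [iota] on the stabilizer of [s0], with default value 1 elsewhere. It is applied to
    edges between moved vertices, which all fix [s0]. *)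
Let kappa g : K := if pselect (exists k, iota k = g) is left e then sval (cid e) else 1%g.

Lemma kappaK g : sact g s0 = s0 -> iota (kappa g) = g.
Proof.
by move=> /stab_iota ex; rewrite /kappa; case: pselect => // e; case: (cid _).
Qed.

Lemma iotaK k : kappa (iota k) = k.
Proof. exact/iota_inj/kappaK. Qed.

Lemma nrm_base u s j : sact (nrm r u s j) s0 = s.
Proof. by rewrite sactM base_move -sactM mulgV sact1. Qed.

Lemma nrm_baseV u s j : sact (nrm r u s j)^-1%g s = s0.
Proof. by rewrite -{2}(nrm_base u s j) -sactM mulVg sact1. Qed.

Lemma edges_nrm_stab q u s j : sact (edges q (nrm r u s) j) s0 = s0.
Proof. by rewrite ffunE sactM nrm_base nrm_baseV. Qed.

Definition unshapiro q : {additive chain M q -> chain MK q} :=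
  vlift q (fun u s => mkmalgU [ffun j => kappa (edges q (nrm r u s) j)] 1 : chain MK q).

Lemma unshapiroE q u s : unshapiro q (vtx q u s) =
  mkmalgU [ffun j => kappa (edges q (nrm r u s) j)] 1.
Proof.
apply: vliftE => [x v t|v w t vw];
  apply: (congr1 (fun g => mkmalgU g _)); apply/ffunP => j; rewrite !ffunE.
  by rewrite nrm_translate invgM mulgA mulgVK.
by rewrite /nrm !vw // ltnW.
Qed.

Local Notation sh := (chain_map iota base_elt).

Lemma chain_shapiroU q g (n : MK) : sh q (mkmalgU g n) =
  mkmalgU [ffun i => iota (g i)] (mkmalgU s0 n : {malg int[S]}).
Proof. exact: chain_mapU. Qed.

Lemma chain_unshapiroK q x : sh q (unshapiro q x) = normalize r q x.
Proof.
pose lhs : {additive _ -> _} := sh q \o unshapiro q.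
rewrite -[LHS]/(lhs x); apply: chain_ext => u s; rewrite {}/lhs /= normalizeE.
rewrite unshapiroE chain_shapiroU /vtx nrm_baseV.
apply: (congr1 (fun g => mkmalgU g _)).
by apply/ffunP => j; rewrite ffunE [in LHS]ffunE kappaK ?edges_nrm_stab.
Qed.

Lemma chain_shapiroK q x : unshapiro q (sh q x) = x.
Proof.
pose lhs : {additive _ -> _} := unshapiro q \o sh q.
rewrite -[LHS]/(lhs x) -[RHS]/((idfun : {additive _ -> _}) x).
apply: malg_ext => g n; rewrite {}/lhs /= chain_shapiroU.
set g' : {ffun _ -> G} := [ffun _ => _].
have stab j : sact (verts g' j) s0 = s0.
  elim: j => [|j IHj] /=; first exact: sact1.
  rewrite sactM; case: insubP => [k _ _|_] /=; last by rewrite sact1.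
  by rewrite ffunE iota_stab.
have nrmE j : nrm r (verts g') s0 j = verts g' j.
  rewrite /nrm -{1}(stab j) -sactM mulVg sact1 /r eqxx.
  exact: mulg1.
transitivity ((mkmalgU [ffun j => kappa (edges q (nrm r (verts g') s0) j)] 1 : chain MK q) *~ n).
  exact: mlift2U.
rewrite -raddfMz intz; congr mkmalgU; apply/ffunP => j.
by rewrite !ffunE !nrmE -[RHS]iotaK /= valK /= mulKg ffunE.
Qed.

(** The Shapiro map is injective on chains, so the identity may be checked after applying it; both
    sides then become normalizations, which commute with the differential. *)
Lemma unshapiro_d q x : unshapiro q (bar_d M q x) = bar_d MK q (unshapiro q.+1 x).
Proof.
apply: (can_inj (@chain_shapiroK q)).
by rewrite (chain_map_d base_elt_equiv) !chain_unshapiroK normalize_d.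
Qed.

Lemma shapiro_inj n : injective (shapiro n).
Proof.
apply: raddf_inj => c; have [x xZ <-] := hcl_surj c; rewrite ghm_hcl //.
case/(hcl_eq0 (cycles_map (chain_map_d base_elt_equiv) xZ)) => w dw.
apply/(hcl_eq0 xZ); exists (unshapiro n.+1 w).
by rewrite -unshapiro_d dw chain_shapiroK.
Qed.

(** On homology [unshapiro] is a right inverse too, because normalization is homotopic to the
    identity. The degree is positive because [hcl_normalize] is. *)
Lemma shapiro_surj n : surjective (shapiro n.+1).
Proof.
move=> c; have [x xZ <-] := hcl_surj c; have dx := (cycleP _ _).1 xZ.
have uZ : unshapiro n.+1 x \in cycles (bar_d MK) n.+1.
  by apply/cycleP; rewrite -unshapiro_d dx raddf0.
exists (hcl (bar_d MK) (unshapiro n.+1 x)).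
rewrite /shapiro (ghm_hcl base_elt_equiv uZ) chain_unshapiroK.
exact: hcl_normalize.
Qed.

End Shapiro.
End PermutationModule.

(** * Lines in the plane over a commutative ring *)

Section Lines.
Variable A : comPzRingType.
Local Open Scope classical_set_scope.
Implicit Types (g : SL2 A) (u v : 'cV[A]_2) (L : line A).
Local Notation span := Defs.span.

Definition cv2 (x y : A) : 'cV[A]_2 := \col_i (if i == 0 then x else y).

Lemma mx2E (M : 'M[A]_2) :
  M = mx2 (M ord0 ord0) (M ord0 ord_max) (M ord_max ord0) (M ord_max ord_max).
Proof.
apply/matrixP => i j; rewrite !mxE.
by case: i => -[|[|//]] i2; case: j => -[|[|//]] j2 /=; congr (M _ _); apply: val_inj.
Qed.

Lemma cv2_inj x y z w : cv2 x y = cv2 z w -> x = z /\ y = w.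
Proof.
by move=> E; split; [have := congr1 (fun u : 'cV_2 => u ord0 ord0) E
  |have := congr1 (fun u : 'cV_2 => u ord_max ord0) E]; rewrite !mxE.
Qed.

Lemma scale_cv2 c x y : c *: cv2 x y = cv2 (c * x) (c * y).
Proof. by apply/matrixP => i j; rewrite !mxE; case: ifP. Qed.

Lemma mx2_cv2 a b c d x y : mx2 a b c d *m cv2 x y = cv2 (a * x + b * y) (c * x + d * y).
Proof.
by apply/matrixP => i j; rewrite !mxE !big_ord_recl big_ord0 !mxE /= addr0; case: ifP.
Qed.

Lemma row_cv2 x y z w :
  row_mx (cv2 x y) (cv2 z w) = (mx2 x z y w : 'M[A]_(2, 1 + 1)).
Proof.
apply/matrixP => i j; rewrite !mxE; case: splitP => k jk; rewrite !mxE.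
  by have -> : (j == 0) = true by rewrite -val_eqE /= jk (ord1 k).
by have -> : (j == 0) = false by rewrite -val_eqE /= jk (ord1 k).
Qed.

Lemma GL2_det (M : 'M[A]_2) : GL2 M <-> exists e, \det M * e = 1.
Proof.
split=> [[N [MN _]]|[e Me]].
  by exists (\det N); rewrite -det_mulmx MN det1.
exists (e *: \adj M); split.
  by rewrite -scalemxAr mul_mx_adj scale_scalar_mx mulrC Me.
by rewrite -scalemxAl mul_adj_mx scale_scalar_mx mulrC Me.
Qed.

Lemma unimodular_cv2 x y z w e : (x * w - y * z) * e = 1 -> unimodular (cv2 x y).
Proof.
move=> xe; exists (mx2 x z y w).
  by apply/GL2_det; exists e; rewrite det_mx2 (mulrC z) xe.
exists ord0; apply/matrixP => i j; rewrite !mxE.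
by case: i => -[|[|//]] i2.
Qed.

Definition mkline u (uU : unimodular u) : line A :=
  exist (fun L : set 'cV[A]_2 => `[< is_line L >]) (span u)
    (introT (asboolP (is_line _)) (ex_intro2 (fun v => unimodular v) _ u uU erefl)).

Lemma span_id u : span u u.
Proof. by exists 1; rewrite ?scale1r. Qed.

Lemma span_eqP u v :
  span u = span v <-> (exists c, v = c *: u) /\ (exists c, u = c *: v).
Proof.
split=> [E|[[c vc] [d ud]]].
  split; first by have := span_id v; rewrite -E => -[c _ <-]; exists c.
  by have := span_id u; rewrite E => -[c _ <-]; exists c.
apply/seteqP; split=> _ [e _ <-].
  by exists (e * d) => //; rewrite -scalerA -ud.
by exists (e * c) => //; rewrite -scalerA -vc.
Qed.

Lemma line_act_span g L u : val L = span u -> val (line_act g L) = span (val g *m u).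
Proof. by move=> /= ->; rewrite span_mul. Qed.

Definition SL2_of a b c d (D : a * d - b * c = 1) : SL2 A :=
  exist (fun g : 'M[A]_2 => \det g == 1) (mx2 a b c d)
    (introT eqP (etrans (det_mx2 a b c d) D)).

Lemma SL2_val g : exists a b c d, val g = mx2 a b c d /\ a * d - b * c = 1.
Proof.
have gE := mx2E (val g); move: gE (eqP (valP g)).
move: (val g ord0 ord0) (val g ord0 ord_max) (val g ord_max ord0) (val g ord_max ord_max).
by move=> a b c d ->; rewrite det_mx2 => D; exists a, b, c, d.
Qed.

(** Other generators are multiples of the given ones, by [c] and [d] say, so their determinant is
    [c * d] times the given one, and a multiple can be a unit only if the given one is. *)
Lemma transverse_det L L' x y z w : val L = span (cv2 x y) -> val L' = span (cv2 z w) ->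
  transverse L L' <-> exists e, (x * w - y * z) * e = 1.
Proof.
move=> LE LE'; split=> [[u [v [Lu Lv /GL2_det[e]]]]|[e xe]]; last first.
  exists (cv2 x y), (cv2 z w); split=> //; rewrite row_cv2; apply/GL2_det.
  by exists e; rewrite det_mx2 (mulrC z).
have [[c uc] _] := (span_eqP (cv2 x y) u).1 (etrans (esym LE) Lu).
have [[d vd] _] := (span_eqP (cv2 z w) v).1 (etrans (esym LE') Lv).
rewrite uc vd !scale_cv2 row_cv2 det_mx2 => De; exists (c * d * e).
by rewrite -De; ring.
Qed.

(** Dividing the complementary column by the determinant, with a sign if it comes first, makes the
    determinant 1. *)
Lemma line_det L : exists x y, [/\ val L = span (cv2 x y) &
  exists z w, x * w - y * z = 1].
Proof.
have /asboolP[_ [M /GL2_det[e Me] [j ->]] LE] := valP L.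
move: Me LE; rewrite (mx2E M) det_mx2.
move: (M ord0 ord0) (M ord0 ord_max) (M ord_max ord0) (M ord_max ord_max).
move=> a b c d D; case: j => -[|[|//]] j2.
  have -> : col (Ordinal j2) (mx2 a b c d) = cv2 a c.
    by apply/matrixP => i j; rewrite !mxE.
  by exists a, c; split=> //; exists (b * e), (d * e); rewrite -D; ring.
have -> : col (Ordinal j2) (mx2 a b c d) = cv2 b d.
  by apply/matrixP => i j; rewrite !mxE.
by exists b, d; split=> //; exists (- a * e), (- c * e); rewrite -D; ring.
Qed.

Fact unimodular_inf : unimodular (cv2 1 0).
Proof. by apply: (@unimodular_cv2 _ _ 0 1 1); ring. Qed.
Fact unimodular_zero : unimodular (cv2 0 1).
Proof. by apply: (@unimodular_cv2 _ _ 1 0 (- 1)); ring. Qed.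
Fact unimodular_slope c : unimodular (cv2 1 c).
Proof. by apply: (@unimodular_cv2 _ _ 0 1 1); ring. Qed.

Definition Linf : line A := mkline unimodular_inf.
Definition Lzero : line A := mkline unimodular_zero.
Definition Lslope c : line A := mkline (unimodular_slope c).

Lemma line_act_inf g a b c d : val g = mx2 a b c d ->
  val (line_act g Linf) = span (cv2 a c).
Proof.
move=> gE; rewrite (@line_act_span _ _ (cv2 1 0)) // gE mx2_cv2.
by rewrite !mulr1 !mulr0 !addr0.
Qed.

Lemma line_act_zero g a b c d : val g = mx2 a b c d ->
  val (line_act g Lzero) = span (cv2 b d).
Proof.
move=> gE; rewrite (@line_act_span _ _ (cv2 0 1)) // gE mx2_cv2.
by rewrite !mulr1 !mulr0 !add0r.
Qed.

Lemma line_act_slope g a b c d s : val g = mx2 a b c d ->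
  val (line_act g (Lslope s)) = span (cv2 (a + b * s) (c + d * s)).
Proof.
move=> gE; rewrite (@line_act_span _ _ (cv2 1 s)) // gE mx2_cv2.
by rewrite !mulr1.
Qed.

Lemma line_trans L : exists g, line_act g Linf = L.
Proof.
have [x [y [LE [z [w D]]]]] := line_det L.
have D' : x * w - z * y = 1 by rewrite (mulrC z).
by exists (SL2_of D'); apply: val_inj; rewrite LE; apply: line_act_inf.
Qed.

Lemma stab_inf g : line_act g Linf = Linf <-> g \in @borel_pred A.
Proof.
have [a [b [c [d [gE D]]]]] := SL2_val g; split=> [/(congr1 val)|/asboolP].
  rewrite (line_act_inf gE) => /span_eqP[_ [e]]; rewrite scale_cv2 => /cv2_inj[ae ce].
  have c0 : c = 0 by rewrite ce mulr0.
  apply/asboolP; exists a, b, d; rewrite gE c0; split=> //.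
  by rewrite -D c0 mulr0 subr0.
move=> [a' [b' [c' [ac gE']]]]; apply: val_inj; rewrite (line_act_inf gE') /=.
apply/span_eqP; split; [exists c'|exists a']; rewrite scale_cv2 ?mulr0 ?mulr1 //.
by rewrite mulrC ac.
Qed.

Lemma stab_zero_diag g a b c : a * c = 1 -> val g = mx2 a b 0 c ->
  line_act g Lzero = Lzero -> b = 0.
Proof.
move=> ac gE /(congr1 val); rewrite (line_act_zero gE) => /span_eqP[_ [e]].
by rewrite scale_cv2 => /cv2_inj[-> _]; rewrite mulr0.
Qed.

Lemma stab_inf_zero g :
  line_act g Linf = Linf /\ line_act g Lzero = Lzero <-> g \in @torus_pred A.
Proof.
split=> [[/stab_inf/asboolP[a [b [c [ac gE]]]] g0]|].
  by apply/asboolP; exists a, c; rewrite gE (stab_zero_diag ac gE g0).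
move=> gT; split; first exact/stab_inf/torus_sub_borel.
have [a [b [ab gE]]] := asboolW gT; apply: val_inj; rewrite (line_act_zero gE) /=.
apply/span_eqP; split; [exists a|exists b]; rewrite scale_cv2 ?mulr0 ?mulr1 //.
by rewrite ab.
Qed.

Lemma pair_trans L L' : transverse L L' ->
  exists g, line_act g Linf = L /\ line_act g Lzero = L'.
Proof.
move=> LL'; have [x [y [LE _]]] := line_det L; have [z [w [LE' _]]] := line_det L'.
have [e De] := (transverse_det LE LE').1 LL'.
(* Only the second generator is divided by the determinant, whose inverse is [e]; its span does not
   change. *)
have D : x * (w * e) - (z * e) * y = 1 by rewrite -De; ring.
exists (SL2_of D); split; apply: val_inj; rewrite ?LE ?LE'; first exact: line_act_inf.
rewrite (@line_act_zero _ x (z * e) y (w * e)) //; apply/span_eqP.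
split; [exists (x * w - y * z)|exists e]; rewrite scale_cv2.
  by congr cv2; rewrite -[LHS]mul1r -De; ring.
by rewrite !(mulrC e).
Qed.

Lemma third_line L : transverse Linf L -> transverse Lzero L ->
  exists c c', c * c' = 1 /\ L = Lslope c.
Proof.
have [x [y [LE _]]] := line_det L.
move=> /(@transverse_det Linf L 1 0 x y erefl LE)[e De].
move=> /(@transverse_det Lzero L 0 1 x y erefl LE)[f Df].
(* The hypotheses say that [e] is the inverse of [y] and [- f] that of [x]; the slope is [y / x]. *)
exists (- (y * f)), (x * e); split.
  by transitivity (((1 * y - 0 * x) * e) * ((0 * y - 1 * x) * f)); [ring|rewrite De Df mulr1].
apply: val_inj; rewrite LE; apply/span_eqP; split.
  exists (- f); rewrite scale_cv2; congr cv2; last by ring.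
  by transitivity ((0 * y - 1 * x) * f); [rewrite Df|ring].
exists x; by rewrite scale_cv2 mulr1; congr cv2; rewrite -[LHS]mulr1 -Df; ring.
Qed.

Lemma slope_transverse c c' : c * c' = 1 ->
  transverse Linf (Lslope c) /\ transverse Lzero (Lslope c).
Proof.
move=> cc; split.
  by apply/(@transverse_det _ _ 1 0 1 c) => //; exists c'; rewrite mul1r mul0r subr0.
by apply/(@transverse_det _ _ 0 1 1 c) => //; exists (- 1); ring.
Qed.

Lemma inf_zero_transverse : transverse Linf Lzero.
Proof. by apply/(@transverse_det _ _ 1 0 0 1) => //; exists 1; ring. Qed.

Lemma transverse_sym L L' : transverse L L' -> transverse L' L.
Proof.
have [x [y [LE _]]] := line_det L; have [z [w [LE' _]]] := line_det L'.
move/(transverse_det LE LE') => [e De]; apply/(transverse_det LE' LE).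
by exists (- e); rewrite -De; ring.
Qed.

Lemma stab_slope g a b c c' : a * b = 1 -> c * c' = 1 -> val g = mx2 a 0 0 b ->
  line_act g (Lslope c) = Lslope c -> a ^+ 2 = 1.
Proof.
move=> ab cc gE /(congr1 val); rewrite (line_act_slope _ gE).
rewrite mul0r addr0 add0r => /span_eqP[_ [e]]; rewrite scale_cv2 mulr1 => /cv2_inj[ae bc].
have ba : b = a by rewrite -[b]mulr1 -cc mulrA bc ae -mulrA cc mulr1.
by rewrite expr2 -{2}ba.
Qed.

(** * Antidiagonal matrices when -1 has a square root *)

Section SquareRoot.
Variable i : A.
Hypothesis ii : i * i = -1.

Lemma swap_det c c' : c * c' = 1 -> 0 * 0 - i * c' * (i * c) = 1.
Proof. by move=> cc; rewrite -[RHS]opprK -ii -[in RHS](mulr1 (i * i)) -cc; ring. Qed.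

(** The antidiagonal matrix that has (1, c) as an eigenvector with eigenvalue [i]. *)
Definition swap_elt c c' (cc : c * c' = 1) : SL2 A := SL2_of (swap_det cc).

Lemma swap_inf c c' (cc : c * c' = 1) : line_act (swap_elt cc) Linf = Lzero.
Proof.
apply: val_inj; rewrite (@line_act_inf _ 0 (i * c') (i * c) 0) //=; apply/span_eqP.
split; [exists (- (i * c'))|exists (i * c)]; rewrite scale_cv2; congr cv2; try by ring.
by rewrite -[LHS]opprK -ii -[in LHS](mulr1 (i * i)) -cc; ring.
Qed.

Lemma swap_zero c c' (cc : c * c' = 1) : line_act (swap_elt cc) Lzero = Linf.
Proof.
apply: val_inj; rewrite (@line_act_zero _ 0 (i * c') (i * c) 0) //=; apply/span_eqP.
split; [exists (- (i * c))|exists (i * c')]; rewrite scale_cv2; congr cv2; try by ring.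
by rewrite -[LHS]opprK -ii -[in LHS](mulr1 (i * i)) -cc; ring.
Qed.

Lemma swap_slope c c' (cc : c * c' = 1) :
  line_act (swap_elt cc) (Lslope c) = Lslope c.
Proof.
apply: val_inj; rewrite (@line_act_slope _ 0 (i * c') (i * c) 0) //=.
apply/span_eqP; rewrite mul0r addr0 add0r -mulrA [c' * c]mulrC cc mulr1.
split; [exists (- i)|exists i]; rewrite scale_cv2 ?mulr1 //.
by rewrite !mulNr mulrA ii !mulNr mul1r !opprK.
Qed.

Lemma swap_monomial c c' (cc : c * c' = 1) : swap_elt cc \in @monomial_pred A.
Proof.
apply/asboolP; exists (- (i * c)), (i * c'); split; last by right; rewrite opprK.
by rewrite mulNr mulrACA ii cc mulr1 opprK.
Qed.

Lemma swap_sqr c c' (cc : c * c' = 1) :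
  val (swap_elt cc * swap_elt cc)%g = mx2 (-1) 0 0 (-1).
Proof.
rewrite sl2_valM mx2_mul; congr mx2; rewrite ?mulr0 ?mul0r ?addr0 ?add0r //.
  by rewrite mulrACA ii mulrC [c' * c]mulrC cc mul1r.
by rewrite mulrACA ii cc mulr1.
Qed.

Lemma antidiag_swap g a b : a * b = 1 -> val g = mx2 0 b (- a) 0 ->
  exists c c' (cc : c * c' = 1), g = swap_elt cc.
Proof.
(* The slope solves [i * c = - a] and [i * c' = b]. *)
move=> ab gE; have cc : i * a * (- i * b) = 1 by rewrite mulrACA mulrN ii opprK ab mulr1.
exists (i * a), (- i * b), cc; apply: val_inj; rewrite gE /=.
by congr mx2; rewrite mulrA ?mulrN ii ?opprK ?mul1r ?mulN1r.
Qed.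

End SquareRoot.

End Lines.

(** * Kernel modules *)

(** Four lemma for a single element: that [d x] lies in the image of [u3] replaces surjectivity of
    [u3]. Injectivity of [u4] lifts the preimage to [z], and surjectivity of [u1] corrects the
    difference of [x] and [u2 z]. *)
Lemma image_lift (A1 A2 A3 A4 B1 B2 B3 B4 : zmodType)
    (a : {additive A1 -> A2}) (d : {additive A2 -> A3}) (b : {additive A3 -> A4})
    (a' : {additive B1 -> B2}) (d' : {additive B2 -> B3}) (b' : {additive B3 -> B4})
    (u1 : {additive B1 -> A1}) (u2 : {additive B2 -> A2})
    (u3 : {additive B3 -> A3}) (u4 : {additive B4 -> A4}) :
  exact_at a d -> exact_at d b -> exact_at d' b' ->
  (forall x, u2 (a' x) = a (u1 x)) -> (forall x, u3 (d' x) = d (u2 x)) ->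
  (forall x, u4 (b' x) = b (u3 x)) -> surjective u1 -> injective u4 ->
  forall x, (exists y, u3 y = d x) -> exists z, u2 z = x.
Proof.
move=> ad db db' ua ud ub u1s u4i x [y yx].
have b'y : b' y = 0.
  by apply: u4i; rewrite ub yx raddf0; apply/db; exists x.
have [z dz] := (db' y).1 b'y.
have : d (x - u2 z) = 0 by rewrite raddfB -ud dz yx subrr.
case/ad => w aw; have [w' w'w] := u1s w; exists (z + a' w').
by rewrite raddfD ua w'w aw addrC subrK.
Qed.

Section KernelModule.
Variables (V W : zmodType) (f : {additive V -> W}).

Section Corestriction.
Variables (U : zmodType) (h : {additive U -> V}).
Hypothesis fh : forall x, f (h x) = 0.

Definition cores_fun (x : U) : subg (Ker f) := exist _ (h x) (introT (kerP f _) (fh x)).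
Fact cores_is_additive : zmod_morphism cores_fun.
Proof. by move=> x y; apply: val_inj; rewrite /= raddfB. Qed.
HB.instance Definition _ :=
  GRing.isZmodMorphism.Build U (subg (Ker f)) cores_fun cores_is_additive.
Definition cores : {additive U -> subg (Ker f)} := cores_fun.

End Corestriction.

Definition kinc : {additive subg (Ker f) -> V} := (val : subg (Ker f) -> V).

Lemma kincK z : f (kinc z) = 0.
Proof. exact/kerP/(valP z). Qed.

Lemma kinc_inj : injective kinc.
Proof. exact: val_inj. Qed.

Lemma ker_lift v : f v = 0 -> exists z, kinc z = v.
Proof. by move=> /kerP vZ; exists (exist _ v vZ). Qed.

End KernelModule.

Section KernelGModule.
Variables (G : groupType) (M N : gmodule G) (f : {additive M -> N}).
Hypothesis fe : equivariant f.

Fact ker_act_proof g z : f (act g (kinc f z)) = 0.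
Proof. by rewrite fe kincK raddf0. Qed.

Definition ker_act g : {additive subg (Ker f) -> subg (Ker f)} :=
  cores (h := act g \o kinc f) (ker_act_proof g).

Fact ker_act1 z : ker_act 1%g z = z.
Proof. by apply: val_inj; apply: act1. Qed.
Fact ker_actM g h z : ker_act (g * h)%g z = ker_act g (ker_act h z).
Proof. by apply: val_inj; apply: actM. Qed.

Definition kerM : gmodule G := GModule ker_act1 ker_actM.
Definition kerI : {additive kerM -> M} := kinc f.

Lemma kerI_equiv : equivariant kerI. Proof. by []. Qed.

End KernelGModule.

Section KernelSES.
Variables (G : groupType) (L M N : gmodule G).
Variables (f : {additive L -> M}) (g : {additive M -> N}).
Hypotheses (fe : equivariant f) (ge : equivariant g).

Definition ses_aug (g_surj : surjective g) : gses G.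
Proof.
apply: (@GSES G (kerM ge) M N (kerI ge) g (@kerI_equiv _ _ _ _ ge) ge) => //.
  exact: kinc_inj.
by move=> v; split=> [/ker_lift|[z <-]] //; apply: kincK.
Defined.

Hypothesis fg : exact_at f g.

Fact exact_comp x : g (f x) = 0.
Proof. by apply/fg; exists x. Qed.

Definition corM : {additive L -> kerM ge} := cores exact_comp.

Fact corM_equiv : equivariant corM.
Proof. by move=> u x; apply: val_inj; apply: fe. Qed.

Fact corM_surj : surjective corM.
Proof.
by move=> z; have /fg[x xz] := kincK z; exists x; apply: val_inj.
Qed.

(** Exactness at [M] makes [L] map onto the kernel of [g]. Together with [ses_aug] this cuts a long
    exact complex into short exact sequences. *)
Definition ses_sub (K : gmodule G) (i : {additive K -> L}) (ie : equivariant i)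
  (i_inj : injective i) (i_f : exact_at i f) : gses G.
Proof.
apply: (@GSES G K L (kerM ge) i corM ie corM_equiv i_inj _ corM_surj).
move=> x; rewrite -i_f; split=> [/(congr1 val)//|fx]; exact: val_inj.
Defined.

End KernelSES.

Lemma ker_exact (U V : zmodType) (f : {additive U -> V}) : exact_at (kinc f) f.
Proof. by move=> v; split=> [/ker_lift|[z <-]] //; apply: kincK. Qed.

(** * Configurations of lines *)

Lemma subr_swapK (V : zmodType) (x y a b : V) : x - y + a + (y - x + b) = a + b.
Proof. by rewrite addrACA -[y - x]opprB subrr add0r. Qed.

Section ShortAlternatingSums.
Variables (U V : zmodType) (face : nat -> {additive U -> V}).

Lemma alt_sum2 x : alt_sum 2 face x = face 0%N x - face 1%N x.
Proof. by rewrite /alt_sum !big_ord_recl big_ord0 addr0 mulr1z mulrN1z. Qed.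

Lemma alt_sum3 x : alt_sum 3 face x = face 0%N x - face 1%N x + face 2%N x.
Proof.
rewrite /alt_sum !big_ord_recl big_ord0 addr0 mulr1z mulrN1z addrA /=.
by rewrite /bump /= exprS expr1 mulrNN mulr1z.
Qed.

End ShortAlternatingSums.

Section Configurations.
Variable A : comPzRingType.
Local Notation G := (SL2 A : groupType).
Local Notation line := (line A).

(** The axes are indexed by booleans so that exchanging them is negation. *)
Definition end_line (b : bool) : line := if b then @Linf A else @Lzero A.

Lemma end_transverse b b' : b != b' -> transverse (end_line b) (end_line b').
Proof.
have T := inf_zero_transverse A.
by case: b; case: b' => // _; apply: transverse_sym.
Qed.

Fact seq_conf_proof k (ls : seq line) :
  (forall i j, (i < j <= k)%N -> transverse (nth (@Linf A) ls i) (nth (@Linf A) ls j)) ->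
  `[< is_conf [ffun i : 'I_k.+1 => nth (@Linf A) ls i] >].
Proof.
move=> T; apply/asboolP => i j; rewrite -val_eqE !ffunE /= neq_ltn => /orP[ij|ji].
  by apply: T; rewrite ij -ltnS ltn_ord.
by apply/transverse_sym/T; rewrite ji -ltnS ltn_ord.
Qed.

Fact pt_proof b i j : (i < j <= 0)%N ->
  transverse (nth (@Linf A) [:: end_line b] i) (nth (@Linf A) [:: end_line b] j).
Proof. by case: j => [|j]; rewrite ?ltn0 ?andbF. Qed.

Definition pt (b : bool) : conf A 0 :=
  exist (fun c => `[< is_conf c >]) _ (seq_conf_proof (@pt_proof b)).

Fact pr_proof b i j : (i < j <= 1)%N ->
  transverse (nth (@Linf A) [:: end_line b; end_line (~~ b)] i)
             (nth (@Linf A) [:: end_line b; end_line (~~ b)] j).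
Proof.
move=> ij; have [-> ->] : i = 0%N /\ j = 1%N by lia.
by apply: end_transverse; case: b.
Qed.

Definition pr (b : bool) : conf A 1 :=
  exist (fun c => `[< is_conf c >]) _ (seq_conf_proof (@pr_proof b)).

Fact tri_proof b c c' : c * c' = 1 -> forall i j, (i < j <= 2)%N ->
  transverse (nth (@Linf A) [:: end_line b; end_line (~~ b); Lslope c] i)
             (nth (@Linf A) [:: end_line b; end_line (~~ b); Lslope c] j).
Proof.
move=> /slope_transverse[Tinf Tzero].
move=> i j ij; have [[-> ->]|[[-> ->]|[-> ->]]] :
  (i = 0%N /\ j = 1%N) \/ (i = 0%N /\ j = 2%N) \/ (i = 1%N /\ j = 2%N) by lia.
- by apply: end_transverse; case: b.
- by case: b.
- by case: b.
Qed.

Definition tri (b : bool) c c' (cc : c * c' = 1) : conf A 2 :=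
  exist (fun c => `[< is_conf c >]) _ (seq_conf_proof (tri_proof b cc)).

Lemma conf_eq k (s s' : conf A k) : (forall i, val s i = val s' i) -> s = s'.
Proof. by move=> ss'; apply/val_inj/ffunP. Qed.

Lemma pt_act g b b' : line_act g (end_line b) = end_line b' ->
  conf_act g (pt b) = pt b'.
Proof. by move=> gb; apply: conf_eq => i; rewrite /= !ffunE (ord1 i). Qed.

Lemma pr_act g b b' : line_act g (end_line b) = end_line b' ->
  line_act g (end_line (~~ b)) = end_line (~~ b') -> conf_act g (pr b) = pr b'.
Proof.
move=> gb gb'; apply: conf_eq => -[[|[|//]] i2]; by rewrite /= !ffunE.
Qed.

Lemma tri_act g b b' c c' (cc : c * c' = 1) d d' (dd : d * d' = 1) :
  line_act g (end_line b) = end_line b' ->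
  line_act g (end_line (~~ b)) = end_line (~~ b') ->
  line_act g (Lslope c) = Lslope d -> conf_act g (tri b cc) = tri b' dd.
Proof.
move=> gb gb' gc; apply: conf_eq => -[[|[|[|//]]] i2]; by rewrite /= !ffunE.
Qed.

Lemma pt_trans (s : conf A 0) : exists g, conf_act g (pt true) = s.
Proof.
have [g gL] := line_trans (val s ord0); exists g; apply: conf_eq => i.
by rewrite /= !ffunE (ord1 i).
Qed.

Lemma conf_transverse k (s : conf A k) i j : i != j -> transverse (val s i) (val s j).
Proof. by have /asboolP := valP s; apply. Qed.

Lemma pr_trans (s : conf A 1) : exists g, conf_act g (pr true) = s.
Proof.
have [g [g0 g1]] := pair_trans (@conf_transverse _ s ord0 ord_max erefl).
exists g; apply: conf_eq => -[[|[|//]] i2]; rewrite /= !ffunE /= ?g0 ?g1;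
  congr (val s _); exact: val_inj.
Qed.

(** The first two lines can be moved to the axes, and a line transverse to both axes has a unit as
    its slope. *)
Lemma tri_trans (s : conf A 2) :
  exists g c c' (cc : c * c' = 1), conf_act g (tri true cc) = s.
Proof.
pose i1 : 'I_3 := Ordinal (isT : 1 < 3)%N.
have [g [g0 g1]] := pair_trans (@conf_transverse _ s ord0 i1 erefl).
pose L := line_act g^-1%g (val s ord_max).
have Ls : line_act g L = val s ord_max by rewrite -line_actM mulgV line_act1.
have gV M N : line_act g M = N -> M = line_act g^-1%g N.
  by move=> <-; rewrite -line_actM mulVg line_act1.
have T0 : transverse (@Linf A) L.
  by rewrite (gV _ _ g0); apply/transverse_act/conf_transverse.
have T1 : transverse (@Lzero A) L.
  by rewrite (gV _ _ g1); apply/transverse_act/conf_transverse.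
have [c [c' [cc Lc]]] := third_line T0 T1; exists g, c, c', cc.
apply: conf_eq => -[[|[|[|//]]] i2]; rewrite /= !ffunE /= ?g0 ?g1 -?Lc ?Ls;
  congr (val s _); exact: val_inj.
Qed.

Lemma conf_lines k (s s' : conf A k) i : s = s' -> val s i = val s' i.
Proof. by move->. Qed.

Lemma pt_stab g : conf_act g (pt true) = pt true <-> g \in @borel_pred A.
Proof.
rewrite -stab_inf; split=> [/(conf_lines ord0)|gL]; last exact: pt_act.
by rewrite /= !ffunE.
Qed.

Lemma pr_stab g : conf_act g (pr true) = pr true <-> g \in @torus_pred A.
Proof.
rewrite -stab_inf_zero; split=> [E|[g0 g1]]; last exact: pr_act.
have := conf_lines ord0 E; have := conf_lines ord_max E.
by rewrite /= !ffunE.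
Qed.

Lemma tri_stab g c c' (cc : c * c' = 1) : conf_act g (tri true cc) = tri true cc ->
  exists a, a ^+ 2 = 1 /\ val g = mx2 a 0 0 a.
Proof.
move=> E; have := conf_lines ord_max E; have := conf_lines ord0 E.
have := conf_lines (Ordinal (isT : 1 < 3)%N) E.
rewrite /= !ffunE /= => g1 g0 gc.
have /asboolP[a [b [ab gE]]] := (stab_inf_zero g).1 (conj g0 g1).
have a2 := stab_slope ab cc gE gc.
exists a; split=> //; rewrite gE; congr mx2.
by rewrite -[b]mul1r -a2 expr2 -mulrA ab mulr1.
Qed.

Lemma face0_pr b : conf_face 0 (pr b) = pt (~~ b).
Proof. by apply: conf_eq => i; rewrite /= !ffunE (ord1 i) inordK. Qed.

Lemma face1_pr b : conf_face 1 (pr b) = pt b.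
Proof. by apply: conf_eq => i; rewrite /= !ffunE (ord1 i) inordK. Qed.

Lemma face2_tri b c c' (cc : c * c' = 1) : conf_face 2 (tri b cc) = pr b.
Proof. by apply: conf_eq => -[[|[|//]] i2]; rewrite /= !ffunE inordK. Qed.

Lemma face01_tri b c c' (cc : c * c' = 1) :
  conf_face 0 (tri b cc) = conf_face 1 (tri (~~ b) cc).
Proof.
by apply: conf_eq => -[[|[|//]] i2]; rewrite /= !ffunE !inordK //= negbK.
Qed.

Lemma XactU k g (s : conf A k) n : Xact k g (mkmalgU s n) = mkmalgU (conf_act g s) n.
Proof. exact: mpushU. Qed.

Lemma bd0U (s : conf A 1) n :
  bd A 0 (mkmalgU s n) = mkmalgU (conf_face 0 s) n - mkmalgU (conf_face 1 s) n.
Proof.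
have fE i : mpush (@conf_face A 0 i) idfun (mkmalgU s n) = mkmalgU (conf_face i s) n.
  exact: mpushU.
by rewrite -!fE; apply: alt_sum2.
Qed.

Lemma bd1U (s : conf A 2) n :
  bd A 1 (mkmalgU s n) = mkmalgU (conf_face 0 s) n - mkmalgU (conf_face 1 s) n
    + mkmalgU (conf_face 2 s) n.
Proof.
have fE i : mpush (@conf_face A 1 i) idfun (mkmalgU s n) = mkmalgU (conf_face i s) n.
  exact: mpushU.
by rewrite -!fE; apply: alt_sum3.
Qed.

Lemma bd0_pr b n : bd A 0 (mkmalgU (pr b) n) = mkmalgU (pt (~~ b)) n - mkmalgU (pt b) n.
Proof. by rewrite bd0U face0_pr face1_pr. Qed.

(** By [face01_tri] the faces that contain the line of slope [c] cancel between the two triples,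
    leaving the two pairs of axes. *)
Lemma bd1_tri c c' (cc : c * c' = 1) n :
  bd A 1 (mkmalgU (tri true cc) n + mkmalgU (tri false cc) n)
    = mkmalgU (pr true) n + mkmalgU (pr false) n.
Proof.
have bE b : bd A 1 (mkmalgU (tri b cc) n) =
    mkmalgU (conf_face 1 (tri (~~ b) cc)) n - mkmalgU (conf_face 1 (tri b cc)) n
      + mkmalgU (pr b) n by rewrite bd1U face2_tri face01_tri.
apply: etrans (raddfD (bd A 1) (mkmalgU (tri true cc) n) (mkmalgU (tri false cc) n)) _.
apply: etrans (congr2 +%R (bE true) (bE false)) _.
exact: (@subr_swapK {malg int[conf A 1]}).
Qed.

End Configurations.

(** * The torus and the Borel subgroup *)

Section Composition.
Variables (G H K : groupType).
Variables (phi : {multiplicative G -> H}) (psi : {multiplicative H -> K}).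
Variable chi : {multiplicative G -> K}.
Variables (M : gmodule G) (N : gmodule H) (P : gmodule K).
Variables (f : {additive M -> N}) (g : {additive N -> P}) (h : {additive M -> P}).
Hypotheses (fe : forall u m, f (act u m) = act (phi u) (f m))
  (ge : forall u m, g (act u m) = act (psi u) (g m))
  (he : forall u m, h (act u m) = act (chi u) (h m)).

Lemma ghm_comp n c : (forall u, psi (phi u) = chi u) -> (forall m, g (f m) = h m) ->
  group_homology_map ge n (group_homology_map fe n c) = group_homology_map he n c.
Proof.
move=> phiE fE; have [x xZ <-] := hcl_surj c.
have xfZ := cycles_map (chain_map_d fe) xZ.
rewrite (ghm_hcl fe xZ) (ghm_hcl ge xfZ) (ghm_hcl he xZ); congr hcl.
rewrite [LHS]mpush_comp; apply: eq_mpush => // u /=.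
by apply/ffunP => k; rewrite !ffunE.
Qed.

End Composition.

Lemma ghm_id (G : groupType) (M : gmodule G) (phi : {multiplicative G -> G})
    (f : {additive M -> M}) (fe : forall u m, f (act u m) = act (phi u) (f m)) n c :
  phi =1 id -> f =1 id -> group_homology_map fe n c = c.
Proof.
move=> phiE fE; have [x xZ <-] := hcl_surj c; rewrite (ghm_hcl fe xZ); congr hcl.
rewrite -[RHS]/((idfun : {additive _ -> _}) x); apply: malg_ext => g m.
rewrite chain_mapU fE; apply: (congr1 (fun g => mkmalgU g _)).
by apply/ffunP => k; rewrite ffunE phiE.
Qed.

Section BorelRetraction.
Variable A : comPzRingType.

Fact borel_diag_det (g : B2 A) :
  val (val g) ord0 ord0 * val (val g) ord_max ord_max - 0 * 0 = 1.
Proof.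
have /asboolP[a [b [c [ac gE]]]] := valP g.
by rewrite gE !mxE /= ac mulr0 subr0.
Qed.

Fact borel_diag_torus (g : B2 A) : SL2_of (borel_diag_det g) \in @torus_pred A.
Proof.
apply/asboolP; exists (val (val g) ord0 ord0), (val (val g) ord_max ord_max).
by split=> //; rewrite -[LHS]subr0 -(mulr0 0) borel_diag_det.
Qed.

(** The quotient by the unipotent matrices. It is a retraction onto the torus, so by functoriality
    the homology of the torus injects into that of the Borel subgroup in every degree. *)
Definition borel_diag (g : B2 A) : T2 A :=
  exist (fun h => h \in @torus_pred A) (SL2_of (borel_diag_det g)) (borel_diag_torus g).

Fact borel_diagM : {morph borel_diag : g h / (g * h)%g}.
Proof.
move=> g h; apply: val_inj; apply: val_inj.
rewrite -[LHS]/(mx2 _ _ _ _) -[RHS]/(mx2 _ _ _ _ *m mx2 _ _ _ _) mx2_mul.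
have [/asboolP[a [b [c [_ gE]]]] /asboolP[d [e [f [_ hE]]]]] := (valP g, valP h).
have -> : val (val (g * h)%g) = val (val g) *m val (val h) by [].
by rewrite gE hE mx2_mul !mxE /= !mulr0 !mul0r !addr0 add0r.
Qed.
HB.instance Definition _ :=
  monoid.isMultiplicative.Build (B2 A) (T2 A) borel_diag borel_diagM.

Lemma borel_diagK (g : T2 A) : borel_diag (T2_B2 A g) = g.
Proof.
apply: val_inj; apply: val_inj; have /asboolP[a [b [ab gE]]] := valP g.
by rewrite /= gE !mxE.
Qed.

Lemma T2_B2_homology_inj n : injective (integral_homology_map n (T2_B2 A)).
Proof.
apply: (@can_inj _ _ _ (integral_homology_map n (borel_diag : {multiplicative B2 A -> T2 A}))).
pose gid : {multiplicative T2 A -> T2 A} := idfun.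
move=> c; rewrite -[RHS](@ghm_id _ _ gid idfun (fun _ _ => erefl) n c) //.
apply: ghm_comp => // u; exact: borel_diagK.
Qed.

End BorelRetraction.

(** * The monomial group acting on the two coordinate axes *)

Section MonomialModule.
Variable A : comPzRingType.
Variable i : A.
Hypothesis ii : i * i = -1.
Hypothesis nz : (1 : A) <> 0.
Local Notation G := (SL2 A : groupType).
Local Notation SM := (SM2 A).

(** If the axes coincided, one line would be transverse to itself and 0 would be a unit. *)
Lemma end_line_inj : injective (end_line A).
Proof.
have LL : @Linf A <> @Lzero A.
  move=> E; have := inf_zero_transverse A; rewrite -E.
  move/(@transverse_det _ (@Linf A) (@Linf A) 1 0 1 0 erefl erefl) => [e].
  by rewrite mulr0 mul0r subrr mul0r => /esym.
by case=> -[] //= E; case: LL.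
Qed.

Definition sgn (g : SM) : bool := val g \notin @torus_pred A.

Lemma sgn_swap g : sgn g -> exists c c' (cc : c * c' = 1), val g = swap_elt ii cc.
Proof.
move=> gT; have /asboolP[a [b [ab [gE|gE]]]] := valP g.
  by case/negP: gT; apply/asboolP; exists a, b.
exact: antidiag_swap ab gE.
Qed.

Lemma sgn_line g b : line_act (val g) (end_line A b) = end_line A (sgn g (+) b).
Proof.
case Es: (sgn g).
  by have [c [c' [cc ->]]] := sgn_swap Es; case: b; [exact: swap_inf|exact: swap_zero].
have /negbFE/stab_inf_zero[g0 g1] := Es.
by case: b.
Qed.

Lemma sgn1 : sgn 1%g = false.
Proof. by apply/negbTE; rewrite negbK; apply: torus_one. Qed.

(** The sign is read off from the action on the axes, which are distinct, so no case analysis on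
    matrices is needed. *)
Lemma sgnM g h : sgn (g * h)%g = sgn g (+) sgn h.
Proof.
apply: (@addIb false); apply: end_line_inj; rewrite -sgn_line -addbA -!sgn_line.
exact: (line_actM (val g) (val h)).
Qed.

Definition sgn_act (g : SM) (b : bool) : bool := sgn g (+) b.

Lemma sgn_act1 b : sgn_act 1%g b = b.
Proof. by rewrite /sgn_act sgn1. Qed.
Lemma sgn_actM g h b : sgn_act (g * h)%g b = sgn_act g (sgn_act h b).
Proof. by rewrite /sgn_act sgnM addbA. Qed.

Definition Yact (g : SM) : {additive {malg int[bool]} -> {malg int[bool]}} :=
  mpush (sgn_act g) idfun.

Lemma YactU g s n : Yact g (mkmalgU s n) = mkmalgU (sgn_act g s) n.
Proof. exact: mpushU. Qed.

Fact Yact1 m : Yact 1%g m = m.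
Proof.
rewrite -[RHS]/((idfun : {additive _ -> _}) m); apply: malg_ext => b n.
by rewrite YactU sgn_act1.
Qed.

Fact YactM g h m : Yact (g * h)%g m = Yact g (Yact h m).
Proof. by rewrite [RHS]mpush_comp; apply: eq_mpush => // b; apply: sgn_actM. Qed.

(** One module serves as both terms of the small complex: an ordered pair of distinct axes is
    indexed by its first entry, and a monomial matrix permutes pairs and axes by the same rule. *)
Definition Y : gmodule SM := GModule Yact1 YactM.

Definition augY : {additive Y -> int} := mlift (fun _ : bool => idfun).
Definition bdY : {additive Y -> Y} :=
  (mpush negb idfun : {additive {malg int[bool]} -> {malg int[bool]}}) \- idfun.
(** In terms of pairs this is the cycle (oo, 0) + (0, oo), which spans the kernel of [bdY]. *)
Definition normY : {additive int -> Y} :=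
  (mkmalgU true : {additive int -> {malg int[bool]}}) \+ mkmalgU false.

Lemma augYU b n : augY (mkmalgU b n) = n.
Proof. exact: mliftU. Qed.
Lemma bdYU b n : bdY (mkmalgU b n) = mkmalgU (~~ b) n - mkmalgU b n.
Proof. by rewrite /bdY /= mpushU. Qed.

Lemma Y_basis (y : {malg int[bool]}) :
  y = mkmalgU true (mcoeff true y) + mkmalgU false (mcoeff false y).
Proof.
by apply/malgP => -[]; rewrite mcoeffD !mcoeffU /= ?addr0 ?add0r.
Qed.

Lemma augY_equiv : @equivariant SM Y (trivial_gmodule SM int) augY.
Proof.
move=> g m; pose lhs : {additive _ -> _} := augY \o act g.
rewrite -[LHS]/(lhs m); apply: malg_ext => b n; rewrite {}/lhs /=.
by rewrite (YactU g b n) !augYU.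
Qed.

Lemma bdY_equiv : equivariant bdY.
Proof.
move=> g m; pose lhs : {additive Y -> Y} := bdY \o act g.
pose rhs : {additive Y -> Y} := act g \o bdY.
rewrite -[LHS]/(lhs m) -[RHS]/(rhs m); apply: malg_ext => b n.
rewrite -[LHS]/(bdY (Yact g (mkmalgU b n))) -[RHS]/(Yact g (bdY (mkmalgU b n))).
rewrite YactU !bdYU; apply: etrans (esym (raddfB (Yact g) _ _)).
by rewrite !YactU /sgn_act addbN.
Qed.

Lemma normY_equiv : @equivariant SM (trivial_gmodule SM int) Y normY.
Proof.
move=> g n; apply: esym; apply: etrans (raddfD (Yact g) _ _) _; rewrite !YactU /sgn_act.
case: (sgn g) => //=; exact: addrC.
Qed.

Lemma augY_surj : surjective augY.
Proof. by move=> n; exists (mkmalgU true n); rewrite augYU. Qed.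

Lemma augYE (y : Y) : augY y = mcoeff true y + mcoeff false y.
Proof.
rewrite {1}[y]Y_basis; apply: etrans (raddfD augY _ _) _.
by rewrite !augYU.
Qed.

Lemma mcoeff_bdY b (y : {malg int[bool]}) :
  mcoeff b (bdY y) = mcoeff (~~ b) y - mcoeff b y.
Proof.
pose lhs : {additive {malg int[bool]} -> int} := mcoeff b \o bdY.
pose rhs : {additive {malg int[bool]} -> int} := mcoeff (~~ b) \- mcoeff b.
rewrite -[LHS]/(lhs y) -[RHS]/(rhs y); apply: malg_ext => c n.
rewrite -[LHS]/(mcoeff b (bdY (mkmalgU c n))) bdYU mcoeffB /= !mcoeffU.
by case: b c {lhs rhs} => -[].
Qed.

Lemma mcoeff_normY b n : mcoeff b (normY n) = n.
Proof. by rewrite mcoeffD !mcoeffU; case: b; rewrite ?addr0 ?add0r. Qed.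

Lemma bdY_exact : exact_at bdY augY.
Proof.
move=> y; rewrite augYE; split=> [y0|[z <-]]; last first.
  by rewrite !mcoeff_bdY addrA subrK subrr.
(* With coefficient sum zero, [y] is a multiple of [true] - [false], which is the boundary of
   [false]. *)
exists (mkmalgU false (mcoeff true y)); apply/malgP => b.
rewrite mcoeff_bdY !mcoeffU; case: b => /=; first by rewrite subr0.
by rewrite sub0r; apply/esym/eqP; rewrite -addr_eq0 addrC y0.
Qed.

Lemma normY_inj : injective normY.
Proof. by move=> m n /(congr1 (mcoeff true)); rewrite !mcoeff_normY. Qed.

Lemma normY_exact : exact_at normY bdY.
Proof.
move=> y; split=> [/(congr1 (mcoeff true))|[n <-]].
  rewrite mcoeff_bdY mcoeff0 => /eqP; rewrite subr_eq0 => /eqP yy.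
  by exists (mcoeff true y); apply/malgP => b; rewrite mcoeff_normY; case: b.
by apply/malgP => b; rewrite mcoeff_bdY !mcoeff_normY subrr mcoeff0.
Qed.

Definition SY0 : gses SM := ses_aug augY_equiv augY_surj.
Definition SY1 : gses SM :=
  ses_sub bdY_equiv augY_equiv bdY_exact normY_equiv normY_inj normY_exact.

Lemma torus_sub_monomial : {subset @torus_pred A <= @monomial_pred A}.
Proof.
by move=> g /asboolP[a [b [ab gE]]]; apply/asboolP; exists a, b; split=> //; left.
Qed.

Definition T2_SM2 : {multiplicative T2 A -> SM} := incl_sub torus_sub_monomial.

Lemma T2_SM2_inj : injective T2_SM2.
Proof. by move=> g h /(congr1 val) gh; apply: val_inj. Qed.

Lemma T2_SM2_stab k : sgn_act (T2_SM2 k) true = true.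
Proof. by rewrite /sgn_act /sgn (valP k). Qed.

Lemma stab_T2_SM2 g : sgn_act g true = true -> exists k, T2_SM2 k = g.
Proof.
rewrite /sgn_act addbT => /negPf/negbFE gT.
by exists (exist _ (val g) gT); apply: val_inj.
Qed.

Definition SM_swap c c' (cc : c * c' = 1) : SM :=
  exist (fun g => g \in @monomial_pred A) (swap_elt ii cc) (swap_monomial ii cc).

Lemma sgn_SM_swap c c' (cc : c * c' = 1) : sgn (SM_swap cc).
Proof.
have := swap_inf ii cc; rewrite -[swap_elt ii cc]/(val (SM_swap cc)) (sgn_line _ true).
by rewrite addbT; case: (sgn _) => // /(@end_line_inj true false).
Qed.

Lemma sgn_trans b : exists g, sgn_act g true = b.
Proof.
case: b; first by exists 1%g; apply: sgn_act1.
by exists (SM_swap (mulr1 1)); rewrite /sgn_act sgn_SM_swap.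
Qed.

Definition shY n : {additive integral_homology n (T2 A) -> 'H_n(SM, Y)} :=
  @shapiro SM bool sgn_act Yact Yact1 YactM YactU (T2 A) T2_SM2 true T2_SM2_stab n.

Lemma shY_surj n : surjective (shY n.+1).
Proof.
exact: (shapiro_surj sgn_act1 sgn_actM YactU T2_SM2_inj T2_SM2_stab stab_T2_SM2 sgn_trans).
Qed.

End MonomialModule.

(** * Comparison of the two complexes *)

Section LineModules.
Variable A : comPzRingType.
Local Notation G := (SL2 A : groupType).
Local Notation SM := (SM2 A).
Local Notation sm_sl := (SM2_SL2 A).

Lemma augU (s : conf A 0) n : aug A (mkmalgU s n) = n.
Proof. exact: mliftU. Qed.

Lemma aug_equiv : @equivariant G (X A 0) (trivial_gmodule G int) (aug A).
Proof.
move=> g m; pose lhs : {additive _ -> _} := aug A \o Xact 0 g.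
rewrite -[LHS]/(lhs m); apply: malg_ext => s n.
apply: etrans (congr1 (aug A) (XactU g s n)) _.
by apply: etrans (augU _ _) (esym (augU s n)).
Qed.

Hypothesis aug_surj : surjective (aug A).
Hypothesis exact0 : exact_at (bd A 0) (aug A).
Hypothesis exact1 : exact_at (bd A 1) (bd A 0).

Definition Z0X : gmodule G := kerM aug_equiv.
Definition Z1X : gmodule G := kerM (@bd_equiv A 0).
Definition SX0 : gses G := ses_aug aug_equiv aug_surj.
Definition SX1 : gses G :=
  ses_sub (@bd_equiv A 0) aug_equiv exact0 (@kerI_equiv _ _ _ _ (@bd_equiv A 0))
    (@kinc_inj _ _ _) (@ker_exact _ _ _).
Definition SX2 : gses G :=
  ses_sub (@bd_equiv A 1) (@bd_equiv A 0) exact1 (@Z2_X2_equiv A)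
    (@kinc_inj _ _ _) (@ker_exact _ _ _).

Definition shT n : {additive integral_homology n (T2 A) -> 'H_n(G, X A 1)} :=
  @shapiro G (conf A 1) (@conf_act A 1) (Xact 1) (@Xact1 A 1) (@XactM A 1) (@XactU A 1)
    (T2 A) (@incl _ (@torus_pred A)) (pr A true)
    (fun k => (pr_stab (val k)).2 (valP k)) n.

Definition shB n : {additive integral_homology n (B2 A) -> 'H_n(G, X A 0)} :=
  @shapiro G (conf A 0) (@conf_act A 0) (Xact 0) (@Xact1 A 0) (@XactM A 0) (@XactU A 0)
    (B2 A) (@incl _ (@borel_pred A)) (pt A true)
    (fun k => (pt_stab (val k)).2 (valP k)) n.

Lemma incl_inj (S : groupClosed G) : injective (@incl _ S).
Proof. exact: val_inj. Qed.

Lemma stab_incl (S : groupClosed G) (P : G -> Prop) :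
  (forall g, P g <-> g \in S) -> forall g, P g -> exists k : subgrp S, incl k = g.
Proof. by move=> PS g /PS gS; exists (exist _ g gS). Qed.

Lemma shT_inj n : injective (shT n).
Proof.
exact: (shapiro_inj (@conf_act1 A 1) (@conf_actM A 1) (aE := @XactU A 1)
  (@incl_inj (@torus_pred A))
  (iota_stab := fun k => (pr_stab (val k)).2 (valP k)) (stab_incl (@pr_stab A)) (@pr_trans A)).
Qed.

Lemma shT_surj n : surjective (shT n.+1).
Proof.
exact: (shapiro_surj (@conf_act1 A 1) (@conf_actM A 1) (@XactU A 1) (@incl_inj (@torus_pred A))
  (fun k => (pr_stab (val k)).2 (valP k)) (stab_incl (@pr_stab A)) (@pr_trans A)).
Qed.

Lemma shB_inj n : injective (shB n).
Proof.
exact: (shapiro_inj (@conf_act1 A 0) (@conf_actM A 0) (aE := @XactU A 0)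
  (@incl_inj (@borel_pred A))
  (iota_stab := fun k => (pt_stab (val k)).2 (valP k)) (stab_incl (@pt_stab A)) (@pt_trans A)).
Qed.

Lemma shB_surj n : surjective (shB n.+1).
Proof.
exact: (shapiro_surj (@conf_act1 A 0) (@conf_actM A 0) (@XactU A 0) (@incl_inj (@borel_pred A))
  (fun k => (pt_stab (val k)).2 (valP k)) (stab_incl (@pt_stab A)) (@pt_trans A)).
Qed.

Variable i : A.
Hypothesis ii : i * i = -1.
Hypothesis nz : (1 : A) <> 0.
Local Notation Y := (Y ii nz).

Definition Y_X0 : {additive Y -> X A 0} :=
  (mpush (pt A) idfun : {additive {malg int[bool]} -> {malg int[conf A 0]}}).
Definition Y_X1 : {additive Y -> X A 1} :=
  (mpush (pr A) idfun : {additive {malg int[bool]} -> {malg int[conf A 1]}}).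

Lemma Y_X0U b n : Y_X0 (mkmalgU b n) = mkmalgU (pt A b) n.
Proof. exact: mpushU. Qed.
Lemma Y_X1U b n : Y_X1 (mkmalgU b n) = mkmalgU (pr A b) n.
Proof. exact: mpushU. Qed.

Lemma Y_X0_equiv g m : Y_X0 (act g m) = act (sm_sl g) (Y_X0 m).
Proof.
pose lhs : {additive {malg int[bool]} -> {malg int[conf A 0]}} := Y_X0 \o Yact g.
pose rhs : {additive {malg int[bool]} -> {malg int[conf A 0]}} := Xact 0 (val g) \o Y_X0.
rewrite -[LHS]/(lhs m) -[RHS]/(rhs m); apply: malg_ext => b n.
rewrite -[LHS]/(Y_X0 (Yact g (mkmalgU b n))) -[RHS]/(Xact 0 (val g) (Y_X0 (mkmalgU b n))).
by rewrite YactU !Y_X0U XactU (pt_act (sgn_line ii g b)).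
Qed.

Lemma Y_X1_equiv g m : Y_X1 (act g m) = act (sm_sl g) (Y_X1 m).
Proof.
pose lhs : {additive {malg int[bool]} -> {malg int[conf A 1]}} := Y_X1 \o Yact g.
pose rhs : {additive {malg int[bool]} -> {malg int[conf A 1]}} := Xact 1 (val g) \o Y_X1.
rewrite -[LHS]/(lhs m) -[RHS]/(rhs m); apply: malg_ext => b n.
rewrite -[LHS]/(Y_X1 (Yact g (mkmalgU b n))) -[RHS]/(Xact 1 (val g) (Y_X1 (mkmalgU b n))).
have gb := sgn_line ii g b; have := sgn_line ii g (~~ b); rewrite addbN => gb'.
by rewrite YactU !Y_X1U XactU (pr_act gb gb').
Qed.

Lemma Y_X0_aug y : aug A (Y_X0 y) = augY ii nz y.
Proof.
pose lhs : {additive {malg int[bool]} -> int} := aug A \o Y_X0.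
rewrite -[LHS]/(lhs y); apply: malg_ext => b n.
by rewrite -[LHS]/(aug A (Y_X0 (mkmalgU b n))) Y_X0U augU augYU.
Qed.

Lemma Y_X1_bd y : bd A 0 (Y_X1 y) = Y_X0 (bdY ii nz y).
Proof.
pose lhs : {additive {malg int[bool]} -> {malg int[conf A 0]}} := bd A 0 \o Y_X1.
pose rhs : {additive {malg int[bool]} -> {malg int[conf A 0]}} := Y_X0 \o bdY ii nz.
rewrite -[LHS]/(lhs y) -[RHS]/(rhs y); apply: malg_ext => b n.
rewrite -[LHS]/(bd A 0 (Y_X1 (mkmalgU b n))) -[RHS]/(Y_X0 (bdY ii nz (mkmalgU b n))).
rewrite Y_X1U bd0_pr bdYU; apply: etrans (esym (raddfB Y_X0 _ _)).
by rewrite !Y_X0U.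
Qed.

Fact ZY_Z0X_proof z : aug A (Y_X0 (kinc (augY ii nz) z)) = 0.
Proof. by rewrite Y_X0_aug kincK. Qed.

Definition ZY_Z0X : {additive kerM (@augY_equiv A i ii nz) -> Z0X} :=
  cores (h := Y_X0 \o kinc (augY ii nz)) ZY_Z0X_proof.

Lemma ZY_Z0X_equiv g z : ZY_Z0X (act g z) = act (sm_sl g) (ZY_Z0X z).
Proof. by apply: val_inj; apply: Y_X0_equiv. Qed.

Fact int_Z1X_proof n : bd A 0 (Y_X1 (normY ii nz n)) = 0.
Proof.
rewrite Y_X1_bd; have -> : bdY ii nz (normY ii nz n) = 0; last exact: raddf0.
by apply/normY_exact; exists n.
Qed.

Definition int_Z1X : {additive trivial_gmodule SM int -> Z1X} :=
  cores (h := Y_X1 \o normY ii nz) int_Z1X_proof.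

Lemma int_Z1X_equiv g n : int_Z1X (act g n) = act (sm_sl g) (int_Z1X n).
Proof.
apply: val_inj; apply: etrans (Y_X1_equiv g (normY ii nz n)).
by congr (Y_X1 _); apply: (@normY_equiv A i ii nz).
Qed.

Definition hom_X0 n : {additive 'H_n(SM, Y) -> 'H_n(G, X A 0)} := group_homology_map Y_X0_equiv n.
Definition hom_X1 n : {additive 'H_n(SM, Y) -> 'H_n(G, X A 1)} := group_homology_map Y_X1_equiv n.
Definition hom_Z0X n : {additive 'H_n(SM, kerM (@augY_equiv A i ii nz)) -> 'H_n(G, Z0X)} :=
  group_homology_map ZY_Z0X_equiv n.
Definition hom_Z1X n : {additive integral_homology n SM -> 'H_n(G, Z1X)} :=
  group_homology_map int_Z1X_equiv n.

Lemma hom_X1_shY n c : hom_X1 n (shY ii nz n c) = shT n c.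
Proof. apply: ghm_comp => // m; exact: Y_X1U. Qed.

(** The line oo has stabilizer T among the monomial matrices and B in the whole group, so in Shapiro
    terms the comparison on [X A 0] is induced by the inclusion of T in B. *)
Lemma hom_X0_shY n c : hom_X0 n (shY ii nz n c) = shB n (integral_homology_map n (T2_B2 A) c).
Proof. apply: ghm_square => // m; exact: Y_X0U. Qed.

Lemma hom_X1_surj n : surjective (hom_X1 n.+1).
Proof.
by move=> c; have [d <-] := shT_surj c; exists (shY ii nz n.+1 d); apply: hom_X1_shY.
Qed.

(** Every class comes from the torus through [shY], and its image is then given by the injective map
    [shT]. *)
Lemma hom_X1_inj n : injective (hom_X1 n.+1).
Proof.
apply: raddf_inj => c; have [d <-] := @shY_surj _ _ ii nz n c.
rewrite hom_X1_shY => d0; have -> : d = 0 by apply: shT_inj; rewrite d0 raddf0.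
exact: raddf0.
Qed.

Lemma hom_X0_inj n : injective (hom_X0 n.+1).
Proof.
apply: raddf_inj => c; have [d <-] := @shY_surj _ _ ii nz n c.
rewrite hom_X0_shY => d0; have -> : d = 0; last exact: raddf0.
by apply/T2_B2_homology_inj/shB_inj; rewrite d0 !raddf0.
Qed.

Lemma hom_X0_surj n : surjective (integral_homology_map n.+1 (T2_B2 A)) -> surjective (hom_X0 n.+1).
Proof.
move=> BT c; have [b <-] := shB_surj c; have [d <-] := BT b.
by exists (shY ii nz n.+1 d); apply: hom_X0_shY.
Qed.

End LineModules.

(** * The bar complex in degrees 0, 1 and 2 *)

Lemma addrBA (V : zmodType) (x y z : V) : x - y + z = z + x - y.
Proof. by rewrite addrAC [x + z]addrC. Qed.

Lemma malg_ind (K : choiceType) (V : zmodType) (P : {malg V[K]} -> Prop) :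
  P 0 -> (forall x y, P x -> P y -> P (x - y)) -> (forall k m, P (mkmalgU k m)) ->
  forall x, P x.
Proof.
move=> P0 PB PU x; rewrite [x]monalgE; apply: big_ind => [//|y z Py Pz|k _] //.
by rewrite -[z]opprK -[- z]sub0r; apply/PB/PB.
Qed.

Section LowDegreeBar.
Variables (G : groupType) (M : gmodule G).

Definition word0 : {ffun 'I_0 -> G} := [ffun _ => 1%g].
Definition word1 (g : G) : {ffun 'I_1 -> G} := [ffun _ => g].
Definition word2 (g h : G) : {ffun 'I_2 -> G} := [ffun j => if j == ord0 then g else h].

Lemma word0E (w : {ffun 'I_0 -> G}) : w = word0.
Proof. by apply/ffunP => -[]. Qed.

Lemma word1E (w : {ffun 'I_1 -> G}) : w = word1 (w ord0).
Proof. by apply/ffunP => j; rewrite ffunE (ord1 j). Qed.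

Lemma bar_d0 g (m : M) :
  bar_d M 0 (mkmalgU (word1 g) m) = mkmalgU word0 (act g^-1%g m) - mkmalgU word0 m.
Proof.
apply: etrans (alt_sum2 (bar_face M 0) _) _.
by rewrite !bar_faceU !(word0E (bar_word _ _)) /= ffunE.
Qed.

Lemma bar_d1 g h (m : M) : bar_d M 1 (mkmalgU (word2 g h) m) =
  mkmalgU (word1 h) (act g^-1%g m) - mkmalgU (word1 (g * h)%g) m + mkmalgU (word1 g) m.
Proof.
apply: etrans (alt_sum3 (bar_face M 1) _) _.
rewrite !bar_faceU /= ffunE eqxx.
have -> : bar_word 0 (word2 g h) = word1 h.
  by apply/ffunP => j; rewrite !ffunE (ord1 j) /= -val_eqE /= inordK.
have -> : bar_word 1 (word2 g h) = word1 (g * h)%g.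
  by apply/ffunP => j; rewrite !ffunE (ord1 j) /= -!val_eqE /= !inordK.
have -> // : bar_word 2 (word2 g h) = word1 g.
by apply/ffunP => j; rewrite !ffunE (ord1 j) /= -val_eqE /= inordK.
Qed.

Lemma word1_cycle g (m : M) : act g m = m -> mkmalgU (word1 g) m \in cycles (bar_d M) 1.
Proof.
move=> gm; apply/cycleP; rewrite bar_d0 -{1}gm -actM mulVg act1.
exact: subrr.
Qed.

(** The chain is its own filling one degree up: the boundary of m (x) [1|1] is m (x) [1]. *)
Lemma hcl_word1_one (m : M) : hcl (bar_d M) (mkmalgU (word1 1%g) m : chain M 1) = 0.
Proof.
apply/hcl_eq0; first exact/word1_cycle/act1.
exists (mkmalgU (word2 1%g 1%g) m); rewrite bar_d1 mulg1 invg1 act1.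
by rewrite subrr add0r.
Qed.

(** The 2-chain m (x) [g|g] gives the relation, since g and its inverse act alike on [m]. It trades
    a square acting trivially for [g] acting on the invariant sum. *)
Lemma hcl_word1_sqr g (m : M) : act (g * g)%g m = m ->
  hcl (bar_d M) (mkmalgU (word1 (g * g)%g) m : chain M 1) =
  hcl (bar_d M) (mkmalgU (word1 g) (m + act g m) : chain M 1).
Proof.
move=> ggm; have gV : act g^-1%g m = act g m by rewrite -{1}ggm actM -actM mulVg act1.
apply/esym/hcl_eq; [|exact: word1_cycle|].
  by apply: word1_cycle; rewrite raddfD -actM ggm addrC.
exists (mkmalgU (word2 g g) m); rewrite bar_d1 gV raddfD.
exact: addrBA.
Qed.

End LowDegreeBar.

Lemma hclD (C : nat -> zmodType) (d : forall n, {additive C n.+1 -> C n}) n x y :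
  x \in cycles d n -> y \in cycles d n -> hcl d (x + y) = hcl d x + hcl d y.
Proof.
move=> xZ yZ; apply/eqP; by rewrite -subr_eq -hclB ?rpredD // addrK.
Qed.

Lemma hcl_word1_mul (G : groupType) (V : zmodType) (g h : G) (m : V) :
  let M := trivial_gmodule G V in
  hcl (bar_d M) (mkmalgU (word1 (g * h)%g) m : chain M 1) =
  hcl (bar_d M) (mkmalgU (word1 g) m : chain M 1)
    + hcl (bar_d M) (mkmalgU (word1 h) m : chain M 1).
Proof.
move=> M; have Z g' : (mkmalgU (word1 g') m : chain M 1) \in cycles (bar_d M) 1.
  exact: word1_cycle.
rewrite -(hclD (Z g) (Z h)); apply/esym/hcl_eq; [exact: rpredD|exact: Z|].
exists (mkmalgU (word2 g h) m); rewrite bar_d1.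
exact: addrBA.
Qed.

(** * One-chains with stabilizing words over orbit representatives *)

Section NormalizedGenerators.
Variables (G : groupType) (S : choiceType) (sact : G -> S -> S).
Hypothesis sact1 : forall s, sact 1%g s = s.
Hypothesis sactM : forall g h s, sact (g * h)%g s = sact g (sact h s).
Variable a : G -> {additive {malg int[S]} -> {malg int[S]}}.
Hypothesis a1 : forall m, a 1%g m = m.
Hypothesis aM : forall g h m, a (g * h)%g m = a g (a h m).
Hypothesis aE : forall g s n, a g (mkmalgU s n) = mkmalgU (sact g s) n.
Let M := GModule a1 aM.
Variable good : S -> Prop.
Hypothesis good_orbit : forall s, exists g t, good t /\ sact g t = s.

Let orbit_rep s t := good t /\ exists g, sact g t = s.

Fact orbit_rep_ex s : exists t, orbit_rep s t.
Proof. by have [g [t [gt E]]] := good_orbit s; exists t; split=> //; exists g. Qed.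

(** An equality of predicates, not just an equivalence, so that [cid] makes the same choice for all
    points of an orbit. *)
Lemma orbit_rep_act g s : orbit_rep (sact g s) = orbit_rep s.
Proof.
apply/funext => t; apply/propext; split=> -[gt [h E]]; split=> //.
  by exists (g^-1 * h)%g; rewrite sactM E -sactM mulVg.
by exists (g * h)%g; rewrite sactM E.
Qed.

(* Depends on the predicate [orbit_rep s] only, hence is constant on orbits. *)
Let rep s : S := sval (cid (orbit_rep_ex s)).

Lemma rep_act g s : rep (sact g s) = rep s.
Proof.
rewrite /rep; move: (orbit_rep_ex (sact g s)) (orbit_rep_ex s).
by rewrite orbit_rep_act => e e'; congr (sval (cid _)).
Qed.

Fact rep_move s : exists g, sact g (rep s) = s.
Proof. by rewrite /rep; case: (cid _) => t /= []. Qed.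

Lemma rep_good s : good (rep s).
Proof. by rewrite /rep; case: (cid _) => t /= []. Qed.

Let r s : G := sval (cid (rep_move s)).

Lemma r_rep s : sact (r s) (rep s) = s.
Proof. by rewrite /r; case: (cid _). Qed.

(** All points of an orbit share their representative, so both moved vertices carry it to [s], and
    the edge between them fixes it. *)
Let normalize_gen (g : {ffun 'I_1 -> G}) s n : exists k t,
  [/\ good t, sact k t = t &
      normalize sact a1 aM r 1 (mkmalgU g (mkmalgU s n : {malg int[S]}))
        = mkmalgU (word1 k) (mkmalgU t n : {malg int[S]})].
Proof.
pose v := nrm sact r (verts g) s.
have vE j : sact (v j) (rep s) = s.
  by rewrite sactM -(rep_act (verts g j)^-1%g) r_rep -sactM mulgV sact1.
exists ((v 0%N)^-1 * v 1%N)%g, (rep s); split; first exact: rep_good.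
  by rewrite sactM vE -{1}(vE 0%N) -sactM mulVg sact1.
transitivity (vtx sact a1 aM 1 v s *~ n).
  have -> : mkmalgU g (mkmalgU s n : {malg int[S]}) = vtx sact a1 aM 1 (verts g) s *~ n.
    rewrite (vtx_verts sact1); apply/esym.
    apply: etrans (esym (raddfMz (mkmalgU g) n (mkmalgU s 1 : {malg int[S]}))) _.
    by rewrite -raddfMz intz.
  by rewrite raddfMz normalizeE.
rewrite /vtx; apply: etrans (esym (raddfMz (mkmalgU _) n (mkmalgU _ 1 : {malg int[S]}))) _.
rewrite -raddfMz intz -{1}(vE 0%N) -sactM mulVg sact1 (word1E (edges _ _)) ffunE.
by [].
Qed.

Lemma orbit_section : exists r : S -> G, forall (g : {ffun 'I_1 -> G}) s n, exists k t,
  [/\ good t, sact k t = t &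
      normalize sact a1 aM r 1 (mkmalgU g (mkmalgU s n : {malg int[S]}))
        = mkmalgU (word1 k) (mkmalgU t n : {malg int[S]})].
Proof. by exists r; apply: normalize_gen. Qed.

End NormalizedGenerators.

(** * Antidiagonal matrices fix a line *)

Section Antidiagonal.
Variable A : comPzRingType.
Local Notation G := (SL2 A : groupType).
Local Notation SM := (SM2 A).
Hypothesis exact1 : exact_at (bd A 1) (bd A 0).
Variable i : A.
Hypothesis ii : i * i = -1.
Hypothesis nz : (1 : A) <> 0.
Local Notation SX2 := (SX2 exact1).
Local Notation hom_Z1X := (hom_Z1X ii nz).
Local Notation swap := (swap_elt ii).
Local Notation SM_swap := (SM_swap ii).

Definition tri_sum c c' (cc : c * c' = 1) (n : int) : X A 2 :=
  mkmalgU (tri true cc) n + mkmalgU (tri false cc) n.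

Lemma swap_tri b c c' (cc : c * c' = 1) : conf_act (swap cc) (tri b cc) = tri (~~ b) cc.
Proof.
by apply: tri_act; rewrite ?swap_slope //; case: b;
  rewrite ?(swap_inf ii cc) ?(swap_zero ii cc).
Qed.

Lemma swap_tri_sum c c' (cc : c * c' = 1) n : act (swap cc) (tri_sum cc n) = tri_sum cc n.
Proof.
apply: etrans (raddfD (Xact 2 (swap cc)) _ _) _.
apply: etrans (congr2 +%R (XactU _ _ _) (XactU _ _ _)) _.
rewrite (swap_tri true) (swap_tri false); exact: addrC.
Qed.

Lemma gpro_tri_sum c c' (cc : c * c' = 1) n : gpro SX2 (tri_sum cc n) = int_Z1X ii nz n.
Proof.
apply: val_inj; apply: etrans (bd1_tri cc n) _.
apply: esym; apply: etrans (raddfD (Y_X1 ii nz) _ _) _.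
by rewrite !Y_X1U.
Qed.

(** The swap fixes [tri_sum], so the chain on the right is a cycle; applying [gpro] gives the image
    of the left-hand generator. *)
Lemma hom_Z1X_swap c c' (cc : c * c' = 1) n :
  hom_Z1X 1 (hcl (bar_d _) (mkmalgU (word1 (SM_swap cc)) n : chain (trivial_gmodule SM int) 1))
  = pro_map SX2 1 (hcl (bar_d _) (mkmalgU (word1 (swap cc)) (tri_sum cc n) : chain (X A 2) 1)).
Proof.
have wE (H K : groupType) (f : H -> K) g : [ffun k => f (word1 g k)] = word1 (f g).
  by apply/ffunP => k; rewrite !ffunE.
rewrite /hom_Z1X ghm_hcl; last exact: word1_cycle.
rewrite /pro_map ghm_hcl; last exact/word1_cycle/swap_tri_sum.
by rewrite !chain_mapU !wE gpro_tri_sum.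
Qed.

Lemma connect_v1 c : connecting SX2 0 (hom_Z1X 1 c) = 0.
Proof.
pose M := trivial_gmodule SM int.
(* With trivial coefficients every 1-chain is a cycle, so generators can be treated one at a
   time. *)
have Z (x : chain M 1) : x \in cycles (bar_d M) 1.
  apply/cycleP; move: x; apply: malg_ind => [|x y dx dy|w n]; first exact: raddf0.
    by rewrite raddfB dx dy subrr.
  by rewrite (word1E w) bar_d0 /= subrr.
pose Phi : {additive integral_homology 1 SM -> 'H_0(G, Z2 A)} :=
  connecting SX2 0 \o hom_Z1X 1.
pose P (x : chain M 1) := Phi (hcl (bar_d M) x) = 0.
have Pswap (g : SM) n : sgn g -> P (mkmalgU (word1 g) n).
  move=> /(sgn_swap ii)[c0 [c0' [cc gE]]].
  have -> : g = SM_swap cc by apply: val_inj.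
  apply: etrans (congr1 (connecting SX2 0) (hom_Z1X_swap cc n)) _.
  exact: (@connecting_pro _ SX2 0
    (hcl (bar_d (X A 2)) (mkmalgU (word1 (swap cc)) (tri_sum cc n)))).
have [x _ <-] := hcl_surj c; rewrite -[LHS]/(Phi _) -/(P x); move: x.
apply: malg_ind => [|x y Px Py|w n].
- have h0 : hcl (bar_d M) (0 : chain M 1) = 0 by rewrite -(subrr 0) (hclB (Z 0) (Z 0)) subrr.
  by rewrite /P h0 raddf0.
- rewrite /P (hclB (Z x) (Z y)); apply: etrans (raddfB Phi _ _) _.
  by apply: etrans (congr2 (fun u v => u - v) Px Py) _; apply: subrr.
rewrite (word1E w); move: (w ord0) => g; case gs: (sgn g); first exact: Pswap.
(* Any antidiagonal element would do; slope 1 is always available. A diagonal [g] is then the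
   product of the antidiagonal [g * s] and the inverse of [s]. *)
pose s := SM_swap (mulr1 1); have ss : sgn s := sgn_SM_swap ii nz (mulr1 1).
have -> : g = (g * s * s^-1)%g by rewrite mulgK.
have sV : sgn s^-1%g.
  by have := sgnM ii nz s s^-1%g; rewrite mulgV sgn1 ss; case: (sgn _).
rewrite /P (hcl_word1_mul (g * s)%g s^-1%g n) (raddfD Phi).
have gsV : sgn (g * s)%g by rewrite (sgnM ii nz) gs ss.
by apply: etrans (congr2 +%R (Pswap _ n gsV) (Pswap _ n sV)) _; apply: addr0.
Qed.

Hypothesis mu2 : forall a : A, a ^+ 2 = 1 -> a = 1 \/ a = -1.

Lemma hom_Z1X_exact : exact_at (hom_Z1X 1) (connecting SX2 0).
Proof.
move=> x; split=> [/(connecting_exact_pro (S := SX2) x).1[c <-]|[c <-]]; last exact: connect_v1.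
pose good (t : conf A 2) := exists c c' (cc : c * c' = 1), t = tri true cc.
have good_orbit (s : conf A 2) : exists g t, good t /\ conf_act g t = s.
  have [g [c0 [c0' [cc E]]]] := tri_trans s.
  by exists g, (tri true cc); split=> //; exists c0, c0', cc.
(* The terms of a cycle need not be cycles, but after normalization each word fixes its triple, so
   each term is a cycle. *)
have [r rP] := orbit_section (@conf_act1 A 2) (@conf_actM A 2) (@Xact1 A 2) (@XactM A 2)
  good_orbit.
have [y yZ <-] := hcl_surj c.
rewrite -(hcl_normalize (@conf_act1 A 2) (@conf_actM A 2) (@XactU A 2) r yZ).
pose N := normalize (@conf_act A 2) (@Xact1 A 2) (@XactM A 2) r 1.
rewrite -/N {yZ}; pose D := bar_d (X A 2).
(* The cycle condition is carried along because [hcl] is additive on cycles only. *)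
pose Q (z : chain (X A 2) 1) := z \in cycles D 1 /\
  exists d, hom_Z1X 1 d = pro_map SX2 1 (hcl D z).
suff QN : forall z, Q (N z) by have [] := QN y.
have Q0 : Q 0.
  split; first exact: rpred0.
  exists 0; have -> : hcl D (0 : chain (X A 2) 1) = 0.
    by apply/hcl_eq0; [exact: rpred0|exists 0; rewrite raddf0].
  by rewrite !raddf0.
have QB z z' : Q z -> Q z' -> Q (z - z').
  move=> [zZ [d dz]] [zZ' [d' dz']]; split; first exact: rpredB.
  exists (d - d'); apply: etrans (raddfB (hom_Z1X 1) d d') _.
  apply: etrans (congr2 (fun u v => u - v) dz dz') _.
  by rewrite (hclB zZ zZ'); apply: esym (raddfB (pro_map SX2 1) _ _).
apply: malg_ind => [|z z' Qz Qz'|w].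
- by rewrite raddf0.
- by rewrite (raddfB N z z'); apply: (QB _ _ Qz Qz').
pose Nw : {additive {malg int[conf A 2]} -> chain (X A 2) 1} := N \o mkmalgU w.
move=> m; rewrite -[N _]/(Nw m); move: m.
apply: malg_ind => [|m m' Qm Qm'|s n].
- by rewrite raddf0.
- by rewrite (raddfB Nw m m'); apply: (QB _ _ Qm Qm').
have [k [t [[c0 [c0' [cc tE]]] kt nE]]] := rP w s n.
rewrite /Nw /= /N nE {nE}; rewrite {t}tE in kt *.
have [a0 [a2 kE]] := tri_stab kt.
have kZ : (mkmalgU (word1 k) (mkmalgU (tri true cc) n : {malg int[conf A 2]})
    : chain (X A 2) 1) \in cycles D 1.
  by apply: word1_cycle; apply: etrans (XactU _ _ _) _; rewrite kt.
split; first exact: kZ.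
(* The word is 1, whose class vanishes, or -1. *)
case: (mu2 a2) => a0E; rewrite {a0 a2}a0E in kE.
  have -> : k = 1%g by apply: val_inj; rewrite kE -mx2_1.
  exists 0; rewrite hcl_word1_one; exact: etrans (raddf0 _) (esym (raddf0 _)).
(* Since -1 is the square of the swap, [hcl_word1_sqr] replaces the triple by its sum with its
   swapped copy, which is [tri_sum]. *)
have kS : k = (swap cc * swap cc)%g by apply: val_inj; rewrite kE swap_sqr.
exists (hcl (bar_d _) (mkmalgU (word1 (SM_swap cc)) n : chain (trivial_gmodule SM int) 1)).
rewrite hom_Z1X_swap kS; apply: (congr1 (pro_map SX2 1)); apply: esym.
apply: etrans (hcl_word1_sqr _) _.
  by rewrite -kS; apply: etrans (XactU _ _ _) _; rewrite kt.
apply: (congr1 (fun m =>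
  hcl D (mkmalgU (word1 (swap cc)) (mkmalgU (tri true cc) n + m) : chain (X A 2) 1))).
by apply: etrans (XactU _ _ _) _; rewrite (swap_tri true).
Qed.

End Antidiagonal.

(** * The iterated connecting map *)

Section Chase.
Variable A : comPzRingType.
Local Notation G := (SL2 A : groupType).
Local Notation SM := (SM2 A).
Hypothesis aug_surj : surjective (aug A).
Hypothesis exact0 : exact_at (bd A 0) (aug A).
Hypothesis exact1 : exact_at (bd A 1) (bd A 0).
Local Notation SX0 := (SX0 aug_surj).
Local Notation SX1 := (SX1 exact0).
Local Notation SX2 := (SX2 exact1).

Definition delta : {additive integral_homology 3 G -> RP A} :=
  connecting SX2 0 \o (connecting SX1 1 \o connecting SX0 2).

Lemma chain_corM (L M N : gmodule G) (f : {additive L -> M}) (g : {additive M -> N})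
    (ge : equivariant g) (fg : exact_at f g) q x :
  chain_map (idfun : {multiplicative G -> G}) (kerI ge) q
    (chain_map (idfun : {multiplicative G -> G}) (corM ge fg) q x)
  = chain_map (idfun : {multiplicative G -> G}) f q x.
Proof.
rewrite [LHS]mpush_comp; apply: eq_mpush => // u.
by apply/ffunP => k; rewrite /= !ffunE.
Qed.

(** Each connecting map is one step of the staircase. Each next lift is taken, by [cycle_lift], of
    the very cycle just produced and not of its class, so the steps fit together on chains. *)
Lemma delta_zigzag z : (exists x, delta x = z) <->
  exists b0 b1 b2 a, [/\ bar_d (X A 0) 2 b0 = Ctau_dh A 0 2 b1,
    bar_d (X A 1) 1 b1 = Ctau_dh A 1 1 b2, bar_d (X A 2) 0 b2 = Ctau_dh A 2 0 a &
    hcl (bar_d (Z2 A)) (a : chain (Z2 A) 0) = z].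
Proof.
split=> [[x <-]|[b0 [b1 [b2 [a [d0 d1 d2 <-]]]]]].
  have [b0 [y0 [d0 ->]]] := connecting_lift (S := SX0) x.
  have y0Z := connecting_cycle (S := SX0) d0.
  have [b1 [y1 [p1 d1]]] := cycle_lift (S := SX1) y0Z.
  have y1Z := connecting_cycle (S := SX1) d1.
  have [b2 [a [p2 d2]]] := cycle_lift (S := SX2) y1Z.
  exists b0, b1, b2, a; split.
  - apply: etrans d0 _; rewrite -p1; exact: chain_corM.
  - apply: etrans d1 _; rewrite -p2; exact: chain_corM.
  - exact: d2.
  apply: esym; apply: etrans (congr1 (connecting SX2 0 \o connecting SX1 1) (connectingE d0)) _.
  rewrite -p1; apply: etrans (congr1 (connecting SX2 0) (connectingE (S := SX1) d1)) _.
  rewrite -p2; exact: (connectingE (S := SX2) d2).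
pose y0 := chain_map idfun (gpro SX1) 2 b1; pose y1 := chain_map idfun (gpro SX2) 1 b2.
have e0 : bar_d (gmid SX0) 2 b0 = chain_map idfun (ginc SX0) 2 y0.
  by apply: etrans d0 _; apply: esym (chain_corM _ _ _).
have e1 : bar_d (gmid SX1) 1 b1 = chain_map idfun (ginc SX1) 1 y1.
  by apply: etrans d1 _; apply: esym (chain_corM _ _ _).
exists (hcl (bar_d _) (chain_map idfun (gpro SX0) 3 b0)).
apply: etrans (congr1 (connecting SX2 0 \o connecting SX1 1) (connectingE e0)) _.
apply: etrans (congr1 (connecting SX2 0) (connectingE e1)) _.
exact: (connectingE (S := SX2) d2).
Qed.

Variable i : A.
Hypothesis ii : i * i = -1.
Hypothesis nz : (1 : A) <> 0.
Hypothesis mu2 : forall a : A, a ^+ 2 = 1 -> a = 1 \/ a = -1.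
Hypothesis H3_BT : surjective (integral_homology_map 3 (T2_B2 A)).
Local Notation SY0 := (SY0 ii nz).
Local Notation SY1 := (SY1 ii nz).
Local Notation hom_Z0X := (hom_Z0X ii nz).
Local Notation hom_Z1X := (hom_Z1X ii nz).
Local Notation H3 := (integral_homology_map 3 (SM2_SL2 A)).

Lemma Y_X0_gpro m : (idfun : {additive int -> int}) (gpro SY0 m) = gpro SX0 (Y_X0 ii nz m).
Proof. symmetry; exact: Y_X0_aug. Qed.

Lemma Y_X1_gpro m : ZY_Z0X ii nz (gpro SY1 m) = gpro SX1 (Y_X1 ii nz m).
Proof. apply: (@kinc_inj _ _ (aug A)); symmetry; exact: Y_X1_bd. Qed.

Lemma connecting_SY0 c : hom_Z0X 2 (connecting SY0 2 c) = connecting SX0 2 (H3 c).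
Proof.
exact: (@connecting_natural SM G (SM2_SL2 A) SY0 SX0 (ZY_Z0X ii nz) (Y_X0 ii nz) idfun
  (@ZY_Z0X_equiv A i ii nz) (@Y_X0_equiv A i ii nz) (fun _ _ => erefl)
  (fun _ => erefl) Y_X0_gpro 2 c).
Qed.

Lemma connecting_SY1 c : hom_Z1X 1 (connecting SY1 1 c) = connecting SX1 1 (hom_Z0X 2 c).
Proof.
exact: (@connecting_natural SM G (SM2_SL2 A) SY1 SX1 (int_Z1X ii nz) (Y_X1 ii nz)
  (ZY_Z0X ii nz) (@int_Z1X_equiv A i ii nz) (@Y_X1_equiv A i ii nz) (@ZY_Z0X_equiv A i ii nz)
  (fun _ => erefl) Y_X1_gpro 1 c).
Qed.

Lemma delta_ker : exact_at H3 delta.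
Proof.
move=> x; split=> [d0|[c <-]]; last first.
  apply: etrans (congr1 (connecting SX2 0 \o connecting SX1 1) (esym (connecting_SY0 c))) _.
  apply: etrans (congr1 (connecting SX2 0) (esym (connecting_SY1 _))) _.
  exact: connect_v1.
have pro0 c : H3 (pro_map SY0 3 c) = pro_map SX0 3 (hom_X0 ii nz 3 c).
  exact: (@pro_natural SM G (SM2_SL2 A) SY0 SX0 (Y_X0 ii nz) idfun
    (@Y_X0_equiv A i ii nz) (fun _ _ => erefl) Y_X0_gpro 3 c).
have inc0 c : hom_X0 ii nz 2 (inc_map SY0 2 c) = inc_map SX0 2 (hom_Z0X 2 c).
  exact: (@inc_natural SM G (SM2_SL2 A) SY0 SX0 (ZY_Z0X ii nz) (Y_X0 ii nz)
    (@ZY_Z0X_equiv A i ii nz) (@Y_X0_equiv A i ii nz) (fun _ => erefl) 2 c).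
have pro1 c : hom_Z0X 2 (pro_map SY1 2 c) = pro_map SX1 2 (hom_X1 ii nz 2 c).
  exact: (@pro_natural SM G (SM2_SL2 A) SY1 SX1 (Y_X1 ii nz) (ZY_Z0X ii nz)
    (@Y_X1_equiv A i ii nz) (@ZY_Z0X_equiv A i ii nz) Y_X1_gpro 2 c).
have inc1 c : hom_X1 ii nz 1 (inc_map SY1 1 c) = inc_map SX1 1 (hom_Z1X 1 c).
  exact: (@inc_natural SM G (SM2_SL2 A) SY1 SX1 (int_Z1X ii nz) (Y_X1 ii nz)
    (@int_Z1X_equiv A i ii nz) (@Y_X1_equiv A i ii nz) (fun _ => erefl) 1 c).
(* Four lemma with the comparison on [X A 1], onto in degree 2 and injective in degree 1. *)
have lift1 y : (exists w, hom_Z1X 1 w = connecting SX1 1 y) -> exists w, hom_Z0X 2 w = y.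
  exact: (image_lift (@connecting_exact_pro _ SX1 1) (@connecting_exact_inc _ SX1 1)
    (@connecting_exact_inc _ SY1 1) pro1 connecting_SY1 inc1 (@hom_X1_surj _ _ ii nz 1)
    (@hom_X1_inj _ _ ii nz 0)).
(* Four lemma with the comparison on [X A 0]: onto in degree 3 by the assumption on T and B,
   injective in degree 2 by the retraction of B onto T. *)
have lift0 y : (exists w, hom_Z0X 2 w = connecting SX0 2 y) -> exists w, H3 w = y.
  exact: (image_lift (@connecting_exact_pro _ SX0 2) (@connecting_exact_inc _ SX0 2)
    (@connecting_exact_inc _ SY0 2) pro0 connecting_SY0 inc0
    (@hom_X0_surj _ _ ii nz 2 H3_BT) (@hom_X0_inj _ _ ii nz 1)).
by apply/lift0/lift1/(hom_Z1X_exact exact1 ii nz mu2).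
Qed.

End Chase.

(** * Total cycles and the refined Bloch group *)

Section Restriction.
Variables (U V : zmodType) (S : zmodClosed V) (f : {additive U -> V}).
Hypothesis fS : forall x, f x \in S.

Definition restrict_fun (x : U) : subg S := exist _ (f x) (fS x).
Fact restrict_is_additive : zmod_morphism restrict_fun.
Proof. by move=> x y; apply: val_inj; rewrite /= raddfB. Qed.
HB.instance Definition _ :=
  GRing.isZmodMorphism.Build U (subg S) restrict_fun restrict_is_additive.
Definition restrict : {additive U -> subg S} := restrict_fun.

End Restriction.

Section Edge.
Variable A : comPzRingType.
Local Notation G := (SL2 A : groupType).
Local Notation C := (Ctau A).

(* The signs turn a zigzag, which has none, into a cycle for [totd], where the
   vertical differential of column p carries the sign (-1)^p. *)
Definition zigzag_tot (b0 : chain (X A 0) 3) (b1 : chain (X A 1) 2)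
    (b2 : chain (X A 2) 1) (a : chain (Z2 A) 0) : tot C := fun p =>
  match p return forall q, chain (Xtau A p) q with
  | 0%N => fun q => match q return chain (Xtau A 0) q with 3%N => b0 | _ => 0 end
  | 1%N => fun q => match q return chain (Xtau A 1) q with 2%N => - b1 | _ => 0 end
  | 2%N => fun q => match q return chain (Xtau A 2) q with 1%N => - b2 | _ => 0 end
  | 3%N => fun q => match q return chain (Xtau A 3) q with 0%N => a | _ => 0 end
  | _ => fun q => 0
  end.

Definition zigzag b0 b1 b2 a := [/\ bar_d (X A 0) 2 b0 = Ctau_dh A 0 2 b1,
  bar_d (X A 1) 1 b1 = Ctau_dh A 1 1 b2 & bar_d (X A 2) 0 b2 = Ctau_dh A 2 0 a].

Lemma totd_zigzag b0 b1 b2 a : zigzag b0 b1 b2 a -> totd (zigzag_tot b0 b1 b2 a) = 0.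
Proof.
move=> [d0 d1 d2]; set x := zigzag_tot _ _ _ _.
(* This settles every position except the three of total degree 2 between consecutive entries of the
   staircase. *)
have Z p q : x p.+1 q = 0 -> x p q.+1 = 0 -> totd x p q = 0.
  by move=> xh xv; rewrite /totd xh xv !raddf0 mul0rz addr0.
apply: tot_ext; case=> [|[|[|p]]].
- case=> [|[|[|q]]]; try exact: Z.
  apply: etrans (congr2 +%R (raddfN (Ctau_dh A 0 2) b1) (mulr1z _)) _.
  by apply: etrans (congr1 (fun u => - Ctau_dh A 0 2 b1 + u) d0) _; apply: addNr.
- case=> [|[|q]]; try exact: Z.
  apply: etrans (congr2 +%R (raddfN (Ctau_dh A 1 1) b2) (mulrN1z _)) _.
  apply: etrans (congr1 (fun u => - Ctau_dh A 1 1 b2 - u) (raddfN (bar_d (X A 1) 1) b1)) _.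
  by rewrite opprK; apply: etrans (congr1 (fun u => - Ctau_dh A 1 1 b2 + u) d1) _; apply: addNr.
- case=> [|q]; try exact: Z.
  have s2 : (-1 : int) ^+ 2 = 1 by [].
  apply: etrans (congr1 (fun u => Ctau_dh A 2 0 a + bar_d (X A 2) 0 (- b2) *~ u) s2) _.
  rewrite mulr1z.
  apply: etrans (congr1 (fun u => Ctau_dh A 2 0 a + u) (raddfN (bar_d (X A 2) 0) b2)) _.
  by apply: etrans (congr1 (fun u => Ctau_dh A 2 0 a - u) d2) _; apply: subrr.
- by case: p => [|p] q; apply: Z => //; case: q.
Qed.

Lemma zigzag_supp b0 b1 b2 a p q : zigzag_tot b0 b1 b2 a p q <> 0 ->
  (p + q = 3)%N.
Proof.
by case: p => [|[|[|[|p]]]]; case: q => [|[|[|[|q]]]] //= /(_ erefl).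
Qed.

Lemma zigzag_Zr b0 b1 b2 a : zigzag b0 b1 b2 a ->
  zigzag_tot b0 b1 b2 a \in Zr C 3 3 0.
Proof.
move=> z; rewrite unfold_in; apply/asboolP; split=> p q.
- by move/zigzag_supp; lia.
- by move/zigzag_supp; lia.
by rewrite (totd_zigzag z).
Qed.

(** The condition that cuts out [RB], expressed in [RP]; [RB_sub] is its preimage in [RP1]. *)
Definition total_edge (z : RP A) := z \in (image_pred (edge A) (Ker (page_d C 3 3 0))).

Lemma edgeE x : edge A (class _ x) = class (Im (bar_d (Z2 A) 0)) (subg_map (@edge_cycles A) x).
Proof. exact: subquot_mapE. Qed.

Lemma zigzag_total_edge b0 b1 b2 a : zigzag b0 b1 b2 a -> total_edge (hcl (bar_d (Z2 A)) a).
Proof.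
move=> z; pose x : subg (Zr C 3 3 0) := exist (fun x => x \in Zr C 3 3 0) _ (zigzag_Zr z).
rewrite /total_edge unfold_in; apply/asboolP; exists (class _ x).
  apply/kerP; rewrite /page_d subquot_mapE -(raddf0 (class _)); apply/class_eq.
  by rewrite /= (totd_zigzag z) subrr rpred0.
rewrite edgeE; congr (class _ _); apply: val_inj => /=.
by rewrite insubdK.
Qed.

(** Vanishing of the differential on page 3 says that [totd x] is a boundary term of that page.
    Correcting [x] accordingly gives a true total cycle, whose coordinates form the staircase. *)
Lemma total_edge_zigzag z : total_edge z ->
  exists b0 b1 b2 a, zigzag b0 b1 b2 a /\ hcl (bar_d (Z2 A)) a = z.
Proof.
rewrite /total_edge unfold_in => /asboolP[c /kerP dc <-].
move: dc; rewrite -[c]class_reprK edgeE; move: (repr c) => x {c}.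
rewrite /page_d subquot_mapE -(raddf0 (class _)) => /class_eq; rewrite /= subr0.
rewrite unfold_in => /asboolP[s [t [sZ tI xst]]].
(* Here [s] has filtration degree -1, while columns are indexed by natural numbers. *)
have s0 : s = 0.
  apply: tot_ext => p q; apply: contrapT => spq; move: sZ; rewrite unfold_in.
  by move=> /asboolP[_ /(_ p q spq) + _]; lia.
(* Here [w] has filtration degree 2, so subtracting it does not affect the coordinate (3,0). *)
move: tI; rewrite unfold_in => /asboolP[w wZ wt].
have w30 : w 3 0 = 0.
  apply: contrapT => w30; move: wZ; rewrite unfold_in.
  by move=> /asboolP[_ /(_ 3%N 0%N w30) + _]; lia.
pose y : tot C := val x - w.
have dy p q : totd y p q = 0.
  have -> : totd y = 0; last by [].
  apply: etrans (raddfB (totd (C := C) : {additive _ -> _}) (val x) w) _.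
  apply: etrans (congr2 (fun u v => u - v) xst wt) _.
  by rewrite s0 add0r subrr.
(* The signs undo those of [zigzag_tot]. *)
exists (y 0 3), (- y 1 2), (- y 2 1), (y 3 0); split; first split.
- apply: etrans (esym (raddfN (Ctau_dh A 0 2) (y 1 2))); apply/esym/addr0_eq.
  by have := dy 0 2; rewrite /totd expr0 mulr1z.
- apply: etrans (raddfN (bar_d (X A 1) 1) (y 1 2)) _.
  apply: etrans (esym (raddfN (Ctau_dh A 1 1) (y 2 1))); apply/esym/addr0_eq.
  by have := dy 1 1; rewrite /totd expr1 mulrN1z.
- apply: etrans (raddfN (bar_d (X A 2) 0) (y 2 1)) _; apply: esym.
  have := dy 2 0; rewrite /totd (_ : (-1) ^+ 2 = 1 :> int) // mulr1z.
  by move/eqP; rewrite addr_eq0 => /eqP.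
rewrite /hcl; apply: (congr1 (class (Im (bar_d (Z2 A) 0)))).
apply: val_inj; rewrite /= insubdK //; have -> : y 3 0 = val x 3 0 - w 3 0 by [].
by rewrite w30 subr0.
Qed.

End Edge.

(** * The exact sequence *)

Section ToRB.
Variable A : comPzRingType.
Local Notation G := (SL2 A : groupType).
Hypothesis aug_surj : surjective (aug A).
Hypothesis exact0 : exact_at (bd A 0) (aug A).
Hypothesis exact1 : exact_at (bd A 1) (bd A 0).
Local Notation delta := (delta aug_surj exact0 exact1).

(** The last step of the staircase exhibits the image of [a] in [X A 2] as the boundary of [b2]. *)
Lemma delta_lambda1 x : delta x \in Ker (lambda1 A).
Proof.
have [b0 [b1 [b2 [a [_ _ d2 <-]]]]] := (delta_zigzag _ _ _ _).1 (ex_intro _ x erefl).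
apply/kerP; apply: etrans (ghm_hcl _ _) _ => //.
by apply/hcl_eq0 => //; exists b2.
Qed.

Lemma delta_RB x : restrict delta_lambda1 x \in RB_sub A.
Proof.
have [b0 [b1 [b2 [a [d0 d1 d2 az]]]]] := (delta_zigzag _ _ _ _).1 (ex_intro _ x erefl).
rewrite -[_ \in _]/(total_edge (delta x)) -az.
by apply: (@zigzag_total_edge A b0 b1 b2).
Qed.

Definition to_RB : {additive integral_homology 3 G -> RB A} := restrict delta_RB.

(** Elements of [RB] and values of [delta] are described by the same staircases. *)
Lemma to_RB_surj : surjective to_RB.
Proof.
move=> w; have [b0 [b1 [b2 [a [[d0 d1 d2] az]]]]] := total_edge_zigzag (valP w).
have [x xw] : exists x, delta x = val (val w).
  by apply/delta_zigzag; exists b0, b1, b2, a.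
by exists x; apply: val_inj; apply: val_inj.
Qed.

Lemma to_RB_eq0 x : to_RB x = 0 <-> delta x = 0.
Proof.
split=> [/(congr1 val)/(congr1 val)//|dx].
by apply: val_inj; apply: val_inj.
Qed.

End ToRB.

(** * The zero ring *)

Section ZeroRing.
Variable A : comPzRingType.
Hypothesis A0 : (1 : A) = 0.
Local Notation G := (SL2 A : groupType).

Lemma zero_ring_eq (a b : A) : a = b.
Proof. by rewrite -[a]mulr1 -[b]mulr1 A0 !mulr0. Qed.

Lemma zero_ring_SL2 (g h : SL2 A) : g = h.
Proof. by apply/val_inj/matrixP => j k; apply: zero_ring_eq. Qed.

Lemma zero_ring_conf k (s s' : conf A k) : s = s'.
Proof.
apply: conf_eq => j; apply: val_inj.
have [x [y [-> _]]] := line_det (val s j); have [z [w [-> _]]] := line_det (val s' j).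
by rewrite (zero_ring_eq x z) (zero_ring_eq y w).
Qed.

(** There is a single configuration in each degree, so the boundary of a triple, an alternating sum
    of three equal terms, is one copy of the unique pair. *)
Lemma zero_ring_Z2 (z : Z2 A) : z = 0.
Proof.
have /kerP := valP z; suff main (x : X A 2) : bd A 1 x = 0 -> x = 0.
  by move=> /main z0; apply: val_inj.
pose s0 := tri true (mulr1 (1 : A)); have [n ->] : exists n, x = mkmalgU s0 n.
  exists (mcoeff s0 x); apply/malgP => s; rewrite (zero_ring_conf s s0).
  by rewrite mcoeffUU.
rewrite bd1U => /(congr1 (mcoeff (conf_face 2 s0))).
rewrite !(zero_ring_conf (conf_face _ s0) (conf_face 2 s0)) subrr add0r mcoeffUU.
by move=> ->; rewrite mcoeff0 raddf0.
Qed.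

Lemma zero_ring_RB (w : RB A) : w = 0.
Proof.
apply: val_inj; apply: val_inj => /=; move: (val (val w)) => c.
have [a aZ <-] := hcl_surj c; apply/hcl_eq0 => //; exists 0; rewrite raddf0.
by apply/malgP => k; rewrite mcoeff0 [RHS]zero_ring_Z2.
Qed.

(** Over the zero ring the special linear group is trivial, so this constant map is a section of the
    inclusion of the monomial group. *)
Definition SL2_const (g : SL2 A) : SM2 A := 1%g.
Fact SL2_const_mul : {morph SL2_const : g h / (g * h)%g}.
Proof. by move=> g h; rewrite /SL2_const mulg1. Qed.
HB.instance Definition _ :=
  monoid.isMultiplicative.Build (SL2 A) (SM2 A) SL2_const SL2_const_mul.

Lemma zero_ring_SM2_surj n : surjective (integral_homology_map n (SM2_SL2 A)).
Proof.
move=> c; pose f : {multiplicative SL2 A -> SM2 A} := SL2_const.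
exists (integral_homology_map n f c).
rewrite -[RHS](@ghm_id _ _ (idfun : {multiplicative G -> G}) idfun (fun _ _ => erefl) n c) //.
apply: ghm_comp => // u; exact: zero_ring_SL2.
Qed.

End ZeroRing.

Theorem corollary7p12 (A : comPzRingType)
  (mu2_pm1 : forall a : A, a ^+ 2 = 1 <-> a = 1 \/ a = -1)
  (m1_square : exists a b : A, a * b = 1 /\ -1 = a ^+ 2)
  (X_exact : exact_below_2 A)
  (H3_BT : bijective (integral_homology_map 3 (T2_B2 A))) :
  exists phi : {additive integral_homology 3 (SL2 A) -> RB A},
    exact_at (integral_homology_map 3 (SM2_SL2 A)) phi /\ surjective phi.
Proof.
have [exact1 exact0 aug_surj] := X_exact.
exists (to_RB aug_surj exact0 exact1); split; last exact: to_RB_surj.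
(* The comparison complex requires two distinct axes, hence the separate treatment of [1 = 0]. *)
move=> x; have [A0|nz] := pselect ((1 : A) = 0).
  split=> _; [exact: zero_ring_SM2_surj|exact: zero_ring_RB].
have [i [_ [_ i2]]] := m1_square; have ii : i * i = -1 by rewrite i2 expr2.
have BT : surjective (integral_homology_map 3 (T2_B2 A)).
  by case: H3_BT => f _ fK y; exists (f y).
apply: iff_trans (to_RB_eq0 _ _ _ x) _.
exact: (delta_ker aug_surj exact0 exact1 ii nz (fun a => (mu2_pm1 a).1) BT).
Qed.
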